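(* Let $(S,\mathfrak n,k_0)$ be an equicharacteristic Artinian Gorenstein local ring with embedding dimension at least two, and let $R$ be the ring $R=S/J$ for some proper non-zero ideal $J$ of $S$. Put $K=(0:_SJ)$. Assume that either - $1\le c_S(R)\le 4$, or - $c_S(R)=5$ and $S$ is a standard-graded algebra over a field $[S]_0$. If the parameter $v(S)$ is sufficiently large, then at least one of the conditions (I), (II), (III) defined in the context holds for $R$. In particular, the following statements hold, where $k$ denotes the minimal number of generators of $\mathfrak n/K$. (a) If $k=0$, then (I) holds. (b) If $k=1$, then (II) holds, provided $2c_S(R)\le v(S)$. (c) If $2\le k=c_S(R)-1$, then (I) holds, provided $3\le v(S)$. (d) If $k=2$, $c_S(R)=4$, and $\mathfrak n^3\subseteq \mathfrak nK$, then (II) holds, provided $5\le v(S)$. (e) If $k=2$, $c_S(R)=4$, and $\mathfrak n^3\not\subseteq \mathfrak nK$, then (I) holds, provided $4\le v(S)$. (f) If $k=2$, $c_S(R)=5$, and $S$ is a standard-graded algebra over a field $[S]_0$, then (I) holds, provided $4\le v(S)$. (g) If $k=3$, $c_S(R)=5$, $3\le \operatorname{maxgd}(K)$, and $S$ is a standard-graded algebra over a field $[S]_0$, then (I) holds, provided $3\le v(S)$. (h) If $k=3$, $c_S(R)=5$, $2\le \dim_{k_0}\operatorname{socle}(S/K)$, and $S$ is a standard-graded algebra over a field $[S]_0$, then (I) holds, provided $3\le v(S)$. (i) If $k=3$, $c_S(R)=5$, $\operatorname{maxgd}(K)\le 2$, $\dim_{k_0}\operatorname{socle}(S/K)=1$,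 and $S$ is a standard-graded algebra over a field $[S]_0$, then (III) holds, provided $5\le v(S)$.
   Context: Colon ideals: $(L:_SM)=\{x\in S\mid xM\subseteq L\}$. By Gorenstein duality $J=(0:_SK)$, so $R=S/(0:_SK)$. The colength is $c_S(R)=\lambda_S(S)-\lambda_S(R)$, where $\lambda_S$ denotes length as an $S$-module. For a local ring $(S,\mathfrak n,k_0)$ of embedding dimension $n=\dim_{k_0}(\mathfrak n/\mathfrak n^2)$, $v(S)=\inf\{i\mid \dim_{k_0}(\mathfrak n^i/\mathfrak n^{i+1})<\binom{(n-1)+i}{i}\}$. For a finitely generated module $M$ over a local ring $S$ with presentation $S^b\xrightarrow{\varphi}S^{\mu(M)}\to M\to0$, where $\mu(M)$ is the minimal number of generators of $M$, $\operatorname{Fitt}^1_S(M)$ is the ideal generated by the entries of $\varphi$. A standard-graded algebra over a field $[S]_0$ is a commutative graded ring $S=\bigoplus_{i\ge0}[S]_i$ generated as an $[S]_0$-algebra by $[S]_1$, with $[S]_1$ finitely generated over $[S]_0$. For a graded $S$-module $M$, $[M]_i$ is the degree-$i$ component and $\operatorname{maxgd}(M)=\inf\{\tau\mid S(\bigoplus_{j\le\tau}[M]_j)=M\}$ is the maximal generator degree. The socle of a module $M$ over a ring with (homogeneous) maximal ideal $\mathfrak M$ is $\operatorname{socle}(M)=0:_M\mathfrak M$. The three conditions are: (I) $\operatorname{Fitt}^1_S(K)=\mathfrak n$ and $(\mathfrak nK:_S\mathfrak n)\ne(K:_S\mathfrak n)$. (II) There exist a commutative Noetherian ring $P$ and ideals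 $A,B$ of $P$ with $A\subseteq B^2$, with $P/A$ and $P/B$ both Artinian Gorenstein local rings, and with $B$ generated by a regular $P$-sequence of length at least two, such that $R\cong P/(A:_PB)$. (III) There exist a field $F$, a nonnegative integer $s$, the standard-graded polynomial ring $P=F[X_1,X_2,X_3,Y_1,\dots,Y_s]$, an ideal $B'$ of $P$ generated by five linearly independent quadratic forms in $X_1,X_2,X_3$, the ideal $B=B'+(Y_1,\dots,Y_s)$, and a homogeneous ideal $A\subseteq([P]_1)^5$ of $P$ with $P/A$ an Artinian Gorenstein local ring, such that $[\operatorname{socle}(P/B)]_1=0$ and $R\cong P/(A:_PB)$.
   Formalization: In the case c_S(R)=5 with S standard-graded, the ideal J is assumed homogeneous; otherwise maxgd(K) is undefined and (f) fails, e.g. S=F[x,y]/(x^6,y^6), K=(xy, y^2-x^3). *)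

(* Defs.v *)
From HB Require Import structures.
From mathcomp Require Import all_boot all_order all_algebra.
From mathcomp Require Import boolp classical_sets.
From mathcomp Require Import mpoly.

Set Implicit Arguments.
Unset Strict Implicit.
Unset Printing Implicit Defensive.

Import GRing.Theory.

Local Open Scope classical_set_scope.
Local Open Scope ring_scope.

(* The least element of a set of natural numbers; 0 if the set is empty. *)
Definition least (A : set nat) : nat :=
  xget 0%N [set i | A i /\ forall j, A j -> (i <= j)%N].

(* The largest element of a set of natural numbers; 0 if there is none. *)
Definition largest (A : set nat) : nat :=
  xget 0%N [set i | A i /\ forall j, A j -> (j <= i)%N].

Section Ideals.

Variable R : comNzRingType.
Implicit Types I L M N X : set R.

Definition is_ideal I : Prop :=
  [/\ I 0, forall x y, I x -> I y -> I (x + y) & forall a x, I x -> I (a * x)].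

Definition ideal_gen X : set R := smallest is_ideal X.

Definition ideal_add I L : set R := [set z | exists x y, [/\ I x, L y & z = x + y]].

Definition ideal_mul I L : set R :=
  ideal_gen [set z | exists x y, [/\ I x, L y & z = x * y]].

Fixpoint ideal_exp I (i : nat) : set R :=
  if i is j.+1 then ideal_mul I (ideal_exp I j) else setT.

Definition colon L M : set R := [set x | forall y, M y -> L (x * y)].

Definition ideal0 : set R := [set 0].

Definition maximal_ideal I : Prop :=
  [/\ is_ideal I, ~ I 1
    & forall L, is_ideal L -> I `<=` L -> L = I \/ L = setT].

Definition local_ring (n : set R) : Prop :=
  maximal_ideal n /\ forall m, maximal_ideal m -> m = n.

Definition artinian : Prop :=
  forall C : nat -> set R, (forall i, is_ideal (C i)) ->
    (forall i, C i.+1 `<=` C i) ->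
    exists m, forall i, (m <= i)%N -> C i = C m.

Definition noetherian : Prop :=
  forall C : nat -> set R, (forall i, is_ideal (C i)) ->
    (forall i, C i `<=` C i.+1) ->
    exists m, forall i, (m <= i)%N -> C i = C m.

(* The R-modules below are the subquotients L / N of R, for ideals N `<=` L;
   the submodules of L / N are the C / N for N `<=` C `<=` L. *)

Definition has_chain L N (d : nat) : Prop :=
  exists C : nat -> set R,
    (forall i, (i <= d)%N -> [/\ is_ideal (C i), N `<=` C i & C i `<=` L]) /\
    (forall i, (i < d)%N -> C i `<` C i.+1).

(* The length of L / N; the junk value 0 does not occur over an Artinian ring. *)
Definition mod_length L N : nat := largest (has_chain L N).

Definition num_gen L N : nat :=
  least [set r | exists g : 'I_r -> R,
    (forall i, L (g i)) /\ ideal_add N (ideal_gen (range g)) = L].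

(* A family whose classes form a basis of L / N over the residue field R / n
   of the local ring (R, n), when n L `<=` N: the coefficients are taken in R,
   and a coefficient vanishes in R / n when it is in n. *)
Definition residue_basis (n L N : set R) (d : nat) (e : 'I_d -> R) : Prop :=
  [/\ forall i, L (e i),
      forall x, L x -> exists a : 'I_d -> R, N (x - \sum_i a i * e i)
    & forall a : 'I_d -> R, N (\sum_i a i * e i) -> forall i, n (a i)].

Definition residue_dim (n L N : set R) : nat :=
  xget 0%N [set d | exists e : 'I_d -> R, residue_basis n L N e].

(* socle (R / L) = 0 :_(R / L) n is the subquotient (L : n) / L. *)
Definition socle_dim (n L : set R) : nat := residue_dim n (colon L n) L.

(* An Artinian local ring is Gorenstein when its socle is one-dimensional over
   the residue field. *)
Definition artinian_gorenstein_local (n : set R) : Prop :=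
  [/\ local_ring n, artinian & socle_dim n ideal0 = 1%N].

(* R and its residue field R / n have the same characteristic: the kernels of
   their structure maps from the integers agree. *)
Definition equicharacteristic (n : set R) : Prop :=
  forall m : nat, m%:R = 0 :> R <-> n m%:R.

Definition embdim (n : set R) : nat := residue_dim n n (ideal_exp n 2).

Definition v_inv (n : set R) : nat :=
  least [set i | (residue_dim n (ideal_exp n i) (ideal_exp n i.+1)
                  < 'C(embdim n - 1 + i, i))%N].

(* R^b --phi--> R^m --g--> I --> 0 is exact, with m = mu(I). *)
Definition minimal_presentation I (m b : nat) (g : 'rV[R]_m) (phi : 'M[R]_(m, b))
    : Prop :=
  [/\ m = num_gen I ideal0,
      forall x, I x <-> exists w : 'cV[R]_m, g *m w = x%:M
    & forall w : 'cV[R]_m, g *m w = 0 <-> exists u : 'cV[R]_b, w = phi *m u].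

(* The ideal L is Fitt^1(I). *)
Definition is_Fitt1 I L : Prop :=
  exists (m b : nat) (g : 'rV[R]_m) (phi : 'M[R]_(m, b)),
    minimal_presentation I g phi /\
    L = ideal_gen [set x | exists i j, x = phi i j].

Definition regular_seq (b : seq R) : Prop :=
  (forall i, (i < size b)%N -> forall x,
     ideal_gen [set` take i b] (x * b`_i) -> ideal_gen [set` take i b] x) /\
  ~ ideal_gen [set` b] 1.

Implicit Type G : nat -> set R.

(* R is the internal direct sum of the G i. *)
Definition grading G : Prop :=
  [/\ (forall i, G i 0 /\ forall x y, G i x -> G i y -> G i (x - y)),
      G 0%N 1 /\ (forall i j x y, G i x -> G j y -> G (i + j)%N (x * y)),
      (forall x, exists (d : nat) (c : nat -> R),
         (forall i, G i (c i)) /\ x = \sum_(i < d) c i)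
    & (forall (d : nat) (c : nat -> R), (forall i, G i (c i)) ->
         \sum_(i < d) c i = 0 -> forall i, (i < d)%N -> c i = 0)].

Definition standard_graded G : Prop :=
  [/\ grading G,
      (forall x, G 0%N x -> x <> 0 -> exists2 y, G 0%N y & x * y = 1),
      (forall T : set R, GRing.subring_closed (mem T) ->
         G 0%N `<=` T -> G 1%N `<=` T -> T = setT)
    & (exists (d : nat) (e : 'I_d -> R), (forall i, G 1%N (e i)) /\
         forall x, G 1%N x -> exists a : 'I_d -> R,
           (forall i, G 0%N (a i)) /\ x = \sum_i a i * e i)].

Definition homogeneous G I : Prop :=
  I = ideal_gen [set x | I x /\ exists i, G i x].

Definition maxgd G I : nat :=
  least [set t | ideal_gen [set x | I x /\ exists2 j, (j <= t)%N & G j x] = I].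

End Ideals.

Arguments ideal0 R : clear implicits.
Arguments artinian_gorenstein_local R n : clear implicits.

Record pideal (R : comNzRingType) := PIdeal {
  carrier :> set R;
  carrier_ideal : is_ideal carrier;
  carrier_proper : ~ carrier 1 }.

Definition mem_pideal (R : comNzRingType) (I : pideal R) : {pred R} :=
  fun x => `[< carrier I x >].

Lemma mem_pideal_idealr (R : comNzRingType) (I : pideal R) :
  idealr_closed (mem_pideal I).
Proof.
case: I => I [I0 ID IM] I1; split; rewrite /mem_pideal ?unfold_in /=.
- exact/asboolP.
- exact/asboolPn.
- by move=> a x y /asboolP Ix /asboolP Iy; apply/asboolP/ID => //; apply: IM.
Qed.

HB.instance Definition _ (R : comNzRingType) (I : pideal R) :=
  isIdealr.Build R (mem_pideal I) (mem_pideal_idealr I).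

Definition quot (R : comNzRingType) (I : pideal R) : comNzRingType :=
  {ideal_quot (Idealr.clone R (mem_pideal I) _)}.

Definition ring_iso (R R' : comNzRingType) : Prop :=
  exists f : {rmorphism R -> R'}, bijective f.

(* length_R(R) - length_R(R / J); the subtraction does not truncate, as R / J is
   a quotient of R. *)
Definition colength (R : comNzRingType) (J : set R) : nat :=
  (mod_length setT (ideal0 R) - mod_length setT J)%N.

Definition condI (S : comNzRingType) (n K : set S) : Prop :=
  is_Fitt1 K n /\ colon (ideal_mul n K) n <> colon K n.

(* The proper ideal C is A :_P B: this colon ideal is proper as R is nonzero. *)
Definition condII (R : comNzRingType) : Prop :=
  exists (P : comNzRingType) (A B C : pideal P),
    [/\ noetherian P, A `<=` ideal_exp B 2,
        (exists m, artinian_gorenstein_local (quot A) m),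
        (exists m, artinian_gorenstein_local (quot B) m)
      & [/\ (exists b : seq P,
               [/\ regular_seq b, (2 <= size b)%N
                 & B = ideal_gen [set` b] :> set P]),
            C = colon A B :> set P & ring_iso R (quot C)]].

Section PolynomialRing.

Variables (F : fieldType) (s : nat).

(* In F[X_1, X_2, X_3, Y_1, ..., Y_s] the first three variables are the X's. *)
Local Notation P := {mpoly F[3 + s]}.

Definition mgrade (i : nat) : set P := [set p | p \is i.-homog].

Definition in_X (q : {mpoly F[3]}) : P := q \mPo [tuple 'X_(lshift s i) | i < 3].

Definition Y_ideal : set P := ideal_gen (range (fun j : 'I_s => 'X_(rshift 3 j))).

Definition lin_indep (d : nat) (q : 'I_d -> {mpoly F[3]}) : Prop :=
  forall c : 'I_d -> F, \sum_i c i *: q i = 0 -> forall i, c i = 0.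

End PolynomialRing.

Arguments mgrade F s i : clear implicits.
Arguments Y_ideal F s : clear implicits.

(* The fourth condition below is [socle (P / B)]_1 = 0: a linear form p with
   p P1 `<=` B is in B. *)
Definition condIII (R : comNzRingType) : Prop :=
  exists (F : fieldType) (s : nat) (q : 'I_5 -> {mpoly F[3]})
         (A C : pideal {mpoly F[3 + s]}),
    let P1 := ideal_gen (mgrade F s 1) in
    let B' := ideal_gen (range (fun i => in_X s (q i))) in
    let B := ideal_add B' (Y_ideal F s) in
    [/\ (forall i, q i \is 2.-homog) /\ lin_indep q,
        homogeneous (mgrade F s) A /\ A `<=` ideal_exp P1 5,
        (exists m, artinian_gorenstein_local (quot A) m),
        mgrade F s 1 `&` colon B P1 `<=` B
      & C = colon A B :> set _ /\ ring_iso R (quot C)].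

(* Main.v *)
(* By Gorenstein duality [S / K] has length [c_S(R)], at most 5, so only a few
   Hilbert functions [(1, k, ...)] of [S / K] occur. Choose a coefficient field
   [F] of [S] (the degree 0 part if [S] is graded) and write [S] as the quotient
   of a polynomial ring [F[X]] by an ideal contained in [(X)^v(S)]; in degrees
   less than [v(S)], [S] thus behaves like a domain.

   If [a u] and [a w] are elements of [K] independent modulo [n K], the relation
   [w (a u) = u (a w)] puts [u] and [w] in the Fitting ideal. Hence (I) holds as
   soon as [k >= 2] and some [a] in [n], not in [K + n^2], satisfies [a n <= K]
   (a "linker" below). If [K + n^2] is one dimension larger than [K] and there is
   no linker, multiplication of linear forms modulo [K] is a nondegenerate
   symmetric pairing, which forces [n^3 <= n K].

   In the remaining cases lift generators of [K] to [F[X]]: besides variables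
   they are a power of a variable, two quadrics in two variables, or five
   quadrics in three variables. If [v(S)] is large, the ideal of [S] lies in a
   high power of [(X)], hence, for (II), in the square of the lifted ideal. *)

Require Import Defs.
From HB Require Import structures.
From mathcomp Require Import all_boot all_order all_algebra.
From mathcomp Require Import boolp classical_sets.
From mathcomp Require Import mpoly ring zify.

Set Implicit Arguments.
Unset Strict Implicit.
Unset Printing Implicit Defensive.

Import GRing.Theory.

Local Open Scope classical_set_scope.
Local Open Scope ring_scope.

(** * Ideals and local rings *)

(** Lengths, generator numbers and socle dimensions all become differences of [F]-dimensions of
    ideals, so that Gorenstein duality is a dimension count. Without a grading, [F] is obtained by
    approximation: subrings of [S] that map onto the residue field and meet [n] in higher and higher
    powers of [n].

    Linkers are linear, and may be missing when [S / K] has Hilbert function (1, 2, 2). There a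
    multiplier [a] of degree two is used, chosen according to the only quadric that [K] can contain
    modulo variables and cubes.

    The bounds on [v_inv n] have three sources. That [a u] in [n K] forces [u] into [K + n^2] is
    seen in degree 2 for a linear [a], in degree 3 for a quadratic one, and this degree must stay
    below [v_inv n]: hence 3 and 4. In (b), [(X)^(2c)] is the first power of the maximal ideal
    inside the square of the ideal generated by the variables [z] and [X^c]. In (d), [(X)^3] lies in
    the ideal of variables and quadrics, and two more degrees reach its square; in (III), 5 is
    prescribed by the condition. *)

Section IdealCalculus.
Variable R : comNzRingType.
Implicit Types (I L M N X : set R) (x y a : R).

Lemma idl0 I : is_ideal I -> I 0. Proof. by case. Qed.
Lemma idlD I x y : is_ideal I -> I x -> I y -> I (x + y).
Proof. by case=> _ + _; apply. Qed.
Lemma idlMl I a x : is_ideal I -> I x -> I (a * x).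
Proof. by case=> _ _; apply. Qed.
Lemma idlMr I a x : is_ideal I -> I x -> I (x * a).
Proof. by rewrite mulrC; apply: idlMl. Qed.
Lemma idlN I x : is_ideal I -> I x -> I (- x).
Proof. by move=> Ii Ix; rewrite -mulN1r; apply: idlMl. Qed.
Lemma idlB I x y : is_ideal I -> I x -> I y -> I (x - y).
Proof. by move=> Ii Ix Iy; apply: idlD => //; apply: idlN. Qed.
Lemma idlBK I x y : is_ideal I -> I (x - y) -> I y -> I x.
Proof. by move=> Ii Ix Iy; rewrite -(subrK y x); apply: idlD. Qed.
Lemma idlBKr I x y : is_ideal I -> I (x - y) -> I x -> I y.
Proof. by move=> Ii Ix Iy; rewrite -(subKr x y); apply: idlB. Qed.
Lemma idl_sum I (T : Type) (r : seq T) (P : pred T) (f : T -> R) :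
  is_ideal I -> (forall i, P i -> I (f i)) -> I (\sum_(i <- r | P i) f i).
Proof.
by move=> Ii If; elim/big_ind: _ => //; [exact: idl0|move=> x y; exact: idlD].
Qed.

Lemma ideal_gen_ideal X : is_ideal (ideal_gen X).
Proof.
split=> [I [Ii _]|x y Hx Hy I [Ii XI]|a x Hx I [Ii XI]]; first exact: idl0.
- by apply: idlD => //; [apply: Hx|apply: Hy].
- by apply: idlMl => //; apply: Hx.
Qed.
Lemma sub_ideal_gen X : X `<=` ideal_gen X.
Proof. by move=> x Xx I [_]; apply. Qed.
Lemma ideal_gen_min X I : is_ideal I -> X `<=` I -> ideal_gen X `<=` I.
Proof. by move=> Ii XI x; apply. Qed.
Lemma ideal_gen_mono X Y : X `<=` Y -> ideal_gen X `<=` ideal_gen Y.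
Proof.
move=> XY; apply: ideal_gen_min; first exact: ideal_gen_ideal.
by apply: subset_trans XY _; apply: sub_ideal_gen.
Qed.

Lemma ideal0_ideal : is_ideal (ideal0 R).
Proof. by split=> [|x y -> ->|a x ->] //=; rewrite /ideal0 /= ?addr0 ?mulr0. Qed.
Lemma idealT_ideal : is_ideal (setT : set R).
Proof. by split. Qed.
Lemma ideal_add_ideal I L : is_ideal I -> is_ideal L -> is_ideal (ideal_add I L).
Proof.
move=> Ii Li; split; first by exists 0, 0; split; rewrite ?addr0 //; apply: idl0.
- move=> _ _ [x [y [Ix Ly ->]]] [x' [y' [Ix' Ly' ->]]]; exists (x + x'), (y + y').
  by split; [exact: idlD|exact: idlD|ring].
- move=> a _ [x [y [Ix Ly ->]]]; exists (a * x), (a * y).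
  by split; [exact: idlMl|exact: idlMl|ring].
Qed.
Lemma ideal_addl I L : is_ideal L -> I `<=` ideal_add I L.
Proof. by move=> Li x Ix; exists x, 0; rewrite addr0; split=> //; apply: idl0. Qed.
Lemma ideal_addr I L : is_ideal I -> L `<=` ideal_add I L.
Proof. by move=> Li x Ix; exists 0, x; rewrite add0r; split=> //; apply: idl0. Qed.
Lemma ideal_add_min I L M : is_ideal M -> I `<=` M -> L `<=` M -> ideal_add I L `<=` M.
Proof.
by move=> Mi IM LM _ [x [y [/IM Ix /LM Ly ->]]]; apply: idlD.
Qed.
Lemma ideal_add_mono I L I' L' : I `<=` I' -> L `<=` L' ->
  ideal_add I L `<=` ideal_add I' L'.
Proof. by move=> II' LL' _ [x [y [/II' ? /LL' ? ->]]]; exists x, y. Qed.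
Lemma ideal_mul_ideal I L : is_ideal (ideal_mul I L).
Proof. exact: ideal_gen_ideal. Qed.
Lemma ideal_mulM I L x y : I x -> L y -> ideal_mul I L (x * y).
Proof. by move=> Ix Ly; apply: sub_ideal_gen; exists x, y. Qed.
Lemma ideal_mul_min I L M : is_ideal M -> (forall x y, I x -> L y -> M (x * y)) ->
  ideal_mul I L `<=` M.
Proof. by move=> Mi H; apply: ideal_gen_min => // _ [x [y [? ? ->]]]; apply: H. Qed.
Lemma ideal_mul_subr I L : is_ideal L -> ideal_mul I L `<=` L.
Proof. by move=> Li; apply: ideal_mul_min => // x y _; apply: idlMl. Qed.
Lemma ideal_mul_subl I L : is_ideal I -> ideal_mul I L `<=` I.
Proof. by move=> Li; apply: ideal_mul_min => // x y + _; apply: idlMr. Qed.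
Lemma ideal_exp_ideal I i : is_ideal (ideal_exp I i).
Proof. by case: i => [|i]; [exact: idealT_ideal|exact: ideal_mul_ideal]. Qed.
Lemma colon_ideal L M : is_ideal L -> is_ideal (colon L M).
Proof.
move=> Li; split=> [y _|x x' Hx Hx' y My|a x Hx y My].
- by rewrite mul0r; apply: idl0.
- by rewrite mulrDl; apply: idlD => //; [apply: Hx|apply: Hx'].
- by rewrite -mulrA; apply: idlMl => //; apply: Hx.
Qed.
Lemma sub_colon L M : is_ideal L -> L `<=` colon L M.
Proof. by move=> Li x Lx y _; apply: idlMr. Qed.

(** The [w] with [M (w * u)] form the ideal [colon M [set u]], so products suffice. This is the
    induction principle for products and powers of ideals. *)
Lemma ideal_mul_ind I L M u w : is_ideal M ->
  (forall x y, I x -> L y -> M (x * y * u)) -> ideal_mul I L w -> M (w * u).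
Proof.
move=> Mi H Hw.
have: ideal_mul I L `<=` colon M [set u].
  by apply: ideal_mul_min => [|x y Ix Ly _ ->]; [exact: colon_ideal|exact: H].
by move=> /(_ _ Hw); apply.
Qed.

Lemma ideal_expD I i j x y : ideal_exp I i x -> ideal_exp I j y ->
  ideal_exp I (i + j) (x * y).
Proof.
elim: i x => [|i IH] x; first by move=> _ Hy; apply: idlMl => //; exact: ideal_exp_ideal.
move=> Hx Hy; move: Hx; apply: ideal_mul_ind => [|u w Iu Hw]; first exact: ideal_exp_ideal.
by rewrite -mulrA; apply: ideal_mulM => //; apply: IH.
Qed.
Lemma ideal_exp_split I i j : ideal_exp I (i + j) `<=` ideal_mul (ideal_exp I i) (ideal_exp I j).
Proof.
elim: i => [|i IH]; first by move=> x Hx; rewrite -[x]mul1r; apply: ideal_mulM.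
apply: ideal_mul_min => [|u w Iu /IH Hw]; first exact: ideal_mul_ideal.
rewrite mulrC; move: Hw; apply: ideal_mul_ind => [|x y Ix Iy]; first exact: ideal_mul_ideal.
by rewrite mulrC mulrA; apply: ideal_mulM => //; apply: ideal_mulM.
Qed.
Lemma ideal_exp_leq I i j : (i <= j)%N -> ideal_exp I j `<=` ideal_exp I i.
Proof.
move=> /subnK <-; elim: (j - i)%N => [|k IH] //.
by apply: subset_trans IH; rewrite addSn; apply: ideal_mul_subr; apply: ideal_exp_ideal.
Qed.
Lemma ideal_exp1 I : is_ideal I -> ideal_exp I 1 = I.
Proof.
move=> Ii; apply/seteqP; split; first exact: ideal_mul_subl.
by move=> x Ix; rewrite -[x]mulr1; apply: ideal_mulM.
Qed.
Lemma ideal_exp2E I : is_ideal I -> ideal_exp I 2 = ideal_mul I I.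
Proof. by move=> /ideal_exp1 E; rewrite -[ideal_exp I 2]/(ideal_mul I (ideal_exp I 1)) E. Qed.
Lemma ideal_expS I i x y : is_ideal I -> I x -> ideal_exp I i y -> ideal_exp I i.+1 (x * y).
Proof. by move=> Ii Ix Hy; apply: ideal_mulM. Qed.
Lemma ideal_exp2 I x y : is_ideal I -> I x -> I y -> ideal_exp I 2 (x * y).
Proof. by move=> Ii Ix Iy; apply: ideal_expS => //; rewrite ideal_exp1. Qed.
Lemma ideal_expX I i x : is_ideal I -> I x -> ideal_exp I i (x ^+ i).
Proof.
by move=> Ii Ix; elim: i => //= i IH; rewrite exprS; apply: ideal_expS.
Qed.

Lemma gen_rangeP r (g : 'I_r -> R) x :
  ideal_gen (range g) x <-> exists a : 'I_r -> R, x = \sum_i a i * g i.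
Proof.
split=> [|[a ->]].
  suff: ideal_gen (range g) `<=` [set x | exists a : 'I_r -> R, x = \sum_i a i * g i].
    by apply.
  apply: ideal_gen_min => [|_ [i _ <-]].
    split=> [|_ _ [a ->] [b ->]|c _ [a ->]] /=.
    - by exists (fun=> 0); rewrite big1 // => i _; rewrite mul0r.
    - exists (fun i => a i + b i); rewrite -big_split.
      by apply: eq_bigr => i _; rewrite mulrDl.
    - exists (fun i => c * a i); rewrite mulr_sumr.
      by apply: eq_bigr => i _; rewrite mulrA.
  exists (fun j => (j == i)%:R); rewrite (bigD1 i) //= eqxx mul1r big1 ?addr0 //.
  by move=> j /negPf ->; rewrite mul0r.
apply: idl_sum => [|i _]; first exact: ideal_gen_ideal.
apply: (idlMl _ (ideal_gen_ideal _)).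
by apply: sub_ideal_gen; exists i.
Qed.

Lemma mul_gen_rangeP I r (g : 'I_r -> R) x : is_ideal I ->
  ideal_mul I (ideal_gen (range g)) x ->
  exists2 a : 'I_r -> R, (forall i, I (a i)) & x = \sum_i a i * g i.
Proof.
move=> Ii.
suff: ideal_mul I (ideal_gen (range g)) `<=` [set x | exists2 a : 'I_r -> R,
  (forall i, I (a i)) & x = \sum_i a i * g i] by apply.
apply: ideal_mul_min => [|u w Iu /gen_rangeP[a ->]]; last first.
  exists (fun i => u * a i); first by move=> i; apply: idlMr.
  by rewrite mulr_sumr; apply: eq_bigr => i _; rewrite mulrA.
split=> [|_ _ [a Ia ->] [b Ib ->]|c _ [a Ia ->]] /=.
- by exists (fun=> 0) => [_|]; [exact: idl0|rewrite big1 // => i _; rewrite mul0r].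
- exists (fun i => a i + b i); first by move=> i; apply: idlD.
  by rewrite -big_split; apply: eq_bigr => i _; rewrite mulrDl.
- exists (fun i => c * a i); first by move=> i; apply: idlMl.
  by rewrite mulr_sumr; apply: eq_bigr => i _; rewrite mulrA.
Qed.

Definition nil_ideal I := exists k : nat, ideal_exp I k `<=` ideal0 R.

(** Substituting the hypothesis into itself puts [L] inside [M + n^i L] for every [i], and some
    [n^i] vanishes. Nilpotency of [n] replaces the usual finite generation of [L]. *)
Lemma nakayama n L M : nil_ideal n -> is_ideal L -> is_ideal M ->
  L `<=` ideal_add M (ideal_mul n L) -> L `<=` M.
Proof.
move=> [k nk] Li Mi H.
have step i : L `<=` ideal_add M (ideal_mul (ideal_exp n i) L).
  elim: i => [|i IH].
    by move=> x Lx; apply: ideal_addr => //; rewrite -[x]mul1r; apply: ideal_mulM.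
  apply: subset_trans IH _; apply: ideal_add_min.
  - by apply: ideal_add_ideal => //; exact: ideal_mul_ideal.
  - by apply: ideal_addl; exact: ideal_mul_ideal.
  apply: ideal_mul_min; first by apply: ideal_add_ideal => //; exact: ideal_mul_ideal.
  move=> x y nx /H [m [l [Mm Hl ->]]]; exists (x * m), (x * l); rewrite mulrDr; split=> //.
    exact: idlMl.
  rewrite mulrC; move: Hl; apply: ideal_mul_ind => [|u w nu Lw].
    exact: ideal_mul_ideal.
  by rewrite mulrC mulrA; apply: ideal_mulM => //; rewrite mulrC; apply: ideal_mulM.
move=> x /(step k)[m [l [Mm Hl ->]]].
suff -> : l = 0 by rewrite addr0.
suff: ideal_mul (ideal_exp n k) L `<=` ideal0 R by apply.
apply: ideal_mul_min; first exact: ideal0_ideal.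
by move=> u w /nk -> _; rewrite mul0r.
Qed.

End IdealCalculus.

Section Local.
Variables (R : comNzRingType) (n : set R).

Lemma krull (I : set R) : is_ideal I -> ~ I 1 -> exists2 m, maximal_ideal m & I `<=` m.
Proof.
move=> Ii I1.
pose P (X : set R) := X = set0 \/ [/\ is_ideal X, ~ X 1 & I `<=` X].
have [F FP Ftot|A [PA Amax]] := @Zorn_bigcup _ P.
  have [[X0 [FX0 nX0]]|nF] := pselect (exists X, F X /\ X <> set0); last first.
    left; rewrite -subset0 => x [X FX Xx]; case: nF; exists X; split=> // X0.
    by rewrite X0 in Xx.
  have ne X x : F X -> X x -> [/\ is_ideal X, ~ X 1 & I `<=` X].
    by move=> FX Xx; case: (FP _ FX) => // X0'; rewrite X0' in Xx.
  have [X0i _ IX0] : [/\ is_ideal X0, ~ X0 1 & I `<=` X0] by case: (FP _ FX0).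
  right; split; last by move=> x /IX0; exists X0.
  - split; first by exists X0 => //; exact: idl0.
    + move=> x y [X FX Xx] [Y FY Yy].
      have [[Xi _ _] [Yi _ _]] := (ne _ _ FX Xx, ne _ _ FY Yy).
      have [XY|YX] := Ftot _ _ FX FY.
        by exists Y => //; apply: idlD => //; apply: XY.
      by exists X => //; apply: idlD => //; apply: YX.
    + move=> a x [X FX Xx]; have [Xi _ _] := ne _ _ FX Xx.
      by exists X => //; apply: idlMl.
  - by move=> [X FX X1]; have [] := ne _ _ FX X1.
have [A0|[Ai A1 IA]] := PA.
  case: (Amax I); last by right; split.
  split; first by rewrite A0.
  by rewrite A0 => /(_ 0); apply; exact: idl0.
exists A => //; split=> // L Li AL.
have [L1|L1] := pselect (L 1).
  by right; apply/seteqP; split=> // x _; rewrite -[x]mulr1; apply: idlMl.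
left; apply/seteqP; split=> //; apply: contrapT => LA.
by case: (Amax L); [split|right; split=> //; apply: subset_trans AL].
Qed.

Hypothesis loc : local_ring n.

Lemma loc_ideal : is_ideal n. Proof. by case: loc => [[]]. Qed.
Lemma loc_1 : ~ n 1. Proof. by case: loc => [[]]. Qed.

Lemma loc_sub I : is_ideal I -> ~ I 1 -> I `<=` n.
Proof. by move=> Ii /(krull Ii)[m mm Im]; case: loc => _ /(_ _ mm) <-. Qed.

Lemma loc_unit x : ~ n x -> exists y, x * y = 1.
Proof.
move=> nx; apply: contrapT => H; apply: nx.
apply: (@loc_sub [set z | exists y, z = x * y]); last by exists 1; rewrite mulr1.
- split; first by exists 0; rewrite mulr0.
  + by move=> _ _ [a ->] [b ->]; exists (a + b); rewrite mulrDr.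
  + by move=> a _ [b ->]; exists (a * b); rewrite mulrCA.
- by move=> [y xy]; case: H; exists y.
Qed.

Hypothesis art : artinian R.

(** Without a minimal element, iterating a choice of strictly smaller ideals in [P] would give a
    chain that never stabilises. *)
Lemma art_min (P : set (set R)) L0 : is_ideal L0 -> P L0 ->
  exists L, [/\ is_ideal L, P L & forall L', is_ideal L' -> P L' -> L' `<=` L -> L' = L].
Proof.
move=> L0i PL0; apply: contrapT => H.
pose T := {L | is_ideal L /\ P L}.
have nxt (L : T) : exists L' : T, sval L' `<` sval L.
  apply: contrapT => nL; apply: H; case: L nL => L [Li PL] nL.
  exists L; split=> // L' L'i PL' L'L; apply: contrapT => neq; apply: nL.
  exists (exist _ L' (conj L'i PL')) => /=; split=> // LL'.
  by apply: neq; apply/seteqP.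
have [f Hf] := choice nxt.
pose C i := iter i f (exist _ L0 (conj L0i PL0)).
have [|i|m /(_ m.+1 (leqnSn m)) Hm] := art (C := fun i => sval (C i)).
- by move=> i; case: (C i) => L [].
- by case: (Hf (C i)).
by case: (Hf (C m)) => _; apply; rewrite -/(iter m.+1 f _) -/(C m.+1) Hm.
Qed.

(** If the stable power [I] of [n] is nonzero, take an ideal [L] minimal with [L I] nonzero. Since
    [I] lies in [I^2], minimality gives [L = x I] for some [x] in [L]; so [x = x b] with [b] in [n],
    and the unit [1 - b] kills [x]. *)
Lemma loc_nilp : nil_ideal n.
Proof.
have [|i|m Hm] := art (C := ideal_exp n); first exact: ideal_exp_ideal.
  by apply: ideal_exp_leq.
exists m; apply: contrapT => /existsNP[z0 /not_implyP[Iz0 z00]].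
set I := ideal_exp n m in Iz0.
have II : is_ideal I by exact: ideal_exp_ideal.
have Isq : I `<=` ideal_mul I I.
  by rewrite {1}/I -(Hm (m + m)%N) ?leq_addr //; apply: ideal_exp_split.
have m0 : (0 < m)%N.
  rewrite lt0n; apply/eqP => m0; apply: loc_1.
  suff -> : n = setT by [].
  by rewrite -(ideal_exp1 loc_ideal) (Hm 1%N) ?m0.
have In : I `<=` n by rewrite -(ideal_exp1 loc_ideal); apply: ideal_exp_leq.
pose P (L : set R) := exists x y, [/\ L x, I y & x * y <> 0].
have [|L [Li [x [y [Lx Iy xy]]] Lmin]] := @art_min P _ (idealT_ideal R).
  by exists 1, z0; rewrite mul1r.
pose xI := [set z | exists2 y, I y & z = x * y].
have xIi : is_ideal xI.
  split; first by exists 0; [exact: idl0|rewrite mulr0].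
  - move=> _ _ [a Ia ->] [b Ib ->]; exists (a + b); last by rewrite mulrDr.
    exact: idlD.
  - move=> a _ [b Ib ->]; exists (a * b); last by rewrite mulrCA.
    exact: idlMl.
have PxI : P xI.
  apply: contrapT => nP; apply: xy.
  suff: ideal0 R (y * x) by rewrite mulrC.
  move: (Isq _ Iy); apply: ideal_mul_ind => [|u w Iu Iw]; first exact: ideal0_ideal.
  apply: contrapT => H; apply: nP; exists (x * u), w; split=> //; first by exists u.
  by move=> E; apply: H; rewrite /ideal0 /= -[RHS]E; ring.
have xIL : xI = L.
  by apply: Lmin => // _ [b Ib ->]; apply: idlMr.
have [b Ib xb] : xI x by rewrite xIL.
have [|c bc] := @loc_unit (1 - b).
  by move=> H; apply: loc_1; rewrite -(subrK b 1); apply: idlD loc_ideal _ (In _ Ib).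
apply: xy; rewrite -[x]mulr1 -bc mulrA mulrBr mulr1 -xb subrr !mul0r //.
Qed.
End Local.

Lemma quot_proj (S : comNzRingType) (I : pideal S) : exists pr : {rmorphism S -> quot I},
  (forall q, exists x, pr x = q) /\ (forall x, pr x = 0 <-> (I : set S) x).
Proof.
pose A := Idealr.clone S (mem_pideal I) _.
exists (\pi_(Quotient.quot A))%qT; split=> [q|x].
  by exists (repr q); exact: reprK.
rewrite -(raddf0 (\pi_(Quotient.quot A))%qT).
split=> [/eqP|Ix]; first by rewrite -Quotient.idealrBE subr0 => /asboolP.
by apply/eqP; rewrite -Quotient.idealrBE subr0; apply/asboolP.
Qed.
Lemma residue_field (S : comNzRingType) (n : set S) : local_ring n ->
  exists (F : fieldType) (pr : {rmorphism S -> F}),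
  (forall q, exists x, pr x = q) /\ (forall x, pr x = 0 <-> n x).
Proof.
move=> loc.
have [pr [prs pr0]] := quot_proj (PIdeal (loc_ideal loc) (loc_1 loc)).
set Q := quot _ in pr prs pr0.
have ex (q : Q) : exists q', (q != 0 -> q' * q = 1) /\ (q = 0 -> q' = 0).
  have [q0|/eqP q0] := eqVneq q 0; first by exists 0; split=> // /eqP.
  have [x xq] := prs q; have [|y xy] := @loc_unit S n loc x.
    by move=> /pr0 x0; apply: q0; rewrite -xq.
  exists (pr y); split=> // _; rewrite -xq -rmorphM mulrC xy rmorph1 //.
have [inv Hinv] := choice ex.
have mulVf (q : Q) : q != 0 -> inv q * q = 1 by case: (Hinv q).
have inv0 : inv 0 = 0 by case: (Hinv 0) => _; apply.
pose f := GRing.ComNzRing_isField.Build Q mulVf inv0.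
pose F : fieldType := HB.pack (GRing.ComNzRing.sort Q) f.
exists F. exists (pr : {rmorphism S -> F}).
by split.
Qed.

(** * Coefficient fields *)

Section CoefficientField.
Variables (S : comNzRingType) (n : set S).

Definition subring_set (T : set S) : Prop :=
  [/\ T 1, forall x y, T x -> T y -> T (x - y) & forall x y, T x -> T y -> T (x * y)].

Section SubringSet.
Variables (T : set S) (HT : subring_set T).
Lemma subring_set1 : T 1. Proof. by case: HT. Qed.
Lemma subring_setB x y : T x -> T y -> T (x - y). Proof. by case: HT => _ + _; apply. Qed.
Lemma subring_setM x y : T x -> T y -> T (x * y). Proof. by case: HT => _ _; apply. Qed.
Lemma subring_set0 : T 0.
Proof. by rewrite -(subrr 1); apply: subring_setB; apply: subring_set1. Qed.
Lemma subring_setN x : T x -> T (- x).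
Proof. by move=> Tx; rewrite -sub0r; apply: subring_setB => //; apply: subring_set0. Qed.
Lemma subring_setD x y : T x -> T y -> T (x + y).
Proof. by move=> Tx Ty; rewrite -[y]opprK; apply: subring_setB => //; apply: subring_setN. Qed.
Lemma subring_setX x i : T x -> T (x ^+ i).
Proof.
by move=> Tx; elim: i => [|i IH]; [exact: subring_set1|rewrite exprS; apply: subring_setM].
Qed.
Lemma subring_set_sum (I : Type) (r : seq I) (P : pred I) (f : I -> S) :
  (forall i, P i -> T (f i)) -> T (\sum_(i <- r | P i) f i).
Proof.
move=> H; elim/big_ind: _ => //; first exact: subring_set0.
exact: subring_setD.
Qed.
Lemma subring_set_nat d : T d%:R.
Proof.
elim: d => [|d IH]; first exact: subring_set0.
by rewrite -natr1; apply: subring_setD => //; apply: subring_set1.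
Qed.
Lemma subring_set_horner (h : {poly S}) x : (forall i, T h`_i) -> T x -> T h.[x].
Proof.
move=> Th Tx; rewrite horner_coef; apply: subring_set_sum => i _.
by apply: subring_setM => //; apply: subring_setX.
Qed.
End SubringSet.

Lemma poly_taylor1 (p : {poly S}) x t : exists c, p.[x + t] = p.[x] + p^`().[x] * t + c * t ^+ 2.
Proof.
elim/poly_ind: p => [|p c [d Hd]]; first by exists 0; rewrite deriv0 !horner0; ring.
exists (d * (x + t) + p^`().[x]); rewrite derivMXaddC !(hornerD, hornerM, hornerX, hornerC) Hd; ring.
Qed.

Lemma poly_sub_dvd (p : {poly S}) x t : exists c, p.[x + t] = p.[x] + c * t.
Proof. by have [c ->] := poly_taylor1 p x t; exists (p^`().[x] + c * t); ring. Qed.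

Hypothesis loc : local_ring n.
Let ni := loc_ideal loc.

Lemma loc_prime x y : n (x * y) -> n x \/ n y.
Proof.
move=> nxy; have [|/(loc_unit loc)[z xz]] := pselect (n x); first by left.
right; have -> : y = z * (x * y) by rewrite mulrA [z * x]mulrC xz mul1r.
exact: idlMl.
Qed.

Lemma loc_prime_exp x i : n (x ^+ i) -> n x.
Proof.
by elim: i => [/(loc_1 loc)//|i IH]; rewrite exprS => /loc_prime[].
Qed.

Definition inv_closed (T : set S) := forall x y, T x -> ~ n x -> x * y = 1 -> T y.
Definition covers (T : set S) := forall x, exists2 t, T t & n (x - t).

Section Division.
Variables (L : set S) (HL : subring_set L) (f : {poly S}) (d : nat).
Hypotheses (Lf : forall i, L f`_i) (fm : f \is monic) (fd : size f = d.+1).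

(** Since [f] is monic, cancelling leading terms never leaves the polynomials with coefficients in
    [L]. *)
Lemma subring_set_div (h : {poly S}) : (forall i, L h`_i) ->
  exists q r : {poly S}, [/\ h = q * f + r, forall i, L q`_i, forall i, L r`_i & (size r <= d)%N].
Proof.
have [s] := ubnP (size h); elim: s h => // s IH h hs Lh.
have [hd|hd] := leqP (size h) d.
  exists 0, h; split=> //; first by rewrite mul0r add0r.
  by move=> i; rewrite coef0; apply: subring_set0.
pose m := 'X^(size h - d.+1) : {poly S}; pose h' := h - lead_coef h *: (m * f).
have szmf : size (m * f) = size h.
  rewrite size_monicM ?monicXn ?monic_neq0 // size_polyXn fd.
  by rewrite addSn /= subnK.
have h0 : h != 0 by rewrite -size_poly_gt0; apply: leq_ltn_trans hd.
have sh' : (size h' < size h)%N.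
  rewrite -(ltn_predK hd) ltnS; apply/leq_sizeP => j hj.
  rewrite coefB coefZ; have [->|neq] := eqVneq j (size h).-1.
    suff -> : (m * f)`_(size h).-1 = 1 by rewrite mulr1 subrr.
    have /monicP <- : m * f \is monic by rewrite monicMl ?monicXn.
    by rewrite /lead_coef szmf.
  have hj' : (size h <= j)%N.
    by move: hj neq; case: (size h) hd => //= k _; rewrite leq_eqVlt eq_sym => /predU1P[->|//]; rewrite eqxx.
  by rewrite !nth_default ?mulr0 ?subrr // szmf.
have Lm i : L (m * f)`_i.
  rewrite coefXnM; case: ifP => _ //; exact: subring_set0.
have [|i|q [r [E Lq Lr sr]]] := IH h'; first exact: leq_trans sh' _.
  rewrite coefB coefZ; apply: (subring_setB HL) => //.
  by apply: (subring_setM HL); [exact: Lh|exact: Lm].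
exists (q + lead_coef h *: m), r; split=> //.
  by apply: (etrans (esym (subrK (lead_coef h *: (m * f)) h))); rewrite -/h' E mulrDl -scalerAl addrAC.
move=> i; rewrite coefD coefZ; apply: (subring_setD HL) => //.
apply: (subring_setM HL); first exact: Lh.
rewrite coefXn; exact: (subring_set_nat HL).
Qed.
End Division.

Section Step.
Variables (m : nat) (T L0 : set S).
Hypotheses (m0 : (0 < m)%N) (HT : subring_set T) (Tinv : inv_closed T) (Tcov : covers T).
Hypothesis (Tn : forall x, T x -> n x -> ideal_exp n m x).
Let I := ideal_exp n m.+1.
Let Ii : is_ideal I := ideal_exp_ideal n m.+1.

(** Modulo [n^(m+1)] such a ring embeds in the residue field. A maximal one will turn out to cover
    it. *)
Definition small_subring (L : set S) :=
  [/\ subring_set L, L0 `<=` L, L `<=` T & forall x, L x -> n x -> I x].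

Hypothesis HL0 : small_subring L0.
(** Vacuous in residue characteristic zero; otherwise applied with [p] the residue characteristic
    and [L0] the ring of [p]-th powers of [T]. *)
Hypothesis L0p : forall d, (0 < d)%N -> n d%:R ->
  exists2 p, (0 < p <= d)%N & forall t, T t -> L0 (t ^+ p).

Lemma small_subring_max : exists2 L, small_subring L &
  forall L', small_subring L' -> L `<=` L' -> L' = L.
Proof.
pose P (X : set S) := X = set0 \/ small_subring X.
have [F FP Ftot|A [PA Amax]] := @Zorn_bigcup _ P.
  have [[X0 [FX0 nX0]]|nF] := pselect (exists X, F X /\ X <> set0); last first.
    left; rewrite -subset0 => x [X FX Xx]; case: nF; exists X; split=> // X0.
    by rewrite X0 in Xx.
  have ne X x : F X -> X x -> small_subring X.
    by move=> FX Xx; case: (FP _ FX) => // X0'; rewrite X0' in Xx.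
  have gX0 : small_subring X0 by case: (FP _ FX0).
  have two x y : (\bigcup_(X in F) X) x -> (\bigcup_(X in F) X) y ->
      exists X, [/\ F X, X x, X y & small_subring X].
    move=> [X FX Xx] [Y FY Yy]; have [XY|YX] := Ftot _ _ FX FY.
      by exists Y; split=> //; [exact: XY|exact: ne Yy].
    by exists X; split=> //; [exact: YX|exact: ne Xx].
  right; split.
  - split; first by exists X0 => //; case: gX0 => /subring_set1.
    + move=> x y Hx Hy; have [X [FX Xx Xy [HX _ _ _]]] := two _ _ Hx Hy.
      by exists X => //; apply: subring_setB.
    + move=> x y Hx Hy; have [X [FX Xx Xy [HX _ _ _]]] := two _ _ Hx Hy.
      by exists X => //; apply: subring_setM.
  - by move=> x Hx; exists X0 => //; case: gX0 => _ H _ _; apply: H.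
  - by move=> x [X FX Xx]; case: (ne _ _ FX Xx) => _ _ H _; apply: H.
  - by move=> x [X FX Xx]; case: (ne _ _ FX Xx) => _ _ _; apply.
have neq0 X : small_subring X -> X <> set0.
  by case=> /subring_set1 X1 _ _ _ X0; rewrite X0 in X1.
have [A0|gA] := PA.
  case: (Amax L0); last by right.
  split; first by rewrite A0.
  by rewrite A0 subset0; exact: neq0.
exists A => // L gL AL; apply: contrapT => LA; case: (Amax L); last by right.
by split=> // LA'; apply: LA; apply/seteqP.
Qed.

Section Maximal.
Variable L : set S.
Hypotheses (gL : small_subring L)
  (Lmax : forall L', small_subring L' -> L `<=` L' -> L' = L).
Let HL : subring_set L. Proof. by case: gL. Qed.
Let LT : L `<=` T. Proof. by case: gL. Qed.
Let Ln x : L x -> n x -> I x. Proof. by case: gL => _ _ _; apply. Qed.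

(** Adjoining the inverse [v] of [u] keeps the ring small: multiplying by the unit [u ^+ i] brings
    [l * v ^+ i] back to [L] without changing whether it lies in [n] or in [I]. *)
Lemma max_inv_closed : inv_closed L.
Proof.
move=> u v Lu nu uv.
have uvX i : u ^+ i * v ^+ i = 1 by rewrite -exprMn uv expr1n.
pose L' := [set x | exists l i, L l /\ x = l * v ^+ i].
suff <- : L' = L by exists 1, 1%N; split; [exact: subring_set1|rewrite mul1r expr1].
have LL' : L `<=` L' by move=> l Ll; exists l, 0%N; rewrite mulr1.
apply: Lmax => //; split.
- split; first by apply: LL'; apply: subring_set1.
  + move=> _ _ [l [i [Ll ->]]] [l' [j [Ll' ->]]].
    exists (l * u ^+ j - l' * u ^+ i), (i + j)%N; split.
      by apply: (subring_setB HL); apply: (subring_setM HL) => //; apply: (subring_setX HL).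
    rewrite exprD mulrBl; congr (_ - _).
      by rewrite mulrACA uvX mulr1.
    by rewrite [v ^+ i * _]mulrC mulrACA uvX mulr1.
  + move=> _ _ [l [i [Ll ->]]] [l' [j [Ll' ->]]]; exists (l * l'), (i + j)%N.
    by split; [exact: subring_setM|rewrite exprD mulrACA].
- by case: gL => _ + _ _ => /subset_trans; apply.
- move=> _ [l [i [Ll ->]]]; apply: (subring_setM HT); first exact: LT.
  by apply: (subring_setX HT); apply: Tinv nu uv; apply: LT.
- move=> _ [l [i [Ll ->]]] /(idlMr (u ^+ i) ni).
  rewrite -mulrA [v ^+ i * _]mulrC uvX mulr1 => /(Ln Ll) Il.
  exact: (idlMr _ Ii).
Qed.

Lemma max_adjoin a : T a ->
  (forall h : {poly S}, (forall i, L h`_i) -> n h.[a] -> I h.[a]) -> L a.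
Proof.
move=> Ta Ha; pose L' := [set x | exists h : {poly S}, (forall i, L h`_i) /\ x = h.[a]].
have LL' : L `<=` L'.
  move=> l Ll; exists l%:P; rewrite hornerC; split=> // i; rewrite coefC.
  by case: eqP => _ //; apply: subring_set0.
suff <- : L' = L.
  exists 'X; rewrite hornerX; split=> // i; rewrite coefX.
  exact: (subring_set_nat HL).
apply: Lmax => //; split.
- split; first by apply: LL'; apply: subring_set1.
  + move=> _ _ [h [Lh ->]] [k [Lk ->]]; exists (h - k); rewrite hornerD hornerN; split=> // i.
    by rewrite coefB; apply: subring_setB.
  + move=> _ _ [h [Lh ->]] [k [Lk ->]]; exists (h * k); rewrite hornerM; split=> // i.
    by rewrite coefM; apply: (subring_set_sum HL) => j _; apply: (subring_setM HL).
- by case: gL => _ + _ _ => /subset_trans; apply.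
- by move=> _ [h [Lh ->]]; apply: (subring_set_horner HT) => // i; apply: LT.
- by move=> _ [h [Lh ->]]; apply: Ha.
Qed.

(* A minimal polynomial of [a] modulo [n] is either separable, and Newton's
   iteration improves [a], or of degree the residue characteristic [p], and can
   be replaced by [X^p - a^p]. *)
Lemma max_covers : covers L.
Proof.
move=> x0; have [a Ta na] := Tcov x0.
suff [a' La' na'] : exists2 a', L a' & n (a - a').
  by exists a' => //; rewrite -(subrK a x0) -addrA; apply: idlD.
(* A [bad] polynomial reduces modulo [n] to a nonzero polynomial vanishing at the class of [a]; one
   of least size reduces to a multiple of the minimal polynomial of that class. *)
pose bad (h : {poly S}) := [/\ forall i, L h`_i, n h.[a] & ~ forall i, n h`_i].
(* If [f.[a']] lies in [I], division by [f] leaves a remainder too short to be [bad]; so adjoining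
   [a'] keeps the subring small. *)
have root_of (f : {poly S}) d a' : (forall i, L f`_i) -> f \is monic -> size f = d.+1 ->
    (forall h : {poly S}, bad h -> (d < size h)%N) ->
    T a' -> n (a - a') -> I f.[a'] -> exists2 a', L a' & n (a - a').
  move=> Lf fm fd dmin Ta' na' If; exists a' => //; apply: max_adjoin => // h Lh nh.
  have [q [r [E Lq Lr sr]]] := subring_set_div HL Lf fm fd Lh.
  have In : I `<=` n by rewrite -(ideal_exp1 ni); apply: ideal_exp_leq.
  have nr' : n r.[a'].
    move: nh; rewrite E hornerD hornerM addrC -[q.[a'] * _]opprK => /(idlBK ni); apply.
    by apply: (idlN ni); apply: (idlMl _ ni); apply: In.
  have nr : n r.[a].
    have [c Hc] := poly_sub_dvd r a' (a - a').
    by rewrite -[a](subrK a') addrC Hc; apply: (idlD ni) => //; apply: (idlMl _ ni).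
  have nri i : n r`_i.
    have D : ~ bad r by move=> /dmin; rewrite ltnNge sr.
    by apply: contrapT => H; apply: D; split=> // H'; apply: H.
  rewrite E hornerD hornerM; apply: (idlD Ii); first exact: (idlMl _ Ii).
  rewrite horner_coef; apply: (idl_sum _ Ii) => i _; apply: (idlMr _ Ii).
  exact: Ln.
(* Without [bad] polynomials the class of [a] is transcendental, and [a] itself can be adjoined. *)
have [[h bh]|nbad] := pselect (exists h, bad h); last first.
  exists a; last by rewrite subrr; exact: idl0.
  apply: max_adjoin => // h Lh nh; rewrite horner_coef; apply: (idl_sum _ Ii) => i _.
  apply: (idlMr _ Ii); apply: Ln => //; apply: contrapT => H; apply: nbad; exists h.
  by split=> // H'; apply: H.
have exsz : exists s, `[< exists h, bad h /\ size h = s >].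
  by exists (size h); apply/asboolP; exists h.
have [s /asboolP[{bh} {}h [[Lh nh nnh] sh]] smin] := ex_minnP exsz.
have dmin k : bad k -> (s <= size k)%N by move=> bk; apply: smin; apply/asboolP; exists k.
have s0 : (0 < s)%N.
  rewrite -sh lt0n size_poly_eq0; apply/eqP => h0; apply: nnh => i.
  by rewrite h0 coef0; exact: idl0.
have nlead : ~ n (lead_coef h).
  (* A leading term with coefficient in [n] could be dropped, leaving a shorter [bad] polynomial. *)
  move=> nl; pose k := h - lead_coef h *: 'X^(s.-1).
  have ks : (size k < s)%N.
    rewrite -(prednK s0) ltnS; apply/leq_sizeP => j hj.
    rewrite coefB coefZ coefXn; have [->|neq] := eqVneq j s.-1.
      by rewrite mulr1 /lead_coef sh subrr.
    rewrite mulr0 subr0 nth_default // sh -(prednK s0).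
    by rewrite ltn_neqAle eq_sym neq.
  have D : ~ bad k by move=> /dmin; rewrite leqNgt ks.
  apply: D; split.
  - move=> i; rewrite coefB coefZ coefXn; apply: (subring_setB HL) => //.
    by apply: (subring_setM HL); [exact: Lh|exact: (subring_set_nat HL)].
  - rewrite hornerD hornerN hornerZ; apply: (idlB ni) => //.
    exact: (idlMr _ ni).
  - move=> nk; apply: nnh => i; have := nk i; rewrite coefB coefZ => H.
    by apply: (idlBK ni H); apply: (idlMr _ ni).
have [w hw] := loc_unit loc nlead.
have Lw : L w by apply: max_inv_closed hw => //; exact: Lh.
pose f := w *: h.
have Lf i : L f`_i by rewrite coefZ; apply: (subring_setM HL).
have fm : f \is monic.
  by rewrite monicE lead_coef_lreg -?hw 1?mulrC // => x y /(congr1 ( *%R (lead_coef h)));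
     rewrite !mulrA hw !mul1r.
have fs : size f = s.
  have le : (size f <= s)%N by rewrite -sh; apply: size_scale_leq.
  apply/eqP; rewrite eqn_leq le /=; apply: dmin; split=> //.
    by rewrite hornerZ; apply: (idlMl _ ni).
  by move=> /(_ (size f).-1); rewrite -/(lead_coef f) (monicP fm); exact: loc_1.
have nf : n f.[a] by rewrite hornerZ; apply: (idlMl _ ni).
have [d sd] : exists d, s = d.+1 by exists s.-1; rewrite prednK.
have d0 : (0 < d)%N.
  rewrite lt0n; apply/eqP => d0; apply: (loc_1 loc).
  move: nf; rewrite (size1_polyC (p := f)) ?fs ?sd ?d0 // hornerC.
  by move/monicP: fm; rewrite /lead_coef fs sd d0 /= => ->.
rewrite sd in dmin fs.
(* Inseparable case: by minimality the derivative has all its coefficients in [n], among them the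
   degree [d], so [L0p] gives some [p <= d]. As [X^p - a^p] is [bad], [p = d]; it has the exact root
   [a] and takes the place of [f]. *)
have [nf'|nf'] := pselect (n f^`().[a]).
  have sf' : (size f^`() <= d)%N.
    by rewrite -ltnS -fs lt_size_deriv // -size_poly_gt0 fs.
  have nd : n d%:R.
    have -> : d%:R = f^`()`_d.-1 :> S.
      by rewrite coef_deriv prednK // -[f`_d]/(f`_d.+1.-1) -fs -/(lead_coef f) (monicP fm).
    have D : ~ bad f^`() by move=> /dmin; rewrite ltnNge sf'.
    apply: contrapT => H; apply: D; split=> // i.
    by rewrite coef_deriv -mulr_natr; apply: (subring_setM HL) => //; exact: (subring_set_nat HL).
  have [p /andP[p0 pd] L0a] := L0p d0 nd.
  have sg : size ('X^p - (a ^+ p)%:P) = p.+1 by rewrite size_XnsubC.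
  have gm : 'X^p - (a ^+ p)%:P \is monic by rewrite monicXnsubC.
  have Lg i : L ('X^p - (a ^+ p)%:P)`_i.
    rewrite coefB coefXn coefC; apply: (subring_setB HL); first exact: (subring_set_nat HL).
    case: eqP => _; last exact: subring_set0.
    by case: gL => _ + _ _; apply; apply: L0a.
  have ga : ('X^p - (a ^+ p)%:P).[a] = 0 by rewrite hornerD hornerN hornerXn hornerC subrr.
  have pd' : p = d.
    apply/eqP; rewrite eqn_leq pd -ltnS -sg; apply: dmin; split=> //.
      by rewrite ga; exact: idl0.
    by move=> /(_ p); rewrite -[p in _`_p]/(p.+1.-1) -sg -/(lead_coef _) (monicP gm); exact: loc_1.
  apply: (root_of _ d a Lg gm) => //; first by rewrite sg pd'.
  - by rewrite subrr; exact: idl0.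
  - by rewrite ga; exact: idl0.
have [v hv] := loc_unit loc nf'.
have Tf : T f.[a] by apply: (subring_set_horner HT) => // i; apply: LT.
have Tv : T v.
  apply: Tinv nf' hv; apply: (subring_set_horner HT) => // i.
  by apply: LT; rewrite coef_deriv -mulr_natr; apply: (subring_setM HL) => //; exact: (subring_set_nat HL).
apply: (root_of f d (a + - (f.[a] * v))) => //.
- by apply: (subring_setB HT) => //; apply: (subring_setM HT).
- by rewrite opprD addrA subrr add0r opprK; apply: (idlMr _ ni).
have [c ->] := poly_taylor1 f a (- (f.[a] * v)).
have -> : f.[a] + f^`().[a] * - (f.[a] * v) = 0.
  by rewrite mulrN mulrCA hv mulr1 subrr.
rewrite add0r; apply: (idlMl _ Ii); rewrite sqrrN exprMn; apply: (idlMr _ Ii).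
(* The error of the Newton step is a multiple of [f.[a] ^+ 2]. As [f.[a]] lies in [T] and in [n], it
   lies in [n^m], and [m + m >= m + 1]. *)
have In : ideal_exp n (m + m) `<=` I by apply: ideal_exp_leq; rewrite -addn1 leq_add2l.
by apply: In; apply: ideal_expD; apply: Tn.
Qed.
End Maximal.

Lemma coef_step : exists T', [/\ subring_set T', inv_closed T', covers T' &
  forall x, T' x -> n x -> I x].
Proof.
have [L gL Lmax] := small_subring_max; exists L; split.
- by case: gL.
- exact: max_inv_closed.
- exact: max_covers.
- by case: gL.
Qed.
End Step.

Hypotheses (nilH : nil_ideal n) (eqc : equicharacteristic n).

Lemma frobenius_image (p : nat) (T : set S) : prime p -> p%:R = 0 :> S ->
  subring_set T -> subring_set [set x | exists2 t, T t & x = t ^+ p].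
Proof.
move=> pp p0 HT.
have chp : p \in [pchar S] by rewrite inE pp p0 eqxx.
split; first by exists 1; [exact: subring_set1|rewrite expr1n].
- move=> _ _ [t Tt ->] [s Ts ->]; exists (t - s); first exact: subring_setB.
  by have := rmorphB (pFrobenius_aut chp) t s; rewrite /= !pFrobenius_autE => ->.
- by move=> _ _ [t Tt ->] [s Ts ->]; exists (t * s); [exact: subring_setM|rewrite exprMn].
Qed.

(** By equal characteristic, the least positive integer vanishing in [S] is also the least one in
    [n]; since [n] is prime, a factorisation would put a smaller one in [n]. *)
Lemma equichar_prime d : (0 < d)%N -> d%:R = 0 :> S ->
  exists p, [/\ prime p, p%:R = 0 :> S & forall e, (0 < e)%N -> n e%:R -> (p <= e)%N].
Proof.
move=> d0 d0'.
have ex : exists d, (0 < d)%N && (d%:R == 0 :> S) by exists d; rewrite d0 d0' eqxx.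
have [p /andP[p0 /eqP p0'] pmin] := ex_minnP ex; exists p.
have pn e : (0 < e)%N -> n e%:R -> (p <= e)%N.
  by move=> e0 /eqc e0'; apply: pmin; rewrite e0 e0' eqxx.
split=> //; apply/primeP; split.
  by case: (p) p0 p0' => [//|[_ /= one0|//]]; case: (loc_1 loc); rewrite (one0 : 1 = 0); exact: idl0.
move=> e ep; have pe := divnK ep.
have e0 : (0 < e)%N by rewrite lt0n; apply: contraTneq ep => ->; rewrite dvd0n -lt0n.
have q0 : (0 < p %/ e)%N by rewrite divn_gt0 // dvdn_leq.
have : n ((p %/ e)%:R * e%:R) by rewrite -natrM pe p0'; exact: idl0.
case/loc_prime => /pn H; apply/orP; [left|right].
  by move: (H q0); rewrite -{1}pe -[leqRHS]muln1 leq_pmul2l // => le; rewrite eqn_leq le.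
by rewrite eqn_leq H // dvdn_leq.
Qed.

(** Cohen's theorem in the Artinian case: [coef_step] raises the power of [n] containing the
    intersection of [T] with [n] until that power is zero. The subring [L0] consists of the [p]-th
    powers of [T], or of the integers in characteristic zero. *)
Lemma exists_coef_subring : exists T, [/\ subring_set T, covers T & forall x, T x -> n x -> x = 0].
Proof.
suff H m : exists T, [/\ subring_set T, inv_closed T, covers T &
    forall x, T x -> n x -> ideal_exp n m.+1 x].
  have [k nk] := nilH; have [T [HT _ cT nT]] := H k; exists T; split=> // x Tx nx.
  by apply: nk; apply: ideal_exp_leq (leqnSn k) _ (nT _ Tx nx).
elim: m => [|m [T [HT Ti Tc Tn]]].
  exists setT; split=> //; first by move=> x; exists x; rewrite // subrr; exact: idl0.
  by move=> x _; rewrite ideal_exp1.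
have [[d [d0 d0']]|nch] := pselect (exists d, (0 < d)%N /\ d%:R = 0 :> S).
  have [p [pp p0 pmin]] := equichar_prime d0 d0'.
  have HF := frobenius_image pp p0 HT.
  apply: (@coef_step m.+1 T [set x | exists2 t, T t & x = t ^+ p] (ltn0Sn m) HT Ti Tc Tn).
    split=> //; first by move=> _ [t Tt ->]; apply: subring_setX.
    (* Since [p >= 2], [t ^+ p] has two factors [t], one used in [n] and one in [n^(m+1)]: the
       exponent goes up by one. *)
    move=> _ [t Tt ->] /loc_prime_exp nt; have := prime_gt1 pp; case: p {pp p0 pmin HF} => [|[|p]] // _.
    rewrite !exprS mulrA; apply: (idlMr _ (ideal_exp_ideal n m.+2)).
    by apply: ideal_expS => //; apply: Tn.
  move=> e e0 /(pmin _ e0) pe; exists p; first by rewrite prime_gt0.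
  by move=> t Tt; exists t.
have nat0 i j : n (i%:R - j%:R) -> i%:R - j%:R = 0 :> S.
  wlog ij : i j / (j <= i)%N => [H|].
    have [/H//|/ltnW ij nij] := leqP j i.
    by rewrite -opprB H ?oppr0 // -opprB; apply: idlN.
  by rewrite -natrB // => /eqc.
apply: (@coef_step m.+1 T [set x | exists i j : nat, x = i%:R - j%:R] (ltn0Sn m) HT Ti Tc Tn).
  split=> //.
  - split; first by exists 1%N, 0%N; rewrite subr0.
    + move=> _ _ [i [j ->]] [k [l ->]]; exists (i + l)%N, (j + k)%N; rewrite !natrD; ring.
    + move=> _ _ [i [j ->]] [k [l ->]]; exists (i * k + j * l)%N, (i * l + j * k)%N.
      rewrite !(natrD, natrM); ring.
  - by move=> _ [i [j ->]]; apply: (subring_setB HT); exact: subring_set_nat.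
  - move=> _ [i [j ->]] /nat0 ->; apply: idl0; exact: ideal_exp_ideal.
by move=> d d0 /eqc d0'; case: nch; exists d.
Qed.

(** A residue class has only one representative in [T], so the choice of representatives respects
    sums and products. *)
Lemma coef_subring_field T : subring_set T -> covers T -> (forall x, T x -> n x -> x = 0) ->
  exists (F : fieldType) (sg : {rmorphism F -> S}),
    (forall a, T (sg a)) /\ (forall x, exists a, n (x - sg a)).
Proof.
move=> HT Tc Tn.
have [F [pr [prs pr0]]] := residue_field loc.
have ex q : exists t, T t /\ pr t = q.
  have [x xq] := prs q; have [t Tt nt] := Tc x; exists t; split=> //.
  by rewrite -xq; apply/esym/eqP; rewrite -subr_eq0 -rmorphB; apply/eqP/pr0.
have [sg Hsg] := choice ex.
have uni x y : T x -> T y -> pr x = pr y -> x = y.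
  move=> Tx Ty E; apply/eqP; rewrite -subr_eq0; apply/eqP; apply: Tn.
    exact: subring_setB.
  by apply/pr0; rewrite rmorphB E subrr.
have sgT q : T (sg q) by case: (Hsg q).
have sgE q : pr (sg q) = q by case: (Hsg q).
have sgB : zmod_morphism sg.
  by move=> x y; apply: uni => //; [exact: subring_setB|rewrite rmorphB !sgE].
have sgM : monoid_morphism sg.
  split=> [|x y]; apply: uni => //; first exact: subring_set1.
  - by rewrite sgE rmorph1.
  - exact: subring_setM.
  - by rewrite rmorphM !sgE.
pose a := GRing.isZmodMorphism.Build _ _ sg sgB.
pose b := GRing.isMonoidMorphism.Build _ _ sg sgM.
pose sgR : {rmorphism F -> S} := HB.pack sg a b.
exists F, sgR; split; first exact: sgT.
move=> x; exists (pr x); apply/pr0; rewrite rmorphB /= sgE subrr //.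
Qed.
End CoefficientField.

(** * Linear algebra over a coefficient field, and Gorenstein duality *)

Lemma least_unique (A : set nat) m : A m -> (forall j, A j -> (m <= j)%N) -> least A = m.
Proof.
move=> Am mA; apply: xget_unique => [|j [Aj jA]] //.
by apply/eqP; rewrite eqn_leq mA // jA.
Qed.
Lemma largest_unique (A : set nat) m : A m -> (forall j, A j -> (j <= m)%N) -> largest A = m.
Proof.
move=> Am mA; apply: xget_unique => [|j [Aj jA]] //.
by apply/eqP; rewrite eqn_leq mA // jA.
Qed.
Lemma leastP (A : set nat) m : A m -> A (least A).
Proof.
move=> Am; have ex : exists m, `[< A m >] by exists m; apply/asboolP.
have [k /asboolP Ak kmin] := ex_minnP ex.
by rewrite (least_unique Ak) // => j Aj; apply: kmin; apply/asboolP.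
Qed.
Lemma least_lt (A : set nat) i : (i < least A)%N -> ~ A i.
Proof.
move=> H Ai; have ex : exists m, `[< A m >] by exists i; apply/asboolP.
have [k /asboolP Ak kmin] := ex_minnP ex.
have E : least A = k by apply: least_unique => // j Aj; apply: kmin; apply/asboolP.
by move: H; rewrite E ltnNge kmin //; apply/asboolP.
Qed.

Section VspaceOfPred.
Variables (F : fieldType) (V : vectType F) (P : set V).
Hypotheses (P0 : P 0) (PD : forall a u v, P u -> P v -> P (a *: u + v)).
(** A subspace inside [P] of the largest dimension absorbs every [v] in [P], for adding the line
    through [v] would otherwise enlarge it. *)
Lemma vspace_of_pred : exists U : {vspace V}, forall v, v \in U <-> P v.
Proof.
pose Q k := `[< exists U : {vspace V}, \dim U = k /\ forall v, v \in U -> P v >].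
have ex : exists k, Q k.
  exists 0%N; apply/asboolP; exists 0%VS; rewrite dimv0; split=> // v.
  by rewrite memv0 => /eqP ->.
have bd k : Q k -> (k <= \dim {:V})%N.
  by move=> /asboolP[U [<- _]]; apply: dimvS; apply: subvf.
have [k /asboolP[U [Uk UP]] kmax] := ex_maxnP ex bd.
exists U => v; split; first exact: UP.
move=> Pv; apply: contrapT => /negP vU.
have : Q (\dim (U + <[v]>)%VS).
  apply/asboolP; exists (U + <[v]>)%VS; split=> // w /memv_addP[u /UP Pu [_ /vlineP[a ->] ->]].
  by rewrite addrC; apply: PD.
move=> /kmax; rewrite -Uk dimv_disjoint_sum ?dim_vline; last first.
  apply/eqP; rewrite -subv0; apply/subvP => w; rewrite memv_cap memv0.
  move=> /andP[wU /vlineP[a wa]]; rewrite wa; have [->|a0] := eqVneq a 0; first by rewrite scale0r.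
  case/negP: vU; have -> : v = a^-1 *: w by rewrite wa scalerA mulVf // scale1r.
  exact: memvZ.
suff -> : v != 0 by rewrite addn1 ltnn.
by apply: contraNneq vU => ->; apply: mem0v.
Qed.
End VspaceOfPred.

(** A local ring as a finite-dimensional algebra over a coefficient field: by [la_cov], [la_F] maps
    onto the residue field. The family [la_e] only spans; subspaces of [S] are measured by their
    preimages in coordinate space. *)
Record loc_alg (S : comNzRingType) (n : set S) := LocAlg {
  la_F : fieldType;
  la_s : {rmorphism la_F -> S};
  la_N : nat;
  la_e : 'I_la_N -> S;
  la_ideal : is_ideal n;
  la_1 : ~ n 1;
  la_unit : forall x, ~ n x -> exists y, x * y = 1;
  la_cov : forall x, exists a, n (x - la_s a);
  la_nil : nil_ideal n;
  la_span : forall x, exists a : 'I_la_N -> la_F, x = \sum_i la_s (a i) * la_e i }.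

Section Dimension.
Variables (S : comNzRingType) (n : set S) (A : loc_alg n).
Let F := la_F A.
Let sg : {rmorphism F -> S} := la_s A.
Let ni := la_ideal A.
Local Notation N := (la_N A).
Local Notation e := (@la_e _ _ A).
Implicit Types (L M I K W : set S) (x y : S).

Lemma la_s_eq0 a : n (sg a) -> a = 0.
Proof.
move=> na; apply/eqP; apply: contrapT => /negP a0; apply: (la_1 A).
by rewrite -(rmorph1 sg) -(mulVf a0) rmorphM; apply: (idlMl _ ni).
Qed.

Definition subsp L : Prop :=
  [/\ L 0, forall x y, L x -> L y -> L (x + y) & forall a x, L x -> L (sg a * x)].

Lemma ideal_subsp L : is_ideal L -> subsp L.
Proof. by case=> L0 LD LM; split=> // a x; apply: LM. Qed.

Lemma subspBK L x y : subsp L -> L (x - y) -> L y -> L x.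
Proof. by case=> L0 LD LM Lx Ly; rewrite -(subrK y x); apply: LD. Qed.
Definition addl L x : set S := [set y | exists a : F, L (y - sg a * x)].

Lemma addl_subsp L x : subsp L -> subsp (addl L x).
Proof.
move=> HL; have [L0 LD LM] := HL; split; first by exists 0; rewrite rmorph0 mul0r subr0.
- move=> y z [a Ha] [b Hb]; exists (a + b); rewrite rmorphD mulrDl opprD addrACA.
  exact: LD.
- move=> a y [b Hb]; exists (a * b); rewrite rmorphM -mulrA -mulrBr.
  exact: LM.
Qed.
Lemma sub_addl L x : L `<=` addl L x.
Proof. by move=> y Ly; exists 0; rewrite rmorph0 mul0r subr0. Qed.
Lemma mem_addl L x : subsp L -> addl L x x.
Proof. by case=> L0 _ _; exists 1; rewrite rmorph1 mul1r subrr. Qed.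
Lemma addl_min L M x : subsp M -> L `<=` M -> M x -> addl L x `<=` M.
Proof.
move=> HM LM Mx y [a /LM]; move/subspBK; apply=> //.
by case: HM => _ _; apply.
Qed.
Lemma addl_ideal L x : is_ideal L -> (forall y, n y -> L (y * x)) -> is_ideal (addl L x).
Proof.
move=> Li nx; have [D1 D2 D3] := addl_subsp x (ideal_subsp Li); split=> //.
move=> b y [a Hy]; have [c Hc] := la_cov A b; exists (c * a).
have -> : b * y - sg (c * a) * x = b * (y - sg a * x) + sg a * ((b - sg c) * x).
  by rewrite rmorphM; ring.
by apply: (idlD Li); apply: (idlMl _ Li) => //; apply: nx.
Qed.

Let f (v : 'rV[F]_N) : S := \sum_i sg (v 0 i) * e i.

Lemma la_f_add a u v : f (a *: u + v) = sg a * f u + f v.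
Proof.
rewrite /f mulr_sumr -big_split; apply: eq_bigr => i _.
by rewrite !mxE rmorphD rmorphM mulrDl mulrA.
Qed.
Lemma la_f_surj x : exists v, f v = x.
Proof.
have [a ->] := la_span A x; exists (\row_i a i).
by apply: eq_bigr => i _; rewrite mxE.
Qed.
Lemma la_f_sum m (a : 'I_m -> F) (u : 'I_m -> 'rV[F]_N) :
  f (\sum_i a i *: u i) = \sum_i sg (a i) * f (u i).
Proof.
have f0 : f 0 = 0 by rewrite /f big1 // => i _; rewrite mxE rmorph0 mul0r.
elim/big_rec2: _ => // i y1 y2 _ <-; exact: la_f_add.
Qed.

Definition vs L : {vspace 'rV[F]_N} := xget 0%VS [set U : {vspace 'rV[F]_N} | forall v, v \in U <-> L (f v)].
(* The dimension of the preimage of [L] in [F^N]: it exceeds that of [L] by a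
   constant, so that only differences are meaningful. *)
Definition ldim L : nat := \dim (vs L).

Lemma vsP L v : subsp L -> v \in vs L <-> L (f v).
Proof.
move=> [L0 LD LM].
have [U HU] : exists U : {vspace 'rV[F]_N}, forall v, v \in U <-> L (f v).
  apply: (@vspace_of_pred _ _ [set v | L (f v)]) => [|a u w Hu Hw] /=.
    by rewrite /f big1 // => i _; rewrite mxE rmorph0 mul0r.
  by rewrite la_f_add; apply: LD => //; apply: LM.
exact: (xgetPex 0%VS (ex_intro [set U : {vspace 'rV[F]_N} | forall v, v \in U <-> L (f v)] U HU)).
Qed.

Lemma vs_mono L M : subsp L -> subsp M -> L `<=` M -> (vs L <= vs M)%VS.
Proof. by move=> HL HM LM; apply/subvP => v /(vsP _ HL)/LM/(vsP _ HM). Qed.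
Lemma ldim_mono L M : subsp L -> subsp M -> L `<=` M -> (ldim L <= ldim M)%N.
Proof. by move=> HL HM LM; apply: dimvS; apply: vs_mono. Qed.
Lemma ldim_eq L M : subsp L -> subsp M -> L `<=` M -> (ldim M <= ldim L)%N -> M `<=` L.
Proof.
move=> HL HM LM le; have /eqP E : vs L == vs M by rewrite eqEdim vs_mono.
by move=> x; have [v <-] := la_f_surj x; move/(vsP _ HM); rewrite -E => /(vsP _ HL).
Qed.
Lemma ldim_lt L M : subsp L -> subsp M -> L `<=` M -> ~ M `<=` L -> (ldim L < ldim M)%N.
Proof. by move=> HL HM LM ML; rewrite ltnNge; apply/negP => /(ldim_eq HL HM LM). Qed.

Definition spans L M d (g : 'I_d -> S) :=
  forall x, L x -> exists a : 'I_d -> F, M (x - \sum_i sg (a i) * g i).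
Definition indep M d (g : 'I_d -> S) :=
  forall a : 'I_d -> F, M (\sum_i sg (a i) * g i) -> forall i, a i = 0.

Lemma spans_ldim L M d (g : 'I_d -> S) : subsp L -> subsp M ->
  spans L M g -> (ldim L <= ldim M + d)%N.
Proof.
move=> HL HM sp; have [v fv] := choice (fun i => la_f_surj (g i)).
have sub : (vs L <= vs M + <<[tuple v i | i < d]>>)%VS.
  apply/subvP => w /(vsP _ HL)/sp[a Ha].
  rewrite -(subrK (\sum_i a i *: v i) w) memv_add //; last first.
    apply: memv_suml => i _; apply: memvZ; apply: memv_span.
    by apply/mapP; exists i; rewrite ?mem_enum ?tnth_ord_tuple.
  apply/(vsP _ HM); have -> : w - \sum_i a i *: v i = (-1) *: (\sum_i a i *: v i) + w.
    by rewrite scaleN1r addrC.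
  rewrite la_f_add rmorphN1 mulN1r addrC la_f_sum.
  by under eq_bigr do rewrite fv.
apply: leq_trans (dimvS sub) _.
rewrite -(leq_add2r (\dim (vs M :&: <<[tuple v i | i < d]>>))) dimv_sum_cap -addnA leq_add2l.
by apply: leq_trans (dim_span _) _; rewrite size_tuple leq_addr.
Qed.

Lemma indep_ldim L M d (g : 'I_d -> S) : subsp L -> subsp M -> M `<=` L ->
  (forall i, L (g i)) -> indep M g -> (ldim M + d <= ldim L)%N.
Proof.
move=> HL HM ML Lg ig; have [v fv] := choice (fun i => la_f_surj (g i)).
pose X := [tuple v i | i < d].
have XE (i : 'I_d) : X`_i = v i by rewrite (nth_map i) ?size_enum_ord // nth_ord_enum.
have ker a : \sum_i a i *: v i \in vs M -> forall i, a i = 0.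
  by move=> /(vsP _ HM); rewrite la_f_sum; under eq_bigr do rewrite fv; exact: ig.
have frX : free X.
  apply/freeP => a; under eq_bigr do rewrite XE.
  by move=> E; apply: ker; rewrite E mem0v.
have disj : (vs M :&: <<X>> = 0)%VS.
  apply/eqP; rewrite -subv0; apply/subvP => w; rewrite memv_cap memv0.
  case/andP => wM wX; move: wM; rewrite (coord_span wX).
  under eq_bigr do rewrite XE.
  by move/ker => H; rewrite big1 // => i _; rewrite H scale0r.
have := dimv_disjoint_sum disj; move: frX; rewrite /free size_tuple => /eqP -> <-.
apply: dimvS; rewrite subv_add vs_mono //=.
apply/span_subvP => w /mapP[i _ ->]; apply/(vsP _ HL).
by rewrite fv.
Qed.

Lemma ldim_basis L M d (g : 'I_d -> S) : subsp L -> subsp M -> M `<=` L ->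
  (forall i, L (g i)) -> spans L M g -> indep M g -> d = (ldim L - ldim M)%N.
Proof.
move=> HL HM ML Lg sp ig; have H1 := spans_ldim HL HM sp.
have H2 := indep_ldim HL HM ML Lg ig.
by apply/eqP; rewrite eqn_leq leq_subLR H1 andbT leq_subRL ?(leq_trans (leq_addr _ _) H2).
Qed.

Lemma ldim_addl L x : subsp L -> ~ L x -> ldim (addl L x) = (ldim L).+1.
Proof.
move=> HL Lx; have HA := addl_subsp x HL.
apply/eqP; rewrite eqn_leq -addn1; apply/andP; split.
  apply: (spans_ldim (g := fun _ : 'I_1 => x)) => // y [a Ha].
  by exists (fun=> a); rewrite big_ord1.
rewrite addn1; apply: ldim_lt => //; first exact: sub_addl.
by move=> H; apply: Lx; apply: H; exact: mem_addl.
Qed.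

(** That [W] spans [L] modulo [M] is expressed through the subspaces containing both. With [W] made
    of homogeneous elements, the basis extracted from it is homogeneous. *)
Lemma exists_basis L M W : subsp L -> subsp M -> M `<=` L -> W `<=` L ->
  (forall K, subsp K -> M `<=` K -> W `<=` K -> L `<=` K) ->
  exists g : 'I_(ldim L - ldim M) -> S,
    [/\ forall i, W (g i), spans L M g & indep M g].
Proof.
move: {2}(ldim L - ldim M)%N (erefl (ldim L - ldim M)%N) => d Ed.
rewrite Ed; elim: d M Ed => [|d IH] M Ed HL HM ML WL gen.
  have LM : L `<=` M by apply: ldim_eq => //; rewrite -subn_eq0 Ed.
  exists (fun=> 0); split; [by case|move=> x Lx|by move=> ? ? []].
  by exists (fun=> 0); rewrite big_ord0 subr0; apply: LM.
have [w Ww Mw] : exists2 w, W w & ~ M w.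
  apply: contrapT => H; have : L `<=` M.
    apply: gen => // w Ww; apply: contrapT => Mw; apply: H; exists w => //.
  by move/(ldim_mono HL HM); rewrite -subn_eq0 Ed.
have HM' := addl_subsp w HM.
have [|||||K HK MK WK|g [Wg sg' ig]] := IH (addl M w) => //.
- by rewrite ldim_addl // subnS Ed.
- by apply: addl_min => //; apply: WL.
- by apply: gen => //; apply: subset_trans MK; exact: sub_addl.
exists (fun i => oapp g w (unlift ord0 i)); split.
- by move=> i; case: unlift => //=.
- move=> x /sg'[a [b Hb]]; exists (fun i => oapp a b (unlift ord0 i)).
  rewrite big_ord_recl unlift_none /=; under eq_bigr do rewrite liftK /=.
  by rewrite opprD addrA addrAC.
- move=> a; rewrite big_ord_recl unlift_none /=; under eq_bigr do rewrite liftK /=.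
  move=> Ha; have a' : forall i, a (lift ord0 i) = 0.
    apply: (ig (fun i => a (lift ord0 i))); exists (- a ord0).
    by rewrite rmorphN mulNr opprK addrC.
  have a0 : a ord0 = 0.
    apply/eqP; apply: contrapT => /negP a0; apply: Mw.
    move: Ha; rewrite big1 ?addr0 => [Ha|i _]; last by rewrite a' rmorph0 mul0r.
    have -> : w = sg (a ord0)^-1 * (sg (a ord0) * w).
      by rewrite mulrA -rmorphM mulVf // rmorph1 mul1r.
    by case: HM => _ _; apply.
  by move=> i; case: (unliftP ord0 i) => [j ->|->].
Qed.

(** A relation with [a j] nonzero eliminates [g j], leaving a spanning family too short for the
    dimension of [L / M]. *)
Lemma spans_indep L M d (g : 'I_d -> S) : subsp L -> subsp M ->
  spans L M g -> (ldim M + d <= ldim L)%N -> indep M g.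
Proof.
move=> HL HM sp le a Ha j; apply/eqP; apply: contrapT => /negP aj.
case: d g sp le a Ha j aj => [g _ _ _ _ []//|d] g sp le a Ha j aj.
suff: (ldim L <= ldim M + d)%N by rewrite leqNgt -addnS le.
apply: (spans_ldim (g := g \o lift j)) => // x /sp[b Hb].
exists (fun i => b (lift j i) - b j / a j * a (lift j i)).
have [M0 MD MM] := HM.
have -> : x - \sum_i sg (b (lift j i) - b j / a j * a (lift j i)) * (g \o lift j) i
    = (x - \sum_i sg (b i) * g i) + sg (b j / a j) * \sum_i sg (a i) * g i.
  rewrite (bigD1_ord j) //= (bigD1_ord j (F := fun i => sg (a i) * g i)) //= mulrDr mulrA.
  rewrite -rmorphM divfK // mulr_sumr.
  have -> : \sum_(i < d) sg (b (lift j i) - b j / a j * a (lift j i)) * g (lift j i) =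
     \sum_i sg (b (lift j i)) * g (lift j i) - \sum_i sg (b j / a j) * (sg (a (lift j i)) * g (lift j i)).
    by rewrite -sumrB; apply: eq_bigr => i _; rewrite rmorphB !rmorphM; ring.
  ring.
by apply: MD => //; apply: MM.
Qed.

Lemma exists_basis_id L M : subsp L -> subsp M -> M `<=` L ->
  exists g : 'I_(ldim L - ldim M) -> S, [/\ forall i, L (g i), spans L M g & indep M g].
Proof. by move=> HL HM ML; apply: exists_basis => // K _ _. Qed.

(** As [n L] lies in [M], coefficients in [S] may be replaced by elements of [F]; so a
    [residue_basis] is an [F]-basis of [L / M], and all have the same size. *)
Lemma residue_dimE L M : is_ideal L -> is_ideal M -> M `<=` L ->
  (forall x y, n x -> L y -> M (x * y)) -> residue_dim n L M = (ldim L - ldim M)%N.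
Proof.
move=> Li Mi ML nLM; have [HL HM] := (ideal_subsp Li, ideal_subsp Mi).
apply: xget_unique => [|d [g [Lg sp ig]]].
  have [g [Lg sp ig]] := exists_basis_id HL HM ML; exists g; split=> //.
    by move=> x /sp[a Ha]; exists (fun i => sg (a i)).
  move=> a Ha i; have [b Hb] := choice (fun i => la_cov A (a i)).
  rewrite -(subrK (sg (b i)) (a i)); apply: (idlD ni) => //.
  rewrite (ig b) ?rmorph0; first exact: idl0.
  apply: (idlBKr Mi) Ha; rewrite -sumrB; apply: (idl_sum _ Mi) => j _.
  by rewrite -mulrBl; apply: nLM.
apply: (ldim_basis HL HM ML Lg) => [x /sp[a Ha]|a Ha i].
  have [b Hb] := choice (fun i => la_cov A (a i)); exists b.
  rewrite -(subrK (\sum_i a i * g i) x) -addrA; apply: (idlD Mi) => //.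
  rewrite -sumrB; apply: (idl_sum _ Mi) => j _.
  by rewrite -mulrBl; apply: nLM.
by apply: la_s_eq0; apply: (ig (fun i => sg (a i))) Ha i.
Qed.

(** Take the least [i] with [n^i L] inside [M]: a product from [n^(i-1) L] outside [M] is sent into
    [M] by [n]. *)
Lemma ideal_socle L M : is_ideal L -> is_ideal M -> ~ L `<=` M ->
  exists x, [/\ L x, ~ M x & forall y, n y -> M (y * x)].
Proof.
move=> Li Mi LM; pose P i := forall u y, ideal_exp n i u -> L y -> M (u * y).
have ex : exists i, `[< P i >].
  have [k nk] := la_nil A; exists k; apply/asboolP => u y /nk -> _.
  by rewrite mul0r; exact: idl0.
have [[|i] /asboolP Pi imin] := ex_minnP ex.
  by case: LM => x Lx; rewrite -[x]mul1r; apply: Pi.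
have : ~ P i by move=> /asboolP/imin; rewrite ltnn.
move=> /existsNP[u /existsNP[y /not_implyP[iu /not_implyP[Ly nuy]]]].
exists (u * y); split=> //; first exact: idlMl.
by move=> w nw; rewrite mulrA; apply: Pi => //; apply: ideal_expS.
Qed.

Lemma ideal_step L M : is_ideal L -> is_ideal M -> M `<=` L -> ~ L `<=` M ->
  exists x, [/\ L x, ~ M x, forall y, n y -> M (y * x), is_ideal (addl M x)
    & [/\ M `<=` addl M x, addl M x `<=` L & ldim (addl M x) = (ldim M).+1]].
Proof.
move=> Li Mi ML LM; have [x [Lx Mx nx]] := ideal_socle Li Mi LM.
have HM := ideal_subsp Mi; exists x; split=> //; first exact: addl_ideal.
split; [exact: sub_addl|apply: addl_min => //; exact: ideal_subsp|exact: ldim_addl].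
Qed.

Lemma mod_lengthE L M : is_ideal L -> is_ideal M -> M `<=` L ->
  mod_length L M = (ldim L - ldim M)%N.
Proof.
move=> Li Mi ML; apply: largest_unique => [|d [C [HC Cs]]]; last first.
  have le i : (i <= d)%N -> (ldim M + i <= ldim (C i))%N.
    elim: i => [|i IH] id.
      have [Ci MC _] := HC _ id.
      by rewrite addn0; apply: ldim_mono => //; exact: ideal_subsp.
    have [CC CC'] := Cs _ id; have [Ci _ _] := HC _ id; have [Ci' _ _] := HC _ (ltnW id).
    rewrite addnS; apply: leq_ltn_trans (IH (ltnW id)) _.
    by apply: ldim_lt => //; exact: ideal_subsp.
  have [Ci _ CL] := HC d (leqnn d).
  have H : (ldim (C d) <= ldim L)%N by apply: ldim_mono => //; exact: ideal_subsp.
  by rewrite leq_subRL ?(leq_trans (le _ (leqnn d))) // ldim_mono //; exact: ideal_subsp.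
move: {2}(ldim L - ldim M)%N (erefl (ldim L - ldim M)%N) => d Ed.
rewrite Ed; elim: d M Ed Mi ML => [|d IH] M Ed Mi ML.
  by exists (fun=> M); split=> [i _|i]; [split|rewrite ltn0].
have LM : ~ L `<=` M.
  by move/(ldim_mono (ideal_subsp Li) (ideal_subsp Mi)); rewrite -subn_eq0 Ed.
have [x [Lx Mx nx Ai [MA AL dA]]] := ideal_step Li Mi ML LM.
have [|C [HC Cs]] := IH (addl M x) _ Ai AL; first by rewrite dA subnS Ed.
exists (fun i => if i is j.+1 then C j else M); split.
  move=> [|i] id; first by split.
  by have [Ci aC CL] := HC i id; split=> //; apply: subset_trans aC.
move=> [|i] id; last exact: Cs.
have [_ aC _] := HC 0%N (leq0n d); split; first exact: subset_trans aC.
by move=> H; apply: Mx; apply: H; apply: aC; apply: mem_addl; exact: ideal_subsp.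
Qed.

Lemma num_genE L M : is_ideal L -> is_ideal M -> M `<=` L ->
  num_gen L M = (ldim L - ldim (ideal_add M (ideal_mul n L)))%N.
Proof.
move=> Li Mi ML; have Ki : is_ideal (ideal_add M (ideal_mul n L)).
  by apply: ideal_add_ideal => //; exact: ideal_mul_ideal.
have KL : ideal_add M (ideal_mul n L) `<=` L.
  by apply: ideal_add_min => //; apply: ideal_mul_subr.
have [HL HK] := (ideal_subsp Li, ideal_subsp Ki).
apply: least_unique => [|r [g [Lg E]]].
  have [g [Lg sp ig]] := exists_basis_id HL HK KL; exists g; split=> //.
  have Gi := ideal_gen_ideal (range g).
  have MGi := ideal_add_ideal Mi Gi.
  apply/seteqP; split.
    apply: ideal_add_min => //; apply: ideal_gen_min => // _ [i _ <-]; exact: Lg.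
  apply: (nakayama (la_nil A)) => // x /sp[a [m [l [Mm Hl Ea]]]].
  exists (m + \sum_i sg (a i) * g i), l; split=> //.
    exists m, (\sum_i sg (a i) * g i); split=> //.
    by apply/gen_rangeP; exists (fun i => sg (a i)).
  by rewrite addrAC -Ea subrK.
rewrite leq_subLR; apply: (spans_ldim (g := g)) => // x.
rewrite -{1}E => -[m [_ [Mm /gen_rangeP[a ->] ->]]].
have [b Hb] := choice (fun i => la_cov A (a i)); exists b.
rewrite -addrA -sumrB; exists m, (\sum_i (a i * g i - sg (b i) * g i)); split=> //.
apply: (idl_sum _ (ideal_mul_ideal n L)) => i _.
by rewrite -mulrBl; apply: ideal_mulM.
Qed.

Section Gorenstein.
Hypothesis soc1 : socle_dim n (ideal0 S) = 1%N.
Local Notation ann := (colon (ideal0 S)).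
Let i0 := @ideal0_ideal S.

Lemma socle_line : exists s, forall x, ann n x -> exists a, x = sg a * s.
Proof.
have Ai : is_ideal (ann n) by exact: colon_ideal.
have A0 : ideal0 S `<=` ann n by apply: sub_colon.
have := soc1; rewrite /socle_dim residue_dimE // => [d1|x y nx Hy]; last by rewrite mulrC; apply: Hy.
have [g [Ag sp _]] := exists_basis_id (ideal_subsp Ai) (ideal_subsp i0) A0.
rewrite d1 in g Ag sp; exists (g ord0) => x /sp[a Ha]; exists (a ord0).
by apply/eqP; rewrite -subr_eq0; apply/eqP; rewrite big_ord1 in Ha.
Qed.

(** Climb from [M] to [L] through ideals [M + F x] with [n x] inside [M]. For [y] in [ann M] the
    product [y x] lies in the socle, a line, so [ann] loses at most one dimension at each step. *)
Lemma ldim_ann_le L M : is_ideal L -> is_ideal M -> M `<=` L ->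
  (ldim (ann M) + ldim M <= ldim (ann L) + ldim L)%N.
Proof.
have [s Hs] := socle_line.
move=> Li; move: {2}(ldim L - ldim M)%N (erefl (ldim L - ldim M)%N) => d.
elim: d M => [|d IH] M Ed Mi ML.
  have LM : L `<=` M by apply: ldim_eq; rewrite -?subn_eq0 ?Ed //; exact: ideal_subsp.
  by have -> : L = M by apply/seteqP.
have LM : ~ L `<=` M.
  by move/(ldim_mono (ideal_subsp Li) (ideal_subsp Mi)); rewrite -subn_eq0 Ed.
have [x [Lx Mx nx Ai [MA AL dA]]] := ideal_step Li Mi ML LM.
have {IH} := IH (addl M x) _ Ai AL; rewrite dA subnS Ed => /(_ erefl).
apply: leq_trans; rewrite addnS -addSn leq_add2r.
have AMi : is_ideal (ann M) by exact: colon_ideal.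
have AAi : is_ideal (ann (addl M x)) by exact: colon_ideal.
have sx y : ann M y -> exists a, y * x = sg a * s.
  move=> Hy; apply: Hs => z nz; rewrite mulrAC -mulrA; apply: Hy.
  exact: nx.
have mem y : ann M y -> y * x = 0 -> ann (addl M x) y.
  move=> Hy yx z [a Hz]; rewrite -(subrK (sg a * x) z) mulrDr mulrCA yx mulr0 addr0.
  exact: Hy.
have [K|] := pselect (forall y, ann M y -> y * x = 0).
  apply: leq_trans (leqnSn _); apply: ldim_mono; try exact: ideal_subsp.
  by move=> y Hy; apply: mem => //; apply: K.
move=> /existsNP[y0 /not_implyP[My0 y0x]].
have [a0 Ha0] := sx _ My0.
have a00 : a0 != 0 by apply/eqP => a00; apply: y0x; rewrite Ha0 a00 rmorph0 mul0r.
rewrite -(@ldim_addl _ y0) //; last 2 first.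
- exact: ideal_subsp.
- by move=> H; apply: y0x; apply: H; apply: mem_addl; exact: ideal_subsp.
apply: ldim_mono; [exact: ideal_subsp|by apply: addl_subsp; exact: ideal_subsp|].
move=> y Hy; have [a Ha] := sx _ Hy; exists (a / a0); apply: mem.
  by apply: (idlB AMi) => //; apply: (idlMl _ AMi).
by rewrite mulrBl -mulrA Ha0 mulrA -rmorphM divfK // Ha subrr.
Qed.

(** The two inequalities are [ldim_ann_le] for [L] inside [S] and for zero inside [L]. *)
Lemma ldim_ann L : is_ideal L -> (ldim (ann L) + ldim L = ldim setT + ldim (ideal0 S))%N.
Proof.
move=> Li; apply/eqP; rewrite eqn_leq; apply/andP; split.
  have := ldim_ann_le (@idealT_ideal S) Li (@subsetT _ L).
  suff -> : ann setT = ideal0 S by rewrite addnC [X in (_ <= X)%N]addnC.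
  apply/seteqP; split; first by move=> x /(_ 1 I); rewrite mulr1.
  by move=> _ -> y _; rewrite mul0r.
have := ldim_ann_le Li i0 (fun x (x0 : ideal0 S x) => eq_ind_r L (idl0 Li) x0).
suff -> : ann (ideal0 S) = setT by [].
by apply/seteqP; split=> // x _ _ ->; rewrite mulr0.
Qed.

Lemma annK L : is_ideal L -> ann (ann L) = L.
Proof.
move=> Li; have Ai : is_ideal (ann L) by exact: colon_ideal.
have AAi : is_ideal (ann (ann L)) by exact: colon_ideal.
have sub : L `<=` ann (ann L) by move=> x Lx y Hy; rewrite mulrC; apply: Hy.
apply/seteqP; split=> //; apply: ldim_eq => //; try exact: ideal_subsp.
by rewrite -(leq_add2l (ldim (ann L))) addnC (ldim_ann Ai) (ldim_ann Li).
Qed.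

Lemma colengthE L : is_ideal L -> colength L = (ldim setT - ldim (ann L))%N.
Proof.
move=> Li; rewrite /colength (mod_lengthE (@idealT_ideal S) i0 (@subsetT _ _)) (mod_lengthE (@idealT_ideal S) Li (@subsetT _ _)).
have le0 : (ldim (ideal0 S) <= ldim L)%N.
  by apply: ldim_mono; try exact: ideal_subsp; move=> _ ->; exact: idl0.
have leT : (ldim L <= ldim setT)%N.
  apply: ldim_mono => //; exact: ideal_subsp.
have := ldim_ann Li; lia.
Qed.
End Gorenstein.
End Dimension.

(** * Polynomial presentations of local rings *)

Section Existence.
Variables (S : comNzRingType) (n : set S).
Hypotheses (loc : local_ring n) (art : artinian S) (emb : (0 < embdim n)%N).
Let ni := loc_ideal loc.

(** A positive [embdim] is not the default value 0 of [residue_dim], so [n / n^2] has a finite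
    basis, which Nakayama lifts to generators. *)
Lemma loc_fg : exists r (g : 'I_r -> S), (forall i, n (g i)) /\ n `<=` ideal_gen (range g).
Proof.
have : exists d, exists e : 'I_d -> S, residue_basis n n (ideal_exp n 2) e.
  apply: contrapT => H; move: emb; rewrite /embdim /residue_dim.
  by rewrite xgetPN // => d Hd; apply: H; exists d.
move=> [d [g [ng sp _]]]; exists d, g; split=> //.
have Gi := ideal_gen_ideal (range g).
apply: (nakayama (loc_nilp loc art)) => // x /sp[a Ha].
exists (\sum_i a i * g i), (x - \sum_i a i * g i); split.
- by apply/gen_rangeP; exists a.
- by move: Ha; rewrite -{3}(ideal_exp1 ni).
- by rewrite addrC subrK.
Qed.

Variables (F : fieldType) (sg : {rmorphism F -> S}).
Hypothesis cov : forall x, exists a, n (x - sg a).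

Lemma coef_span t : exists (I : finType) (e : I -> S),
  forall x, exists a : I -> F, ideal_exp n t (x - \sum_i sg (a i) * e i).
Proof.
have [r [g [ng gn]]] := loc_fg.
elim: t => [|t [I [e sp]]]; first by exists unit, (fun=> 0) => x; exists (fun=> 0).
exists ('I_1 + 'I_r * I)%type, (fun i => if i is inr (j, k) then g j * e k else 1) => x.
have [a Ha] := cov x; have /gen_rangeP[y Hy] := gn _ Ha.
have [b Hb] := choice (fun j => sp (y j)).
exists (fun i => if i is inr (j, k) then b j k else a).
rewrite big_sumType big_ord1 /= mulr1 opprD addrA Hy.
set w := (X in _ - X); have -> : w = \sum_j \sum_k sg (b j k) * (g j * e k).
  by rewrite pair_bigA; apply: eq_bigr => -[].
rewrite -sumrB.
apply: (idl_sum _ (ideal_exp_ideal n t.+1)) => j _.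
have -> : \sum_k sg (b j k) * (g j * e k) = g j * \sum_k sg (b j k) * e k.
  by rewrite mulr_sumr; apply: eq_bigr => k _; rewrite mulrCA.
by rewrite mulrC -mulrBr; apply: ideal_expS.
Qed.

(** The existential hides that the field of [A] is [F]; [E] records it, so that properties of the
    image of [sg], such as lying in degree 0, carry over to [la_s A]. *)
Lemma exists_loc_alg : exists (A : loc_alg n) (E : F = la_F A),
  forall a : F, la_s A (ecast K K E a) = sg a.
Proof.
have nil := loc_nilp loc art; have [k nk] := nil.
have [I [e sp]] := coef_span k.
pose A := @LocAlg S n F sg #|I| (fun i => e (enum_val i)) ni (loc_1 loc) (loc_unit loc) cov nil.
have sp' x : exists a : 'I_#|I| -> F, x = \sum_i sg (a i) * e (enum_val i).
  have [a /nk/eqP] := sp x; rewrite subr_eq0 => /eqP ->.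
  exists (fun i => a (enum_val i)).
  rewrite (reindex (@enum_val I I)) //=.
  by exists enum_rank => i _; [exact: enum_valK|exact: enum_rankK].
by exists (A sp'), erefl.
Qed.
End Existence.

(** * Order of vanishing of polynomials, and setting variables to zero *)

Section OrdGe.
Variables (F : fieldType) (m : nat).
Implicit Types (p q : {mpoly F[m]}) (t : nat).

(** Membership in [(X)^t], read off the coefficients. *)
Definition ordge t p := forall mon, (mdeg mon < t)%N -> p@_mon = 0.

Lemma ordgeD t p q : ordge t p -> ordge t q -> ordge t (p + q).
Proof. by move=> Hp Hq mon Hm; rewrite mcoeffD Hp // Hq // addr0. Qed.
Lemma ordgeN t p : ordge t p -> ordge t (- p).
Proof. by move=> Hp mon Hm; rewrite mcoeffN Hp // oppr0. Qed.
Lemma ordgeB t p q : ordge t p -> ordge t q -> ordge t (p - q).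
Proof. by move=> Hp Hq; apply: ordgeD => //; apply: ordgeN. Qed.
Lemma ordge_zero t : ordge t 0. Proof. by move=> mon _; rewrite mcoeff0. Qed.
Lemma ordge_sum t (I : Type) (r : seq I) (P : pred I) (f : I -> {mpoly F[m]}) :
  (forall i, P i -> ordge t (f i)) -> ordge t (\sum_(i <- r | P i) f i).
Proof.
move=> H; elim/big_ind: _ => //; [exact: ordge_zero|exact: ordgeD].
Qed.
Lemma ordgeX t mon : (t <= mdeg mon)%N -> ordge t 'X_[mon].
Proof.
by move=> tm mon' H; rewrite mcoeffX; case: eqP => // E; move: H; rewrite -E ltnNge tm.
Qed.
Lemma ordgeZ t c p : ordge t p -> ordge t (c *: p).
Proof. by move=> Hp mon Hm; rewrite mcoeffZ Hp // mulr0. Qed.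
Lemma ordge_msupp t p : ordge t p <-> (forall mon, mon \in msupp p -> (t <= mdeg mon)%N).
Proof.
split=> H mon Hm; last by apply/memN_msupp_eq0/negP => /H; rewrite leqNgt Hm.
by rewrite leqNgt; apply/negP => /H /eqP; apply/negP; rewrite -mcoeff_msupp.
Qed.
Lemma ordgeM i j p q : ordge i p -> ordge j q -> ordge (i + j) (p * q).
Proof.
move=> /ordge_msupp Hp /ordge_msupp Hq.
rewrite [p]mpolyE [q]mpolyE big_distrlr /= big_seq; apply: ordge_sum => a Ha.
rewrite big_seq; apply: ordge_sum => b Hb.
rewrite -scalerAl -scalerAr -mpolyXD; do 2! apply: ordgeZ.
by apply: ordgeX; rewrite mdegD leq_add // ?Hp ?Hq.
Qed.
Lemma ordge_homog t p : p \is t.-homog -> ordge t p.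
Proof. by move=> /dhomogP H; apply/ordge_msupp => mon /H ->. Qed.
Lemma ordge_leq i j p : (i <= j)%N -> ordge j p -> ordge i p.
Proof. by move=> ij Hp mon Hm; apply: Hp; apply: leq_trans ij. Qed.
Lemma mcoeff_pihomog t p mon : (pihomog mdeg t p)@_mon = if mdeg mon == t then p@_mon else 0.
Proof.
rewrite pihomogE raddf_sum /=; have [mp|mp] := boolP (mon \in msupp p); last first.
  rewrite (memN_msupp_eq0 mp) if_same big_seq_cond big1 // => i /andP[ip _].
  by rewrite mcoeffZ mcoeffX; case: eqP ip mp => [->->//|_ _ _]; rewrite mulr0.
rewrite big_mkcond (bigD1_seq mon) //= ?msupp_uniq // big1 ?addr0 => [|i ne].
  by case: eqP => _; rewrite ?mcoeff0 // mcoeffZ mcoeffX eqxx mulr1.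
by case: eqP => _; rewrite ?mcoeff0 // mcoeffZ mcoeffX (negPf ne) mulr0.
Qed.
Lemma ordge_pihomog t p : ordge t p -> ordge t.+1 (p - pihomog mdeg t p).
Proof.
move=> Hp mon; rewrite ltnS leq_eqVlt mcoeffB mcoeff_pihomog => /orP[->|lt].
  by rewrite subrr.
by rewrite Hp // if_same subrr.
Qed.
Lemma ordge_homog_eq0 t p : ordge t.+1 p -> p \is t.-homog -> p = 0.
Proof.
move=> Hp hp; apply/mpolyP => mon; rewrite mcoeff0.
by have [E|ne] := eqVneq (mdeg mon) t; [rewrite Hp ?E|rewrite (dhomog_nemf_coeff hp)].
Qed.
Lemma ordgeS t p : ordge t p -> pihomog mdeg t p = 0 -> ordge t.+1 p.
Proof. by move=> /ordge_pihomog; move=> + E; rewrite E subr0. Qed.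
(** The lowest forms multiply, and polynomials over a field have no zero divisors. *)
Lemma ordge_dom i j p q : ordge i p -> ordge j q -> ordge (i + j).+1 (p * q) ->
  ordge i.+1 p \/ ordge j.+1 q.
Proof.
move=> Hp Hq Hpq; set P := pihomog mdeg i p; set Q := pihomog mdeg j q.
have hP : P \is i.-homog by exact: pihomogP.
have hQ : Q \is j.-homog by exact: pihomogP.
have /eqP : P * Q = 0.
  apply: (@ordge_homog_eq0 (i + j)); last exact: dhomogM.
  have -> : P * Q = p * q - (p - P) * q - P * (q - Q) by ring.
  apply: ordgeB; first apply: ordgeB => //.
    by rewrite -addSn; apply: ordgeM => //; apply: ordge_pihomog.
  by rewrite -addnS; apply: ordgeM; [exact: ordge_homog|exact: ordge_pihomog].
by rewrite mulf_eq0 => /orP[] /eqP E; [left|right]; apply: ordgeS.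
Qed.

Section Kill.
Variable Z : pred 'I_m.

(** A substitution with kernel [varZ Z]: congruences modulo the variables in [Z] become equations
    between polynomials. *)
Definition kill : {rmorphism {mpoly F[m]} -> {mpoly F[m]}} :=
  mmap (@mpolyC m F) (fun i => if Z i then 0 else 'X_i).
Definition varZ : set {mpoly F[m]} := ideal_gen [set 'X_i | i in [set i | Z i]].

Lemma killX mon : kill 'X_[mon] = if [exists i, Z i && (mon i != 0)%N] then 0 else 'X_[mon].
Proof.
rewrite /kill /= mmapX /mmap1; case: existsP => [[i /andP[Zi mi]]|H].
  by rewrite (bigD1 i) //= Zi expr0n (negPf mi) mul0r.
rewrite [RHS]mpolyXE_id; apply: eq_bigr => i _.
case: ifP => // Zi; have [->|mi] := eqVneq (mon i) 0%N; first by rewrite !expr0.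
by case: H; exists i; rewrite Zi.
Qed.
Lemma killXU i : kill 'X_i = if Z i then 0 else 'X_i.
Proof. by rewrite /kill /= mmapX mmap1U. Qed.
Lemma killZ c p : kill (c *: p) = c *: kill p.
Proof. by rewrite /kill /= mmapZ mul_mpolyC. Qed.
Lemma kill_sum p : kill p = \sum_(mon <- msupp p) p@_mon *: kill 'X_[mon].
Proof. by rewrite {1}[p]mpolyE raddf_sum /=; apply: eq_bigr => mon _; rewrite killZ. Qed.
Lemma ordge_kill t p : ordge t p -> ordge t (kill p).
Proof.
move=> /ordge_msupp Hp; rewrite kill_sum big_seq; apply: ordge_sum => mon /Hp Hm.
by apply: ordgeZ; rewrite killX; case: ifP => _; [exact: ordge_zero|exact: ordgeX].
Qed.
Lemma varZ_X i : Z i -> varZ 'X_i.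
Proof. by move=> Zi; apply: sub_ideal_gen; exists i. Qed.
Lemma varZ_kill p : varZ (p - kill p).
Proof.
have Vi : is_ideal varZ by exact: ideal_gen_ideal.
rewrite kill_sum {1}[p]mpolyE -sumrB; apply: (idl_sum _ Vi) => mon _.
rewrite -scalerBr -mul_mpolyC; apply: (idlMl _ Vi); rewrite killX.
case: ifP => [/existsP[i /andP[Zi mi]]|_]; last by rewrite subrr; exact: idl0.
rewrite subr0 -(submK (m := U_(i)%MM) (m' := mon)); last by rewrite lep1mP.
by rewrite mpolyXD; apply: (idlMl _ Vi); apply: varZ_X.
Qed.
Lemma varZP p : varZ p <-> kill p = 0.
Proof.
split=> [|H]; last by rewrite -[p]subr0 -H; exact: varZ_kill.
suff: varZ `<=` [set p | kill p = 0] by apply.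
apply: ideal_gen_min => [|_ [i Zi <-]] /=; last by rewrite killXU Zi.
split=> /= [|x y Hx Hy|a x Hx]; first exact: rmorph0.
  by rewrite rmorphD /= Hx Hy addr0.
by rewrite rmorphM /= Hx mulr0.
Qed.
End Kill.
End OrdGe.
Arguments kill {F m} Z.

(** * Evaluation of polynomials at generators of the maximal ideal *)

Section Evaluation.
Variables (S : comNzRingType) (n : set S) (A : loc_alg n) (m : nat) (x : 'I_m -> S).
Local Notation F := (la_F A).
Local Notation sg := (la_s A).
Let ni := la_ideal A.
Local Notation P := {mpoly F[m]}.
Implicit Types (p q : P) (t : nat).

Definition ev : {rmorphism P -> S} := mmap sg x.

Lemma evZ c p : ev (c *: p) = sg c * ev p.
Proof. exact: mmapZ. Qed.
Lemma evC c : ev c%:MP = sg c.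
Proof. exact: mmapC. Qed.
Lemma evXU i : ev 'X_i = x i.
Proof. by rewrite /ev /= mmapX mmap1U. Qed.
Lemma evE p : ev p = \sum_(mon <- msupp p) sg p@_mon * ev 'X_[mon].
Proof. by rewrite {1}[p]mpolyE raddf_sum /=; apply: eq_bigr => mon _; rewrite evZ. Qed.

Hypotheses (nx : forall i, n (x i)) (gx : n `<=` ideal_gen (range x)).

Lemma ev_mon mon : ideal_exp n (mdeg mon) (ev 'X_[mon]).
Proof.
rewrite /ev /= mmapX /mmap1 mdegE.
elim/big_ind2: _ => // [a b c d|i _]; first exact: ideal_expD.
exact: ideal_expX.
Qed.
Lemma ev_ordge t p : ordge t p -> ideal_exp n t (ev p).
Proof.
move=> /ordge_msupp Hp; rewrite evE big_seq; apply: (idl_sum _ (ideal_exp_ideal n t)) => mon /Hp le.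
by apply: (idlMl _ (ideal_exp_ideal n t)); apply: ideal_exp_leq (ev_mon mon).
Qed.

Lemma ev_homog_surj t y : ideal_exp n t y ->
  exists2 p, p \is t.-homog & ideal_exp n t.+1 (y - ev p).
Proof.
elim: t y => [|t IH] y Hy.
  have [a Ha] := la_cov A y; exists a%:MP; last by rewrite evC ideal_exp1.
  by rewrite -[a%:MP]mulr1 mul_mpolyC; apply: rpredZ; exact: dhomog1.
have E1 := ideal_exp_ideal n t.+1; have E2 := ideal_exp_ideal n t.+2.
pose T := [set y | ideal_exp n t.+1 y /\ exists2 p, p \is t.+1.-homog & ideal_exp n t.+2 (y - ev p)].
suff: ideal_exp n t.+1 `<=` T by move=> /(_ _ Hy)[].
apply: ideal_mul_min.
  split; first by split; [exact: (idl0 E1)|exists 0; rewrite ?rpred0 // rmorph0 subrr; exact: (idl0 E2)].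
    move=> u w [Hu [p hp Hp]] [Hw [q hq Hq]]; split; first exact: (idlD E1).
    by exists (p + q); rewrite ?rpredD // rmorphD opprD addrACA; exact: (idlD E2).
  move=> a w [Hw [p hp Hp]]; split; first exact: (idlMl _ E1).
  have [c Hc] := la_cov A a; exists (c *: p); first exact: rpredZ.
  have -> : a * w - ev (c *: p) = (a - sg c) * w + sg c * (w - ev p) by rewrite evZ; ring.
  by apply: (idlD E2); [exact: ideal_expS|exact: (idlMl _ E2)].
move=> u w nu Hw; split; first exact: ideal_expS.
have [p hp Hp] := IH _ Hw; have /gen_rangeP[a Ha] := gx nu.
have [c Hc] := choice (fun i => la_cov A (a i)).
exists ((\sum_i c i *: 'X_i) * p).
  rewrite -add1n; apply: dhomogM => //; apply: rpred_sum => i _.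
  by apply: rpredZ; rewrite dhomogX /= mdeg1.
have -> : u * w - ev ((\sum_i c i *: 'X_i) * p) =
   (u - \sum_i sg (c i) * x i) * w + (\sum_i sg (c i) * x i) * (w - ev p).
  rewrite rmorphM raddf_sum /=; under [X in _ - X * _]eq_bigr do rewrite evZ evXU.
  ring.
apply: (idlD E2).
  apply: (ideal_expD (i := 2)) => //; rewrite Ha -sumrB.
  apply: (idl_sum _ (ideal_exp_ideal n 2)) => i _; rewrite -mulrBl.
  exact: ideal_exp2.
apply: ideal_expS => //; apply: (idl_sum _ ni) => i _; exact: (idlMl _ ni).
Qed.

(** Forms of degree [t], [t + 1] and so on approximate [y] better and better, and a power of [n]
    vanishes. *)
Lemma ev_surj t y : ideal_exp n t y -> exists2 p, ordge t p & ev p = y.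
Proof.
move=> Hy; have [k nk] := la_nil A.
suff [p Hp Ep] : exists2 p, ordge t p & ideal_exp n (t + k) (y - ev p).
  exists p => //; apply/esym/eqP; rewrite -subr_eq0; apply/eqP/nk.
  by apply: ideal_exp_leq Ep; rewrite leq_addl.
elim: k {nk} => [|k [p Hp Ep]]; first by exists 0; [exact: ordge_zero|rewrite rmorph0 subr0 addn0].
have [q hq Hq] := ev_homog_surj Ep; exists (p + q).
  by apply: ordgeD => //; apply: ordge_leq (ordge_homog hq); rewrite leq_addr.
by rewrite rmorphD opprD addrA addnS.
Qed.
Lemma ev_onto y : exists p, ev p = y.
Proof. by have [//|p _ <-] := @ev_surj 0 y; exists p. Qed.

Hypotheses (me : m = (ldim A n - ldim A (ideal_exp n 2))%N) (m0 : (0 < m)%N).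

Lemma n2_sub : ideal_exp n 2 `<=` n.
Proof. by rewrite -[X in _ `<=` X](ideal_exp1 ni); apply: ideal_exp_leq. Qed.

Lemma embdimE : embdim n = (ldim A n - ldim A (ideal_exp n 2))%N.
Proof.
rewrite /embdim (residue_dimE A) //; [exact: ideal_exp_ideal|exact: n2_sub|].
by move=> u w; exact: ideal_exp2 ni.
Qed.

(** Below [v_inv n] the dimension of [n^t / n^(t+1)] is at least the number of monomials of degree
    [t] in [embdim n] variables. The monomials in [x] span this quotient, hence are independent. *)
Lemma ev_homog_eq0 t p : (t < v_inv n)%N -> p \is t.-homog -> ideal_exp n t.+1 (ev p) -> p = 0.
Proof.
move=> /least_lt /= nv hp Ep.
have [Et Et1] := (ideal_exp_ideal n t, ideal_exp_ideal n t.+1).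
have sub : ideal_exp n t.+1 `<=` ideal_exp n t by apply: ideal_exp_leq.
pose b := [seq s2m s | s : t.-tuple 'I_m <- enum (basis m t)].
have sb : size b = 'C(m - 1 + t, t).
  by rewrite /b; case: (m) m0 => // m' _; rewrite size_basis subSS subn0 addnC.
have ub : uniq b by exact: uniq_basis.
have bP mon : (mdeg mon == t) = (mon \in b) by exact: basis_cover.
pose M (i : 'I_(size b)) := nth 0%MM b i.
have homE q : q \is t.-homog -> q = \sum_i q@_(M i) *: 'X_[M i].
  move=> hq; transitivity (\sum_(mon <- b) q@_mon *: 'X_[mon]); last first.
    by rewrite (big_nth 0%MM) big_mkord.
  rewrite {1}[q]mpolyE.
  rewrite [RHS](bigID (mem (msupp q))) /= [X in _ + X]big1 ?addr0; last first.
    by move=> mon mq; rewrite (memN_msupp_eq0 mq) scale0r.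
  rewrite -[RHS]big_filter; apply: perm_big; apply: uniq_perm.
  - exact: msupp_uniq.
  - exact: filter_uniq.
  - move=> mon; rewrite mem_filter -bP andb_idr // => mq.
    by move/dhomogP: hq => ->.
have evh q : q \is t.-homog -> ev q = \sum_i sg q@_(M i) * ev 'X_[M i].
  by move=> hq; rewrite {1}(homE q hq) raddf_sum /=; apply: eq_bigr => i _; rewrite evZ.
have sp : spans A (ideal_exp n t) (ideal_exp n t.+1) (fun i => ev 'X_[M i]).
  move=> y /ev_homog_surj[q hq Hq]; exists (fun i => q@_(M i)).
  by rewrite -evh.
have le : (ldim A (ideal_exp n t.+1) + size b <= ldim A (ideal_exp n t))%N.
  move: nv; rewrite (residue_dimE A Et Et1 sub); last by move=> u w; exact: ideal_expS.
  rewrite embdimE -me -sb => /negP; rewrite -leqNgt leq_subRL //.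
  by apply: ldim_mono => //; exact: ideal_subsp.
have ind := spans_indep (ideal_subsp A Et) (ideal_subsp A Et1) sp le.
rewrite (homE p hp) big1 // => i _; rewrite (ind (fun i => p@_(M i))) ?scale0r //.
by rewrite -evh.
Qed.

(** The lowest form of [p] is removed degree by degree with [ev_homog_eq0]. For [ev p = 0] this
    bounds the order of the relations of [S] from below by [v_inv n]. *)
Lemma ev_ordgeP t p : (t <= v_inv n)%N -> ideal_exp n t (ev p) -> ordge t p.
Proof.
elim: t => // t IH tv Hp.
have Ht : ordge t p by apply: IH (ltnW tv) _; apply: ideal_exp_leq Hp.
apply: ordgeS => //; apply: (ev_homog_eq0 tv); first exact: pihomogP.
have -> : pihomog mdeg t p = p - (p - pihomog mdeg t p) by rewrite subKr.
rewrite rmorphB; apply: (idlB (ideal_exp_ideal n t.+1)) => //.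
by apply: ev_ordge; apply: ordge_pihomog.
Qed.

Section SubSystem.
Variable Z : pred 'I_m.
Definition idZ : set S := ideal_gen [set x i | i in [set i | Z i]].

Lemma idZ_ideal : is_ideal idZ. Proof. exact: ideal_gen_ideal. Qed.
Lemma ev_varZ p : varZ Z p -> idZ (ev p).
Proof.
suff: varZ Z `<=` [set p | idZ (ev p)] by apply.
apply: ideal_gen_min => [|_ [i Zi <-]] /=; last by rewrite evXU; apply: sub_ideal_gen; exists i.
split=> /= [|u w Hu Hw|a w Hw]; first by rewrite rmorph0; exact: (idl0 idZ_ideal).
  by rewrite rmorphD; exact: (idlD idZ_ideal).
by rewrite rmorphM; exact: (idlMl _ idZ_ideal).
Qed.
Lemma idZ_ev y : idZ y -> exists2 p, varZ Z p & ev p = y.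
Proof.
have Vi : is_ideal (varZ (F := F) Z) by exact: ideal_gen_ideal.
suff: idZ `<=` [set y | exists2 p, varZ Z p & ev p = y] by apply.
apply: ideal_gen_min => [|_ [i Zi <-]] /=; last by exists 'X_i; [exact: varZ_X|rewrite evXU].
split=> /= [|_ _ [p Vp <-] [q Vq <-]|a _ [p Vp <-]].
- by exists 0; [exact: (idl0 Vi)|rewrite rmorph0].
- by exists (p + q); [exact: (idlD Vi)|rewrite rmorphD].
- by have [b <-] := ev_onto a; exists (b * p); [exact: (idlMl _ Vi)|rewrite rmorphM].
Qed.

Lemma ev_killP t p : (t <= v_inv n)%N -> ideal_add idZ (ideal_exp n t) (ev p) -> ordge t (kill Z p).
Proof.
move=> tv [_ [w [/idZ_ev[q Vq <-] Hw E]]].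
have -> : kill Z p = kill Z (p - q).
  by move/varZP: Vq => Vq; rewrite rmorphB /= Vq subr0.
apply: ordge_kill; apply: (ev_ordgeP tv).
by rewrite rmorphB E addrC addKr.
Qed.
Lemma ev_killW t p : ordge t (kill Z p) -> ideal_add idZ (ideal_exp n t) (ev p).
Proof.
move=> H; exists (ev (p - kill Z p)), (ev (kill Z p)); split.
- by apply: ev_varZ; apply: varZ_kill.
- exact: ev_ordge.
- by rewrite -rmorphD subrK.
Qed.

(* The associated graded ring of [S] is a polynomial ring, hence a domain, in
   degrees less than [v_inv n]. *)
Lemma ev_dom i j y w : (i + j < v_inv n)%N -> ideal_exp n i y -> ideal_exp n j w ->
  ideal_add idZ (ideal_exp n (i + j).+1) (y * w) ->
  ideal_add idZ (ideal_exp n i.+1) y \/ ideal_add idZ (ideal_exp n j.+1) w.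
Proof.
move=> ijv /ev_surj[p Hp <-] /ev_surj[q Hq <-]; rewrite -rmorphM => /(ev_killP ijv).
rewrite rmorphM => /(ordge_dom (@ordge_kill _ _ Z _ _ Hp) (@ordge_kill _ _ Z _ _ Hq))[H|H].
  by left; apply: ev_killW.
by right; apply: ev_killW.
Qed.
End SubSystem.
End Evaluation.

(** * Condition (I) *)

Section Fitting.
Variables (S : comNzRingType) (n : set S) (A : loc_alg n).
Local Notation F := (la_F A).
Local Notation sg := (la_s A).
Local Notation ldim := (ldim A).
Let ni := la_ideal A.
Implicit Types (K L M D : set S).

Lemma indep_residue L M d (g : 'I_d -> S) (a : 'I_d -> S) : is_ideal M ->
  (forall u w, n u -> L w -> M (u * w)) -> (forall i, L (g i)) -> indep A M g ->
  M (\sum_i a i * g i) -> forall i, n (a i).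
Proof.
move=> Mi nL Lg ig Ha i; have [b Hb] := choice (fun i => la_cov A (a i)).
rewrite -(subrK (sg (b i)) (a i)); apply: (idlD ni) => //.
rewrite (ig b) ?rmorph0; first exact: idl0.
apply: (idlBKr Mi) Ha; rewrite -sumrB; apply: (idl_sum _ Mi) => j _.
by rewrite -mulrBl; apply: nL.
Qed.

Lemma spans_gen L M d (g : 'I_d -> S) : is_ideal L -> is_ideal M -> (forall i, L (g i)) ->
  spans A L (ideal_add M (ideal_mul n L)) g -> L `<=` ideal_add M (ideal_gen (range g)).
Proof.
move=> Li Mi Lg sp; have Gi := ideal_gen_ideal (range g).
apply: (nakayama (la_nil A)) => //; first exact: ideal_add_ideal.
move=> x /sp[a [m [l [Mm Hl Ea]]]].
exists (m + \sum_i sg (a i) * g i), l; split=> //; last by rewrite addrAC -Ea subrK.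
exists m, (\sum_i sg (a i) * g i); split=> //.
by apply/gen_rangeP; exists (fun i => sg (a i)).
Qed.

(** All relations between the [g i] are taken, so that no presentation has to be chosen; for a
    minimal system of generators this is [Fitt^1]. *)
Definition syz_ideal d (g : 'I_d -> S) : set S :=
  ideal_gen [set x | exists w : 'I_d -> S, \sum_i w i * g i = 0 /\ exists i, x = w i].

Lemma syz_ideal_mem d (g w : 'I_d -> S) i : \sum_i w i * g i = 0 -> syz_ideal g (w i).
Proof. by move=> H; apply: sub_ideal_gen; exists w; split=> //; exists i. Qed.

(** Expanding [a] and [b] in the generators turns [u a - w b = 0] into a syzygy with coefficients
    [u al_l - w be_l]. Independence modulo [n K] makes a two by two minor of [(al, be)] a unit, and
    Cramer's rule recovers [u] and [w]. *)
Lemma syz_pair K d (g : 'I_d -> S) a b u w : is_ideal K -> (forall i, K (g i)) ->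
  K `<=` ideal_gen (range g) -> K a -> K b ->
  (forall s t, ideal_mul n K (s * a + t * b) -> n s /\ n t) ->
  u * a = w * b -> syz_ideal g u /\ syz_ideal g w.
Proof.
move=> Ki Kg gK /gK/gen_rangeP[al Ea] /gK/gen_rangeP[be Eb] ind uw.
have nKi := ideal_mul_ideal n K; have Ei : is_ideal (syz_ideal g) by exact: ideal_gen_ideal.
have [i ai] : exists i, ~ n (al i).
  apply: contrapT => H; apply: (la_1 A); apply: (proj1 (ind 1 0 _)).
  rewrite mul1r mul0r addr0 Ea; apply: (idl_sum _ nKi) => i _.
  by apply: ideal_mulM => //; apply: contrapT => ?; apply: H; exists i.
have [ai' Hai] := la_unit A ai.
(* If all minors with column [i] were in [n], then [b] would be a multiple of [a] modulo [n K]. *)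
have [j Dj] : exists j, ~ n (al i * be j - al j * be i).
  apply: contrapT => H; apply: (la_1 A); apply: (proj2 (ind (- (be i * ai')) 1 _)).
  have -> : - (be i * ai') * a + 1 * b = \sum_j (ai' * (al i * be j - al j * be i)) * g j.
    rewrite Ea Eb mul1r mulr_sumr -big_split; apply: eq_bigr => j _ /=.
    have -> : ai' * (al i * be j - al j * be i) = al i * ai' * be j - be i * ai' * al j by ring.
    by rewrite Hai; ring.
  apply: (idl_sum _ nKi) => j _; apply: ideal_mulM => //; apply: (idlMl _ ni).
  by apply: contrapT => ?; apply: H; exists j.
have [D' HD] := la_unit A Dj.
have r l : syz_ideal g (u * al l - w * be l).
  apply: (syz_ideal_mem (w := fun l => u * al l - w * be l)).
  apply: etrans (_ : u * a - w * b = 0); last by rewrite uw subrr.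
  by rewrite Ea Eb !mulr_sumr -sumrB; apply: eq_bigr => k _; ring.
split.
  have -> : u = D' * (be j * (u * al i - w * be i) - be i * (u * al j - w * be j)).
    have -> : be j * (u * al i - w * be i) - be i * (u * al j - w * be j) =
       u * (al i * be j - al j * be i) by ring.
    by rewrite mulrC -mulrA HD mulr1.
  by apply: (idlMl _ Ei); apply: (idlB Ei); apply: (idlMl _ Ei).
have -> : w = D' * (al j * (u * al i - w * be i) - al i * (u * al j - w * be j)).
  have -> : al j * (u * al i - w * be i) - al i * (u * al j - w * be j) =
     w * (al i * be j - al j * be i) by ring.
  by rewrite mulrC -mulrA HD mulr1.
by apply: (idlMl _ Ei); apply: (idlB Ei); apply: (idlMl _ Ei).
Qed.

Section SyzGen.
Variables (d : nat) (g : 'I_d -> S).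
Let Phi (U : 'M[F]_(d, la_N A)) : 'cV[S]_d := \col_i \sum_k sg (U i k) * la_e (l:=A) k.

(** Syzygies come from a subspace of the coordinate matrices over [F]; the images of a basis of it
    are the columns of [phi]. *)
Lemma syz_fg : exists b (phi : 'M[S]_(d, b)), forall w : 'cV[S]_d,
  (\row_i g i) *m w = 0 <-> exists u : 'cV[S]_b, w = phi *m u.
Proof.
have PhiD a U V : Phi (a *: U + V) = sg a *: Phi U + Phi V.
  apply/matrixP => i j; rewrite !mxE mulr_sumr -big_split; apply: eq_bigr => k _.
  by rewrite !mxE rmorphD rmorphM mulrDl mulrA.
have Phi0 : Phi 0 = 0.
  by apply/matrixP => i j; rewrite !mxE big1 // => k _; rewrite mxE rmorph0 mul0r.
have [||U HU] := @vspace_of_pred F 'M[F]_(d, la_N A) [set U | (\row_i g i) *m Phi U = 0].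
- by rewrite /= Phi0 mulmx0.
- by move=> a u v /= Hu Hv; rewrite PhiD mulmxDr -scalemxAr Hu Hv scaler0 addr0.
pose b := \dim U; pose vb (j : 'I_b) := (vbasis U)`_j.
exists b, (\matrix_(i, j) Phi (vb j) i 0) => w; split=> [H|[u ->]].
  have [a Ha] := choice (fun i => la_span A (w i 0)).
  pose V := \matrix_(i, k) a i k.
  have wV : w = Phi V.
    apply/matrixP => i j; rewrite ord1 mxE Ha; apply: eq_bigr => k _.
    by rewrite mxE.
  have VU : V \in U by apply/HU; rewrite /= -wV.
  exists (\col_j sg (coord (vbasis U) j V)); rewrite wV {1}(coord_vbasis VU).
  have PhiS m (c : 'I_m -> F) (v : 'I_m -> _) : Phi (\sum_i c i *: v i) = \sum_i sg (c i) *: Phi (v i).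
    by elim/big_rec2: _ => // i y1 y2 _ <-; exact: PhiD.
  rewrite PhiS; apply/matrixP => i j; rewrite ord1 !mxE summxE; apply: eq_bigr => k _.
  by rewrite !mxE mulrC.
rewrite mulmxA; suff -> : (\row_i g i) *m (\matrix_(i, j) Phi (vb j) i 0) = 0 by rewrite mul0mx.
apply/matrixP => i j; rewrite ord1 [LHS]mxE [RHS]mxE.
have /HU /= /matrixP/(_ 0 0) E : vb j \in U by apply: vbasis_mem; apply: mem_nth; rewrite size_tuple.
rewrite [LHS]mxE [RHS]mxE in E; apply: etrans E.
by apply: eq_bigr => k _; rewrite [X in _ * X = _]mxE.
Qed.
End SyzGen.

(** Entries of a minimal presentation always lie in [n], since a basis of [K / n K] has no relation
    with a unit coefficient; only the other inclusion is left. It is asked for every generating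
    family because the minimal one is chosen in the proof. *)
Lemma is_Fitt1_max K : is_ideal K ->
  (forall d (g : 'I_d -> S), (forall i, K (g i)) -> K `<=` ideal_gen (range g) ->
     n `<=` syz_ideal g) ->
  is_Fitt1 K n.
Proof.
move=> Ki H; have nKi := ideal_mul_ideal n K; have i0 := @ideal0_ideal S.
have z0 : ideal_add (ideal0 S) (ideal_mul n K) = ideal_mul n K.
  apply/seteqP; split; last exact: ideal_addr.
  by apply: ideal_add_min => // _ ->; exact: idl0.
have K0 : ideal0 S `<=` K by move=> _ ->; exact: idl0.
have [g [Kg sp ig]] := exists_basis_id (ideal_subsp A Ki) (ideal_subsp A nKi) (ideal_mul_subr Ki).
set d := (_ - _)%N in g Kg sp ig.
have gK : K `<=` ideal_gen (range g).
  have := spans_gen Ki i0 Kg; rewrite z0 => /(_ sp); move=> KG x /KG[_ [y [-> Hy ->]]].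
  by rewrite add0r.
have [b [phi Hphi]] := syz_fg g.
have mulE (w : 'cV[S]_d) : (\row_i g i) *m w = (\sum_i w i 0 * g i)%:M.
  apply/matrixP => i j; rewrite !ord1 !mxE eqxx mulr1n; apply: eq_bigr => k _.
  by rewrite mxE mulrC.
have scal0 (x : S) : x%:M = 0 :> 'M_1 -> x = 0.
  by move=> /matrixP/(_ 0 0); rewrite !mxE eqxx mulr1n.
exists d, b, (\row_i g i), phi; split.
  split=> //; first by rewrite (num_genE A Ki i0 K0) z0.
  move=> x; split=> [/gK/gen_rangeP[a ->]|[w]].
    exists (\col_i a i); rewrite mulE; congr (_%:M); apply: eq_bigr => i _.
    by rewrite mxE.
  rewrite mulE => /matrixP/(_ 0 0); rewrite !mxE eqxx !mulr1n => <-.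
  by apply: (idl_sum _ Ki) => i _; apply: (idlMl _ Ki).
have Gi := ideal_gen_ideal [set x | exists i j, x = phi i j].
apply/seteqP; split.
  apply: subset_trans (H _ g Kg gK) _; apply: ideal_gen_min => // _ [w [w0 [i ->]]].
  have /Hphi[u Eu] : (\row_i g i) *m (\col_i w i) = 0.
    rewrite mulE; suff -> : \sum_i (\col_i w i) i 0 * g i = 0 by rewrite raddf0.
    by rewrite -[RHS]w0; apply: eq_bigr => k _; rewrite mxE.
  have := congr1 (fun M : 'cV[S]_d => M i 0) Eu; rewrite !mxE => ->.
  apply: (idl_sum _ Gi) => k _; apply: (idlMr _ Gi); apply: sub_ideal_gen.
  by exists i, k.
apply: ideal_gen_min => // _ [i [j ->]].
have : (\row_i g i) *m col j phi = 0 by apply/Hphi; exists (delta_mx j 0); rewrite colE.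
rewrite mulE => /scal0 E.
have := @indep_residue K _ d g (fun i => phi i j) nKi (fun u w nu Kw => ideal_mulM nu Kw) Kg ig.
apply; rewrite (_ : \sum_i _ = 0); first exact: idl0.
by rewrite -[RHS]E; apply: eq_bigr => k _; rewrite mxE.
Qed.

(** As [n^2] lies in [D], [n / D] is a vector space over [F], and any vector off the line of [u]
    serves as [w]. *)
Lemma indep_pair D u : is_ideal D -> ideal_exp n 2 `<=` D -> D `<=` n ->
  (2 <= ldim n - ldim D)%N -> n u -> ~ D u ->
  exists2 w, n w & forall s t, D (s * u + t * w) -> n s /\ n t.
Proof.
move=> Di n2D Dn d2 nu Du; have [HD Hn] := (ideal_subsp A Di, ideal_subsp A ni).
have [w nw Dw] : exists2 w, n w & ~ addl A D u w.
  apply: contrapT => H; have : n `<=` addl A D u.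
    by move=> w nw; apply: contrapT => ?; apply: H; exists w.
  by move/(ldim_mono Hn (addl_subsp u HD)); rewrite ldim_addl //; lia.
exists w => // s t; have [[a Ha] [b Hb]] := (la_cov A s, la_cov A t) => Hst.
have nD (x y : S) : n x -> n y -> D (x * y) by move=> nx ny; apply: n2D; apply: ideal_exp2.
have H2 : D (sg a * u + sg b * w).
  apply: (idlBKr Di) Hst.
  have -> : s * u + t * w - (sg a * u + sg b * w) = (s - sg a) * u + (t - sg b) * w by ring.
  by apply: (idlD Di); apply: nD.
have b0 : b = 0.
  apply/eqP; apply: contrapT => /negP b0; apply: Dw; exists (- (b^-1 * a)).
  have -> : w - sg (- (b^-1 * a)) * u = sg b^-1 * (sg a * u + sg b * w).
    by rewrite mulrDr !mulrA -!rmorphM mulVf // rmorph1 mul1r rmorphN; ring.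
  exact: (idlMl _ Di).
rewrite b0 rmorph0 mul0r addr0 in H2; rewrite b0 rmorph0 subr0 in Hb; split=> //.
have a0 : a = 0.
  apply/eqP; apply: contrapT => /negP a0; apply: Du.
  have -> : u = sg a^-1 * (sg a * u) by rewrite mulrA -rmorphM mulVf // rmorph1 mul1r.
  exact: (idlMl _ Di).
by rewrite a0 rmorph0 subr0 in Ha.
Qed.

(* For [u], [w] in [n], independent modulo [D], the relation
   [w (a u) = u (a w)] between elements [a u], [a w] of [K], which are
   independent modulo [n K], shows that [u] is in the Fitting ideal. *)
Lemma condI_criterion K D a : is_ideal K -> is_ideal D -> ideal_exp n 2 `<=` D -> D `<=` n ->
  (2 <= ldim n - ldim D)%N -> colon K n a ->
  (forall u, n u -> ideal_mul n K (a * u) -> D u) -> condI n K.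
Proof.
move=> Ki Di n2D Dn d2 Ka Ha.
have [u0 nu0 Du0] : exists2 u, n u & ~ D u.
  apply: contrapT => H; have : n `<=` D.
    by move=> w nw; apply: contrapT => ?; apply: H; exists w.
  by move/(ldim_mono (ideal_subsp A ni) (ideal_subsp A Di)); lia.
split; last first.
  (* If the two colon ideals agreed, [a * u0] would lie in [n K], and [u0] in [D]. *)
  by move=> E; apply: Du0; apply: Ha => //; move: Ka; rewrite -E; apply.
apply: is_Fitt1_max => // d g Kg gK.
have Ei : is_ideal (syz_ideal g) by exact: ideal_gen_ideal.
have out u : n u -> ~ D u -> syz_ideal g u.
  move=> nu Du; have [w nw ind] := indep_pair Di n2D Dn d2 nu Du.
  have [//|//|s t Hst||//] := @syz_pair K d g (a * u) (a * w) w u Ki Kg gK.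
  - exact: Ka.
  - exact: Ka.
  - apply: ind; apply: Ha; first by apply: (idlD ni); apply: (idlMl _ ni).
    by move: Hst; rewrite mulrDr !(mulrCA a).
  - by ring.
(* An element of [D] is a difference of elements outside [D]: [u = (u + u0) - u0]. *)
move=> u nu; have [Du|Du] := pselect (D u); last exact: out.
rewrite -(addrK u0 u); apply: (idlB Ei); last exact: out.
apply: out; first exact: idlD.
by move=> H; apply: Du0; rewrite -(addKr u u0) addrC; apply: (idlB Di).
Qed.
End Fitting.

Section System.
Variables (S : comNzRingType) (n : set S) (A : loc_alg n) (K : set S).
Hypotheses (Ki : is_ideal K) (Kn : K `<=` n).
Local Notation F := (la_F A).
Local Notation sg := (la_s A).
Local Notation ldim := (ldim A).
Let ni := la_ideal A.

Definition lin : set S := ideal_add K (ideal_exp n 2).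
Let n2i : is_ideal (ideal_exp n 2) := ideal_exp_ideal n 2.
Lemma lin_ideal : is_ideal lin. Proof. exact: ideal_add_ideal. Qed.
Lemma sub_lin : K `<=` lin. Proof. exact: ideal_addl. Qed.
Lemma sq_lin : ideal_exp n 2 `<=` lin. Proof. exact: ideal_addr. Qed.
Lemma lin_sub : lin `<=` n. Proof. by apply: ideal_add_min => //; exact: (n2_sub A). Qed.

Definition linker := (exists a, [/\ n a, ~ lin a & forall u, n u -> K (a * u)]).

Lemma num_gen_lin : num_gen n K = (ldim n - ldim lin)%N.
Proof.
rewrite (num_genE A ni Ki Kn); congr (_ - ldim _)%N.
by rewrite /lin (ideal_exp2E ni).
Qed.

Lemma ldim_max : ldim setT = (ldim n).+1.
Proof.
have HT := ideal_subsp A (@idealT_ideal S); have Hn := ideal_subsp A ni.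
rewrite -(@ldim_addl _ _ A n 1 Hn (la_1 A)); congr ldim; apply/seteqP; split=> // x _.
by have [a Ha] := la_cov A x; exists a; rewrite mulr1.
Qed.

Section Coordinates.
Variables (k s : nat) (y : 'I_k -> S) (z : 'I_s -> S).

Definition coords (i : 'I_(k + s)) : S :=
  match split i with inl i => y i | inr j => z j end.
Definition is_z (i : 'I_(k + s)) : bool := if split i is inr _ then true else false.

Lemma coords_l i : coords (lshift s i) = y i.
Proof. by rewrite /coords (unsplitK (inl i)). Qed.
Lemma coords_r j : coords (rshift k j) = z j.
Proof. by rewrite /coords (unsplitK (inr j)). Qed.
Lemma is_z_l i : is_z (lshift s i) = false.
Proof. by rewrite /is_z (unsplitK (inl i)). Qed.
Lemma is_z_r j : is_z (rshift k j) = true.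
Proof. by rewrite /is_z (unsplitK (inr j)). Qed.

(** [y] lifts a basis of [n / (K + n^2)], and [z], inside [K], completes it to a minimal system of
    generators of [n]; by [cs_dim] their number is the embedding dimension. Modulo [z], [K] starts
    in degree two. *)
Record coord_system : Prop := CoordSystem {
  cs_y : forall i, n (y i);
  cs_z : forall j, K (z j);
  cs_spans : spans A n lin y;
  cs_indep : indep A lin y;
  cs_lin : lin `<=` ideal_add (ideal_gen (range z)) (ideal_exp n 2);
  cs_dim : (k + s = ldim n - ldim (ideal_exp n 2))%N }.
End Coordinates.

(** [W] restricts the choice of [z]; in the graded case it will be the set of linear forms in
    [K]. *)
Lemma exists_coords (W : set S) k (y : 'I_k -> S) : W `<=` K ->
  (forall L, subsp A L -> ideal_exp n 2 `<=` L -> W `<=` L -> K `<=` L) ->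
  (forall i, n (y i)) -> spans A n lin y -> indep A lin y ->
  exists s (z : 'I_s -> S), coord_system y z /\ forall j, W (z j).
Proof.
move=> WK gen ny sp ig.
have [Hl H2] := (ideal_subsp A lin_ideal, ideal_subsp A n2i).
have [|L HL nL WL|z [Wz sz iz]] := @exists_basis _ _ A lin (ideal_exp n 2) W Hl H2 sq_lin.
- by apply: subset_trans WK _; apply: sub_lin.
- have KL := gen L HL nL WL; move=> _ [u [w [Ku nw ->]]].
  by case: HL => _ HD _; apply: HD; [exact: KL|exact: nL].
exists (ldim lin - ldim (ideal_exp n 2))%N, z; split=> //; split=> //.
- by move=> j; apply: WK.
- move=> x /sz[a Ha]; exists (\sum_i sg (a i) * z i), (x - \sum_i sg (a i) * z i).
  by split=> //; [apply/gen_rangeP; exists (fun i => sg (a i))|rewrite addrC subrK].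
have := ldim_basis (ideal_subsp A ni) Hl lin_sub ny sp ig.
have := ldim_mono Hl (ideal_subsp A ni) lin_sub.
have := ldim_mono H2 Hl sq_lin; lia.
Qed.

Section WithSystem.
Variables (k s : nat) (y : 'I_k -> S) (z : 'I_s -> S).
Hypothesis cs : coord_system y z.
Local Notation x := (coords y z).
Local Notation idz := (idZ x (is_z (k:=k) (s:=s))).

Lemma coords_n i : n (x i).
Proof.
by rewrite /coords; case: split => j; [exact: cs_y cs j|apply: Kn; exact: cs_z cs j].
Qed.

Lemma idz_gen : idz = ideal_gen (range z).
Proof.
apply/seteqP; split; apply: ideal_gen_mono.
  move=> _ [i Zi <-]; rewrite /coords; move: Zi; rewrite /= /is_z.
  by case: split => // j _; exists j.
move=> _ [j _ <-]; exists (rshift k j); first exact: is_z_r.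
exact: coords_r.
Qed.
Lemma lin_idz : lin `<=` ideal_add idz (ideal_exp n 2).
Proof. by rewrite idz_gen; exact: cs_lin cs. Qed.
Lemma idz_sub : idz `<=` K.
Proof. by rewrite idz_gen; apply: ideal_gen_min => // _ [j _ <-]; exact: cs_z cs j. Qed.
Lemma idz_lin : ideal_add idz (ideal_exp n 2) = lin.
Proof.
apply/seteqP; split; last exact: lin_idz.
apply: ideal_add_mono => //; exact: idz_sub.
Qed.

Lemma coords_gen : n `<=` ideal_gen (range x).
Proof.
have Gi := ideal_gen_ideal (range x).
apply: (nakayama (la_nil A)) => // u nu.
have [a Ha] := cs_spans cs nu; have [v [w [Hv Hw E]]] := lin_idz Ha.
exists (v + \sum_i sg (a i) * y i), w; split.
- apply: (idlD Gi).
    by move: Hv; apply: ideal_gen_mono => _ [i _ <-]; exists i.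
  apply: (idl_sum _ Gi) => i _; apply: (idlMl _ Gi); apply: sub_ideal_gen.
  by exists (lshift s i) => //; rewrite coords_l.
- by rewrite -(ideal_exp2E ni).
- by rewrite addrAC -E subrK.
Qed.

Lemma nK_sub : ideal_mul n K `<=` ideal_add idz (ideal_exp n 3).
Proof.
have n3i := ideal_exp_ideal n 3; have idzi := idZ_ideal x (is_z (k:=k) (s:=s)).
apply: ideal_mul_min; first exact: ideal_add_ideal.
move=> u w nu /sub_lin/lin_idz[a [b [Ha Hb ->]]]; rewrite mulrDr.
by exists (u * a), (u * b); split=> //; [exact: (idlMl _ idzi)|exact: ideal_expS].
Qed.

Lemma dim_k : (ldim n - ldim lin = k)%N.
Proof.
apply/esym; apply: (ldim_basis (g := y)); try exact: ideal_subsp; first 1 last.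
- exact: lin_sub.
- exact: cs_y cs.
- exact: cs_spans cs.
- exact: cs_indep cs.
- apply: ideal_subsp; exact: lin_ideal.
Qed.

Hypothesis k0 : (0 < k)%N.
Let m0 : (0 < k + s)%N. Proof. by rewrite addn_gt0 k0. Qed.

Lemma cs_dom (Z : pred 'I_(k + s)) i j u w : (i + j < v_inv n)%N -> ideal_exp n i u ->
  ideal_exp n j w -> ideal_add (idZ x Z) (ideal_exp n (i + j).+1) (u * w) ->
  ideal_add (idZ x Z) (ideal_exp n i.+1) u \/ ideal_add (idZ x Z) (ideal_exp n j.+1) w.
Proof. exact: (@ev_dom S n A _ x coords_n coords_gen (cs_dim cs) m0). Qed.

(** By [nK_sub], a product [a u] in [n K] lies in [(z) + n^3]. Degree 2 is below [v_inv n], where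
    [S] modulo [z] is like a domain; [a] being outside [lin], [u] is in it. So the criterion applies
    with [D = lin]. *)
Lemma condI_linear : (2 <= k)%N -> (3 <= v_inv n)%N -> linker -> condI n K.
Proof.
move=> k2 v3 [a [na la aK]].
apply: (@condI_criterion S n A K lin a) => //.
- exact: lin_ideal.
- exact: sq_lin.
- exact: lin_sub.
- by rewrite dim_k.
move=> u nu /nK_sub Hau.
have [//| | |//|Ha|Hu] := @cs_dom (is_z (k:=k) (s:=s)) 1 1 a u.
- by rewrite ideal_exp1.
- by rewrite ideal_exp1.
- by case: la; rewrite -idz_lin.
- by rewrite -idz_lin.
Qed.

End WithSystem.

Lemma exists_coords0 : exists s (y : 'I_(ldim n - ldim lin) -> S) (z : 'I_s -> S), coord_system y z.
Proof.
have [y [ny sp ig]] := exists_basis_id (ideal_subsp A ni) (ideal_subsp A lin_ideal) lin_sub.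
have [||s [z [cs _]]] := @exists_coords K _ y _ _ ny sp ig => //.
by exists s, y, z.
Qed.

Lemma linker_condI : (2 <= ldim n - ldim lin)%N -> (3 <= v_inv n)%N -> linker -> condI n K.
Proof.
move=> k2 v3; have [s [y [z cs]]] := exists_coords0.
by apply: (condI_linear cs) => //; apply: leq_trans k2.
Qed.

(* [y_i y_j = b_ij s0] modulo [K]; if [b] is invertible then the symmetry
   [y_i (y_j y_l) = y_l (y_j y_i)] forces [y_i s0] into [n K]. *)
Lemma linker_or_cube k (y : 'I_k -> S) (b : 'M[F]_k) s0 : (2 <= k)%N ->
  (forall i, n (y i)) -> spans A n lin y -> indep A lin y ->
  (forall i j, K (y i * y j - sg (b i j) * s0)) ->
  linker \/ ideal_exp n 3 `<=` ideal_mul n K.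
Proof.
move=> k2 ny sp ig Hb.
have nKi := ideal_mul_ideal n K.
have KY : n `<=` ideal_add K (ideal_gen (range y)).
  apply: (spans_gen ni Ki ny) => u /sp[a Ha]; exists a.
  by move: Ha; rewrite /lin (ideal_exp2E ni).
have [bU|bU] := boolP (b \in unitmx); [right|left].
  pose c := invmx b.
  have Hsym i j l : ideal_mul n K (sg (b i j) * (y l * s0) - sg (b l j) * (y i * s0)).
    have -> : sg (b i j) * (y l * s0) - sg (b l j) * (y i * s0) =
        y i * (y l * y j - sg (b l j) * s0) - y l * (y i * y j - sg (b i j) * s0) by ring.
    by apply: (idlB nKi); apply: ideal_mulM.
  (* With an index [l] other than [i], summing [c_jl (b_lj y_i s0 - b_ij y_l s0)] over [j] gives
     [y_i s0], because [c] is inverse to [b]. *)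
  have ys i : ideal_mul n K (y i * s0).
    have [l li] : exists l : 'I_k, l != i.
      exists (if i == Ordinal k2 then Ordinal (ltnW k2) else Ordinal k2).
      by have [->|ne] := eqVneq i (Ordinal k2); rewrite // eq_sym.
    have H := idl_sum (index_enum 'I_k) nKi
      (fun j (_ : true) => idlMl (sg (c j l)) nKi (Hsym l j i)).
    move: H; rewrite (_ : \sum_j _ = y i * s0) //.
    have bc u : \sum_j sg (c j l) * sg (b u j) = (u == l)%:R.
      have := congr1 (fun M : 'M[F]_k => M u l) (mulmxV bU); rewrite !mxE => E.
      rewrite -(rmorph_nat sg) -E rmorph_sum; apply: eq_bigr => j _.
      by rewrite rmorphM mulrC.
    transitivity ((\sum_j sg (c j l) * sg (b l j)) * (y i * s0) -
                  (\sum_j sg (c j l) * sg (b i j)) * (y l * s0)).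
      rewrite !mulr_suml -sumrB; apply: eq_bigr => j _; ring.
    by rewrite !bc eqxx eq_sym (negPf li) mul1r mul0r subr0.
  have yyy i j l : ideal_mul n K (y i * (y j * y l)).
    rewrite -(subrK (sg (b j l) * s0) (y j * y l)) mulrDr; apply: (idlD nKi).
      exact: ideal_mulM.
    by rewrite mulrCA; apply: (idlMl _ nKi).
  have red (Q : set S) : is_ideal Q -> (forall u, K u -> Q u) -> (forall i, Q (y i)) -> n `<=` Q.
    move=> Qi KQ yQ; apply: subset_trans KY _; apply: ideal_add_min => //.
    by apply: ideal_gen_min => // _ [i _ <-].
  have kerl w : is_ideal [set u | ideal_mul n K (u * w)].
    split=> /= [|u v|u v]; first by rewrite mul0r; exact: idl0.
      by rewrite mulrDl; exact: idlD.
    by rewrite -mulrA; exact: idlMl.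
  have yyn i j u : n u -> ideal_mul n K (u * (y i * y j)).
    apply: (red [set u | ideal_mul n K (u * (y i * y j))]) => // [w Kw|l] /=; last exact: yyy.
    by rewrite mulrC; apply: ideal_mulM => //; apply: (idlMl _ ni).
  have ynn i u w : n u -> n w -> ideal_mul n K (w * (u * y i)).
    move=> nu; apply: (red [set w | ideal_mul n K (w * (u * y i))]) => // [v Kv|j] /=.
      by rewrite mulrC; apply: ideal_mulM => //; apply: (idlMl _ ni).
    by rewrite mulrCA; apply: yyn.
  have nnn u v w : n u -> n v -> n w -> ideal_mul n K (u * (v * w)).
    move=> nu nv; rewrite mulrA mulrC.
    apply: (red [set w | ideal_mul n K (w * (u * v))]) => // [t Kt|j] /=.
      by rewrite mulrC; apply: ideal_mulM => //; apply: (idlMl _ ni).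
    by rewrite mulrC -mulrA; apply: ynn.
  apply: ideal_mul_min => // u w nu Hw; rewrite mulrC; move: Hw.
  apply: ideal_mul_ind => // v w' nv /(ideal_mul_subl ni) nw'.
  by rewrite mulrC; apply: nnn.
(* If [b] is singular, a vector of its kernel is the coordinate vector of a linker. *)
have [a a0 ab] : exists2 a : 'rV[F]_k, a != 0 & a *m b = 0.
  have : kermx b != 0 by rewrite kermx_eq0 row_free_unit.
  case/rowV0Pn => a /sub_kermxP ab a0; exists a => //.
exists (\sum_i sg (a 0 i) * y i); split.
- by apply: (idl_sum _ ni) => i _; exact: (idlMl _ ni).
- move=> H; case/eqP: a0; apply/rowP => i; rewrite mxE.
  exact: (ig (fun i => a 0 i)).
set l := \sum_i _.
have ly j : K (l * y j).
  have -> : l * y j = \sum_i sg (a 0 i) * (y i * y j - sg (b i j) * s0) + sg ((a *m b) 0 j) * s0.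
    rewrite mxE rmorph_sum !mulr_suml -big_split; apply: eq_bigr => i _ /=.
    by rewrite rmorphM; ring.
  rewrite ab mxE rmorph0 mul0r addr0; apply: (idl_sum _ Ki) => i _.
  exact: (idlMl _ Ki).
move=> u /KY[v [w [Kv /gen_rangeP[c ->] ->]]]; rewrite mulrDr.
apply: (idlD Ki); first exact: (idlMl _ Ki).
rewrite mulr_sumr; apply: (idl_sum _ Ki) => i _; rewrite mulrCA.
exact: (idlMl _ Ki).
Qed.

(* When [S / K] has Hilbert function [(1, k, 1)]. *)
Lemma linker_or_cube1 : (2 <= ldim n - ldim lin)%N -> (ldim lin - ldim K = 1)%N ->
  linker \/ ideal_exp n 3 `<=` ideal_mul n K.
Proof.
move=> k2 d1.
have [y [ny sp ig]] := exists_basis_id (ideal_subsp A ni) (ideal_subsp A lin_ideal) lin_sub.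
have [g [_ spg _]] := exists_basis_id (ideal_subsp A lin_ideal) (ideal_subsp A Ki) sub_lin.
rewrite d1 in g spg.
have H i j : exists b, K (y i * y j - sg b * g ord0).
  have [|a Ha] := spg (y i * y j); first by apply: sq_lin; apply: ideal_exp2.
  by exists (a ord0); rewrite big_ord1 in Ha.
have [b Hb] := choice (fun p : 'I_(ldim n - ldim lin) * 'I_(ldim n - ldim lin) => H p.1 p.2).
apply: (@linker_or_cube _ y (\matrix_(i, j) b (i, j)) (g ord0)) => // i j.
by rewrite mxE; exact: (Hb (i, j)).
Qed.

Lemma sq_linker : (1 <= ldim n - ldim lin)%N -> ideal_exp n 2 `<=` K -> linker.
Proof.
move=> k1 n2K; have [a na la] : exists2 a, n a & ~ lin a.
  apply: contrapT => H; have : n `<=` lin.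
    by move=> w nw; apply: contrapT => ?; apply: H; exists w.
  by move/(ldim_mono (ideal_subsp A ni) (ideal_subsp A lin_ideal)); lia.
by exists a; split=> // u nu; apply: n2K; apply: ideal_exp2.
Qed.

(** The socle of [S / K] is too large to fit in [lin / K], so a socle element lies outside [lin]. It
    is in [n], as a unit in [colon K n] would force [n] into [K]. *)
Lemma socle_linker : (1 <= ldim n - ldim lin)%N -> (ldim lin - ldim K <= 1)%N ->
  (2 <= socle_dim n K)%N -> linker.
Proof.
move=> k1 d1; have Ci : is_ideal (colon K n) by exact: colon_ideal.
have KC : K `<=` colon K n by apply: sub_colon.
rewrite /socle_dim (residue_dimE A Ci Ki KC); last by move=> x y nx Hy; rewrite mulrC; apply: Hy.
move=> d2; have [a Ca la] : exists2 a, colon K n a & ~ lin a.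
  apply: contrapT => H; have : colon K n `<=` lin.
    by move=> w nw; apply: contrapT => ?; apply: H; exists w.
  by move/(ldim_mono (ideal_subsp A Ci) (ideal_subsp A lin_ideal)); lia.
exists a; split=> //; apply: contrapT => na; have [a' aa'] := la_unit A na.
have nK : n `<=` K.
  move=> u nu; have := idlMl a' Ki (Ca _ nu).
  by rewrite mulrA [a' * a]mulrC aa' mul1r.
have : n `<=` lin by apply: subset_trans nK sub_lin.
by move/(ldim_mono (ideal_subsp A ni) (ideal_subsp A lin_ideal)); lia.
Qed.

End System.

(** * The Hilbert function (1, 2, 2): multipliers of degree two *)

Section HilbertFunction122.
Variables (S : comNzRingType) (n : set S) (A : loc_alg n) (K : set S).
Hypotheses (Ki : is_ideal K) (Kn : K `<=` n).
Local Notation F := (la_F A).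
Local Notation sg := (la_s A).
Local Notation ldim := (ldim A).
Local Notation lin := (lin n K).
Let ni := la_ideal A.
Let lini : is_ideal lin := lin_ideal n Ki.

Section Pair.
Variables (s : nat) (y : 'I_2 -> S) (z : 'I_s -> S).
Hypothesis cs : coord_system A K y z.
Local Notation x := (coords y z).
Local Notation idz := (idZ x (is_z (k:=2) (s:=s))).
Let idzi : is_ideal idz := idZ_ideal _ _.
Let nexpi t : is_ideal (ideal_exp n t) := ideal_exp_ideal n t.
Let ny i : n (y i) := cs_y cs i.

Definition quad (al be ga : F) (a b : 'I_2) : S :=
  sg al * (y a * y a) + sg be * (y a * y b) + sg ga * (y b * y b).

Lemma n2_quad al be ga a b : ideal_exp n 2 (quad al be ga a b).
Proof.
by apply: (idlD (nexpi 2)); first apply: (idlD (nexpi 2)); apply: (idlMl _ (nexpi 2));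
   apply: ideal_exp2.
Qed.

Lemma y_indep (r t : S) (a b : 'I_2) : a != b -> lin (r * y a + t * y b) -> n r /\ n t.
Proof.
move=> ab H; pose c (i : 'I_2) := if i == a then r else t.
have E : \sum_i c i * y i = r * y a + t * y b.
  rewrite (bigD1 a) //= (bigD1 b) /=; last by rewrite eq_sym.
  rewrite big1 ?addr0 => [|i]; first by rewrite /c eqxx eq_sym (negPf ab).
  case/andP=> ia ib; exfalso; clear -ab ia ib; move: a b i ab ia ib.
  by do 3! case=> [[|[|?]] ?].
have H2 := @indep_residue S n A n lin 2 y c lini
  (fun u w nu nw => sq_lin Ki (ideal_exp2 ni nu nw)) ny (cs_indep cs).
rewrite E in H2; have := H2 H; move=> H3; have := H3 a; have := H3 b.
by rewrite /c eqxx eq_sym (negPf ab).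
Qed.

Lemma y_notin_lin a : ~ lin (y a).
Proof.
move=> H; have [b ab] : exists b : 'I_2, a != b.
  by exists (if a == ord0 then ord_max else ord0); case: a {H} => [[|[|]]].
have [] := @y_indep 1 0 a b ab; last by move=> /(la_1 A).
by rewrite mul0r addr0 mul1r.
Qed.

(** Modulo [z] and [y_a] a single variable is left; in low degrees this tests divisibility by
    [y_a]. *)
Definition Zy (a : 'I_2) : pred 'I_(2 + s) := fun i => is_z i || (i == lshift s a).
Local Notation idzy a := (idZ x (Zy a)).

Lemma idz_idzy a : idz `<=` idzy a.
Proof.
by apply: ideal_gen_mono => _ [i Zi <-]; exists i; rewrite //= /Zy Zi.
Qed.
Lemma y_idzy a : idzy a (y a).
Proof.
apply: sub_ideal_gen; exists (lshift s a); last exact: coords_l.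
by rewrite /= /Zy eqxx orbT.
Qed.
Lemma idzyP a v : idzy a v -> exists r, idz (v - r * y a).
Proof.
suff: idzy a `<=` [set v | exists r, idz (v - r * y a)] by apply.
apply: ideal_gen_min => [|_ [i /orP[Zi|/eqP ->] <-]] /=.
- split=> /= [|u w [r Hr] [t Ht]|c u [r Hr]].
  + by exists 0; rewrite mul0r subr0; exact: (idl0 idzi).
  + by exists (r + t); rewrite mulrDl opprD addrACA; exact: (idlD idzi).
  + by exists (c * r); rewrite -mulrA -mulrBr; exact: (idlMl _ idzi).
- by exists 0; rewrite mul0r subr0; apply: sub_ideal_gen; exists i.
- by exists 1; rewrite mul1r coords_l subrr; exact: (idl0 idzi).
Qed.
Lemma idzy_nP a t v : ideal_add (idzy a) (ideal_exp n t) v ->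
  exists r, ideal_add idz (ideal_exp n t) (v - r * y a).
Proof.
move=> [u [w [/idzyP[r Hr] Hw ->]]]; exists r, (u - r * y a), w.
by split=> //; rewrite addrAC.
Qed.

Lemma y_notin_idzy a b : a != b -> ~ ideal_add (idzy a) (ideal_exp n 2) (y b).
Proof.
move=> ab /idzy_nP[r]; rewrite (idz_lin Ki cs) => H.
have [] := @y_indep (- r) 1 a b ab; last by move=> _ /(la_1 A).
by rewrite mul1r mulNr addrC.
Qed.

Lemma sq_cancel a b j v : a != b -> (2 + j < v_inv n)%N -> ideal_exp n j v ->
  ideal_add (idzy a) (ideal_exp n (2 + j).+1) (y b * y b * v) ->
  ideal_add (idzy a) (ideal_exp n j.+1) v.
Proof.
move=> ab jv nv H; have Hn : ideal_exp n 1 (y b) by rewrite ideal_exp1.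
have [|||//|Hy|//] := @cs_dom S n A K Kn _ _ _ _ cs isT (Zy a) 2 j (y b * y b) v.
- exact: jv.
- exact: ideal_exp2.
- exact: nv.
- have [|//|//|//|Hy1|Hy1] := @cs_dom S n A K Kn _ _ _ _ cs isT (Zy a) 1 1 (y b) (y b).
  + by apply: leq_ltn_trans jv; rewrite leq_addr.
  + by case: (y_notin_idzy ab).
  + by case: (y_notin_idzy ab).
Qed.

Lemma y_cancel a j v : (1 + j < v_inv n)%N -> ideal_exp n j v ->
  ideal_add idz (ideal_exp n (1 + j).+1) (y a * v) -> ideal_add idz (ideal_exp n j.+1) v.
Proof.
move=> jv nv H; have Hn : ideal_exp n 1 (y a) by rewrite ideal_exp1.
have [//|//|//|//|Hy|//] := @cs_dom S n A K Kn _ _ _ _ cs isT (is_z (k:=2) (s:=s)) 1 j (y a) v.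
by move: Hy; rewrite (idz_lin Ki cs) => /(y_notin_lin (a := a)).
Qed.

Let M : set S := ideal_add idz (ideal_exp n 3).
Let Mi : is_ideal M := ideal_add_ideal idzi (nexpi 3).

Lemma sq_span v : lin v -> exists al be ga, M (v - quad al be ga ord0 ord_max).
Proof.
set a : 'I_2 := ord0; set b : 'I_2 := ord_max.
suff H : ideal_exp n 2 `<=` [set v | ideal_exp n 2 v /\ exists al be ga, M (v - quad al be ga a b)].
  rewrite -(idz_lin Ki cs) => -[u [w [Hu /H[_ [al [be [ga Hw]]]] ->]]].
  exists al, be, ga; rewrite -addrA; apply: (idlD Mi) => //.
  exact: (ideal_addl (nexpi 3)).
have n3M : ideal_exp n 3 `<=` M by exact: ideal_addr.
rewrite (ideal_exp2E ni); apply: ideal_mul_min.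
  rewrite -(ideal_exp2E ni); split.
  - split; first exact: idl0.
    exists 0, 0, 0; rewrite /quad rmorph0 !mul0r !addr0 subrr; exact: (idl0 Mi).
  - move=> u w [Hu [al [be [ga H1]]]] [Hw [al' [be' [ga' H2]]]]; split; first exact: (idlD (nexpi 2)).
    exists (al + al'), (be + be'), (ga + ga').
    have -> : u + w - quad (al + al') (be + be') (ga + ga') a b =
      (u - quad al be ga a b) + (w - quad al' be' ga' a b) by rewrite /quad !rmorphD; ring.
    exact: (idlD Mi).
  - move=> c u [Hu [al [be [ga H1]]]]; split; first exact: (idlMl _ (nexpi 2)).
    have [d Hd] := la_cov A c; exists (d * al), (d * be), (d * ga).
    have -> : c * u - quad (d * al) (d * be) (d * ga) a b =
      (c - sg d) * u + sg d * (u - quad al be ga a b) by rewrite /quad !rmorphM; ring.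
    by apply: (idlD Mi); [apply: n3M; exact: ideal_expS|exact: (idlMl _ Mi)].
move=> u w nu nw; split; first exact: ideal_mulM.
have dec t : n t -> exists c d, lin (t - (sg c * y a + sg d * y b)).
  move=> /(cs_spans cs)[c]; rewrite big_ord_recl big_ord1 => Hc.
  have E : lift ord0 (ord0 : 'I_1) = b by apply: val_inj.
  by exists (c a), (c b); rewrite E in Hc.
have linM t r : n t -> lin r -> M (t * r).
  move=> nt; rewrite -(idz_lin Ki cs) => -[p [q [Hp Hq ->]]]; rewrite mulrDr.
  apply: (idlD Mi); first by apply: (ideal_addl (nexpi 3)); apply: (idlMl _ idzi).
  by apply: n3M; apply: ideal_expS.
have [[c [d Hu]] [c' [d' Hw]]] := (dec _ nu, dec _ nw).
exists (c * c'), (c * d' + d * c'), (d * d').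
have -> : u * w - quad (c * c') (c * d' + d * c') (d * d') a b =
  u * (w - (sg c' * y a + sg d' * y b)) +
  (sg c' * y a + sg d' * y b) * (u - (sg c * y a + sg d * y b)).
  by rewrite /quad !rmorphD !rmorphM; ring.
apply: (idlD Mi); apply: linM => //.
by apply: (idlD ni); apply: (idlMl _ ni).
Qed.

Hypotheses (n3K : ideal_exp n 3 `<=` K) (d2 : (ldim lin - ldim K = 2)%N).

(** [lin] exceeds [M] by at most the three dimensions of quadratic forms in [y], and [K] by two, so
    [K / M] is at most a line. *)
Lemma K_quad : exists al be ga, forall u, K u -> exists c, M (u - sg c * quad al be ga ord0 ord_max).
Proof.
have HM := ideal_subsp A Mi; have HK := ideal_subsp A Ki; have Hl := ideal_subsp A lini.
have MK : M `<=` K by apply: ideal_add_min => //; exact: (idz_sub Ki cs).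
pose g (i : 'I_3) : S := match val i with 0 => y ord0 * y ord0 | 1 => y ord0 * y ord_max
  | _ => y ord_max * y ord_max end.
have le : (ldim lin <= ldim M + 3)%N.
  apply: (spans_ldim (g := g)) => // v /sq_span[al [be [ga H]]].
  exists (fun i : 'I_3 => match val i with 0 => al | 1 => be | _ => ga end).
  by rewrite !big_ord_recl big_ord0 /= addr0 addrA.
have [KM|KM] := pselect (K `<=` M).
  exists 0, 0, 0 => u /KM Mu; exists 0; rewrite rmorph0 mul0r subr0 //.
have [q Kq Mq] : exists2 q, K q & ~ M q.
  by apply: contrapT => H; apply: KM => w Kw; apply: contrapT => ?; apply: H; exists w.
have Kadd : K `<=` addl A M q.
  apply: (ldim_eq (addl_subsp q HM) HK (addl_min HK MK Kq)).
  rewrite ldim_addl //; lia.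
have [al [be [ga Hq]]] := sq_span (sub_lin n Kq).
exists al, be, ga => u /Kadd[c Hc]; exists c.
rewrite -(subrK (sg c * q) u) -addrA -mulrBr; apply: (idlD Mi) => //.
exact: (idlMl _ Mi).
Qed.

Hypothesis v4 : (4 <= v_inv n)%N.

Section Forms.
Variables (al be ga : F) (a b : 'I_2).
Hypotheses (ab : a != b)
  (Kq : forall u, K u -> exists c, M (u - sg c * quad al be ga a b)).
Local Notation q := (quad al be ga a b).
Let N4 : set S := ideal_add idz (ideal_exp n 4).
Let N4i : is_ideal N4 := ideal_add_ideal idzi (nexpi 4).

Lemma nK_quad v : ideal_mul n K v -> exists2 l, n l & N4 (v - l * q).
Proof.
suff: ideal_mul n K `<=` [set v | exists2 l, n l & N4 (v - l * q)] by apply.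
apply: ideal_mul_min => [|u w nu /Kq[c Hc]] /=.
  split=> /= [|u w [r nr Hr] [t nt Ht]|c u [r nr Hr]].
  + by exists 0; [exact: idl0|rewrite mul0r subr0; exact: (idl0 N4i)].
  + by exists (r + t); [exact: idlD|rewrite mulrDl opprD addrACA; exact: (idlD N4i)].
  + by exists (c * r); [exact: idlMl|rewrite -mulrA -mulrBr; exact: (idlMl _ N4i)].
exists (u * sg c); first exact: idlMr.
rewrite -mulrA -mulrBr; case: Hc => p [r [Hp Hr ->]]; rewrite mulrDr.
by exists (u * p), (u * r); split=> //; [exact: (idlMl _ idzi)|exact: ideal_expS].
Qed.

Lemma N4_idzy t c : N4 t -> ideal_add (idzy c) (ideal_exp n 4) t.
Proof. by apply: ideal_add_mono => //; exact: idz_idzy. Qed.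

(** Write [y_a^2 u = l q] modulo [z] and [n^4]. Setting [y_a] to zero leaves [ga y_b^2 l], so
    [l = r y_a] up to order two; cancelling [y_a] gives [y_a u = r q] modulo [n^3]. Setting [y_a] to
    zero again puts [r] in [n], so [y_a u] has order three and [u] order two modulo [z]. *)
Lemma sq_linker_ga u : ga != 0 -> n u -> ideal_mul n K (y a * y a * u) -> lin u.
Proof.
move=> ga0 nu /nK_quad[l nl Hl].
have Iy t : is_ideal (ideal_add (idzy a) (ideal_exp n t)).
  by apply: ideal_add_ideal; [exact: idZ_ideal|exact: nexpi].
have yI t w : ideal_add (idzy a) (ideal_exp n t) (y a * w).
  by apply: (idlMr _ (Iy t)); apply: (ideal_addl (nexpi t)); exact: y_idzy.
have ga' c : sg ga^-1 * (sg ga * c) = c by rewrite mulrA -rmorphM mulVf // rmorph1 mul1r.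
have nl1 : ideal_exp n 1 l by rewrite ideal_exp1.
have {nl1} : ideal_add (idzy a) (ideal_exp n 2) l.
  apply: (sq_cancel ab) nl1 _ => //.
  rewrite -(ga' (_ * l)); apply: (idlMl _ (Iy 4)).
  have -> : sg ga * (y b * y b * l) = y a * (y a * u - l * (sg al * y a + sg be * y b))
     - (y a * y a * u - l * q) by rewrite /quad; ring.
  by apply: (idlB (Iy 4)) => //; apply: N4_idzy.
move=> /idzy_nP[r Hr].
have H1 : N4 (y a * (y a * u - r * q)).
  have -> : y a * (y a * u - r * q) = (y a * y a * u - l * q) + (l - r * y a) * q by ring.
  apply: (idlD N4i) => //; move: Hr => -[p [w [Hp Hw ->]]]; rewrite mulrDl.
  exists (p * q), (w * q); split=> //; first exact: (idlMr _ idzi).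
  by apply: (ideal_expD (i := 2) (j := 2)) => //; exact: n2_quad.
have H2 : M (y a * u - r * q).
  apply: (y_cancel (j := 2) _ _ H1) => //.
  apply: (idlB (nexpi 2)); first exact: ideal_exp2.
  by apply: (idlMl _ (nexpi 2)); exact: n2_quad.
have nr : n r.
  suff: ideal_add (idzy a) (ideal_exp n 1) r.
    move=> [p [w [/idzyP[t Ht] Hw ->]]]; apply: (idlD ni); last by rewrite -(ideal_exp1 ni).
    rewrite -(subrK (t * y a) p); apply: (idlD ni); last exact: (idlMl _ ni).
    by apply: Kn; apply: (idz_sub Ki cs).
  apply: (sq_cancel (j := 0) ab) => //; first by apply: leq_trans v4.
  rewrite -(ga' (_ * r)); apply: (idlMl _ (Iy 3)).
  have -> : sg ga * (y b * y b * r) = y a * (u - r * (sg al * y a + sg be * y b))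
     - (y a * u - r * q) by rewrite /quad; ring.
  apply: (idlB (Iy 3)) => //.
  by move: H2; apply: ideal_add_mono => //; exact: idz_idzy.
rewrite -(idz_lin Ki cs); apply: (y_cancel (j := 1) (a := a)).
- by apply: leq_trans v4.
- by rewrite ideal_exp1.
rewrite -(subrK (r * q) (y a * u)); apply: (idlD Mi) => //.
by apply: (ideal_addr idzi); apply: ideal_expS => //; exact: n2_quad.
Qed.

(** A single square fails when [y_a y_b] is in [K], since [y_a^2 y_b] is then in [n K]. For the sum
    of squares, setting [y_a] to zero leaves [y_b^2 u], so [u] is a multiple of [y_a] up to order
    two, and by symmetry of [y_b]; hence [u] has no linear part. *)
Lemma sq_linker_xy u : al = 0 -> ga = 0 -> n u ->
  ideal_mul n K ((y a * y a + y b * y b) * u) -> lin u.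
Proof.
move=> al0 ga0 nu /nK_quad[l nl]; rewrite /quad al0 ga0 rmorph0 !mul0r add0r addr0 => Hl.
have nu1 : ideal_exp n 1 u by rewrite ideal_exp1.
have side c d : c != d -> (y a * y a + y b * y b = y c * y c + y d * y d) ->
   (y a * y b = y c * y d) -> exists r, lin (u - r * y c).
  move=> cd E1 E2; rewrite E1 E2 in Hl.
  have Iy : is_ideal (ideal_add (idzy c) (ideal_exp n 4)).
    by apply: ideal_add_ideal; [exact: idZ_ideal|exact: nexpi].
  have : ideal_add (idzy c) (ideal_exp n 2) u.
    apply: (sq_cancel cd) nu1 _ => //.
    have -> : y d * y d * u = ((y c * y c + y d * y d) * u - l * (sg be * (y c * y d)))
        - y c * (y c * u - l * (sg be * y d)) by ring.
    apply: (idlB Iy); first exact: N4_idzy.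
    by apply: (idlMr _ Iy); apply: (ideal_addl (nexpi 4)); exact: y_idzy.
  by move=> /idzy_nP[r]; rewrite (idz_lin Ki cs); exists r.
have [//|//|r Hr] := side a b ab.
have [|||t Ht] := side b a; first by rewrite eq_sym.
- by rewrite addrC.
- by rewrite mulrC.
have [|nr _] := @y_indep (- r) t a b ab.
  have -> : - r * y a + t * y b = (u - r * y a) - (u - t * y b) by ring.
  exact: (idlB lini).
rewrite -(subrK (r * y a) u); apply: (idlD lini) => //.
apply: (sq_lin Ki); apply: ideal_exp2 => //.
by rewrite -[r]opprK; apply: idlN.
Qed.
End Forms.
End Pair.

(** With [n^3] in [K], every [a] in [n^2] sends [n] into [K]. It remains to avoid the quadric [q] in
    [K]: a square of a variable when [q] contains the square of the other one, the sum of both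
    squares otherwise. *)
Lemma condI_122 : (ldim n - ldim lin = 2)%N -> (ldim lin - ldim K = 2)%N ->
  ideal_exp n 3 `<=` K -> (4 <= v_inv n)%N -> condI n K.
Proof.
move=> k2 d2 n3K v4; have := exists_coords0 A Ki Kn; rewrite k2 => -[s [y [z cs]]].
have crit a : ideal_exp n 2 a -> (forall u, n u -> ideal_mul n K (a * u) -> lin u) -> condI n K.
  move=> na Ha; apply: (@condI_criterion S n A K lin a) => //.
  - exact: sq_lin.
  - exact: (lin_sub A Kn).
  - by rewrite k2.
  - move=> u nu; apply: n3K; rewrite mulrC; exact: ideal_expS.
have ny i : n (y i) := cs_y cs i.
have [al [be [ga Kq]]] := K_quad cs n3K d2.
have [ga0|ga0] := eqVneq ga 0; last first.
  apply: (crit (y ord0 * y ord0)); first exact: ideal_exp2.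
  by move=> u; apply: (sq_linker_ga cs v4 _ Kq).
have [al0|al0] := eqVneq al 0; last first.
  apply: (crit (y ord_max * y ord_max)); first exact: ideal_exp2.
  have Kq' u : K u -> exists c, ideal_add (idZ (coords y z) (is_z (k:=2) (s:=s))) (ideal_exp n 3)
      (u - sg c * quad y ga be al ord_max ord0).
    have -> : quad y ga be al ord_max ord0 = quad y al be ga ord0 ord_max by rewrite /quad; ring.
    exact: Kq.
  by move=> u; apply: (sq_linker_ga cs v4 _ Kq').
apply: (crit (y ord0 * y ord0 + y ord_max * y ord_max)).
  by apply: (idlD (ideal_exp_ideal n 2)); apply: ideal_exp2.
by move=> u; apply: (sq_linker_xy cs v4 _ Kq).
Qed.
End HilbertFunction122.

(** * Graded rings *)

Section Components.
Variables (S : comNzRingType) (G : nat -> set S).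
Hypothesis HG : grading G.
Implicit Types (x y u : S).

Lemma gr0 i : G i 0. Proof. by case: HG => /(_ i)[]. Qed.
Lemma grB i x y : G i x -> G i y -> G i (x - y).
Proof. by case: HG => /(_ i)[_ H] _ _ _; exact: H. Qed.
Lemma gr1 : G 0 1. Proof. by case: HG => _ []. Qed.
Lemma grM i j x y : G i x -> G j y -> G (i + j) (x * y).
Proof. by case: HG => _ [_ H] _ _; exact: H. Qed.

Definition decomp x (c : nat -> S) : Prop := (forall i, G i (c i)) /\
  exists d, (forall j, (d <= j)%N -> c j = 0) /\ x = \sum_(i < d) c i.

Lemma decomp_ex x : exists c, decomp x c.
Proof.
case: HG => _ _ /(_ x)[d [c [Gc ->]]] _.
exists (fun i => if (i < d)%N then c i else 0); split.
  by move=> i; case: ifP => // _; exact: gr0.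
exists d; split; first by move=> j; rewrite ltnNge => ->.
by apply: eq_bigr => i _; rewrite ltn_ord.
Qed.

Lemma sum_widen (c : nat -> S) d d' : (d <= d')%N -> (forall j, (d <= j)%N -> c j = 0) ->
  \sum_(i < d) c i = \sum_(i < d') c i.
Proof.
move=> dd H; rewrite (big_ord_widen _ c dd) big_mkcond; apply: eq_bigr => i _.
by case: ltnP => // /H ->.
Qed.

Lemma decomp_unique x c c' : decomp x c -> decomp x c' -> c =1 c'.
Proof.
move=> [Gc [d [Hd Ec]]] [Gc' [d' [Hd' Ec']]] i.
pose m := (maxn i.+1 (maxn d d')).
have [dm dm' im] : [/\ (d <= m)%N, (d' <= m)%N & (i < m)%N] by rewrite /m; split; lia.
case: HG => _ _ _ /(_ m (fun i => c i - c' i)) H.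
apply/eqP; rewrite -subr_eq0; apply/eqP; apply: H => //; first by move=> j; apply: grB.
by rewrite sumrB -(sum_widen dm Hd) -(sum_widen dm' Hd') -Ec -Ec' subrr.
Qed.

Definition hcomp x : nat -> S := sval (cid (decomp_ex x)).
Lemma hcompP x : decomp x (hcomp x). Proof. by rewrite /hcomp; case: cid. Qed.
Lemma hcomp_gr x i : G i (hcomp x i). Proof. by case: (hcompP x). Qed.
Lemma hcomp_eq x c : decomp x c -> forall i, hcomp x i = c i.
Proof. by move=> H; apply: decomp_unique H; exact: hcompP. Qed.
Lemma hcomp_sum x : exists d, (forall j, (d <= j)%N -> hcomp x j = 0) /\ x = \sum_(i < d) hcomp x i.
Proof. by case: (hcompP x). Qed.

Lemma hcompB x y i : hcomp (x - y) i = hcomp x i - hcomp y i.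
Proof.
apply: hcomp_eq (fun i => hcomp x i - hcomp y i) _ i.
split=> [j|]; first by apply: grB; exact: hcomp_gr.
have [[d [Hd Ed]] [d' [Hd' Ed']]] := (hcomp_sum x, hcomp_sum y).
exists (maxn d d'); split=> [j|].
  by rewrite geq_max => /andP[dj dj']; rewrite Hd // Hd' // subrr.
by rewrite sumrB -(sum_widen (leq_maxl d d') Hd) -(sum_widen (leq_maxr d d') Hd') -Ed -Ed'.
Qed.
Lemma hcomp0 i : hcomp 0 i = 0. Proof. by have := hcompB 0 0 i; rewrite !subrr. Qed.
Lemma hcompN x i : hcomp (- x) i = - hcomp x i.
Proof. by rewrite -sub0r hcompB hcomp0 sub0r. Qed.
Lemma hcompD x y i : hcomp (x + y) i = hcomp x i + hcomp y i.
Proof. by have := hcompB x (- y) i; rewrite opprK hcompN opprK. Qed.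
Lemma hcomp_bigsum (I : Type) (r : seq I) (P : pred I) (f : I -> S) i :
  hcomp (\sum_(j <- r | P j) f j) i = \sum_(j <- r | P j) hcomp (f j) i.
Proof.
by elim/big_rec2: _ => [|j u w _ <-]; [exact: hcomp0|rewrite hcompD].
Qed.
Lemma hcompMl i y x m : G i y ->
  hcomp (y * x) m = if (i <= m)%N then y * hcomp x (m - i) else 0.
Proof.
move=> Gy; apply: hcomp_eq (fun m => if (i <= m)%N then y * hcomp x (m - i) else 0) _ m.
split=> [j|].
  case: leqP => [ij|_]; last exact: gr0.
  by rewrite -{1}(subnKC ij); apply: grM => //; exact: hcomp_gr.
have [d [Hd Ed]] := hcomp_sum x; exists (i + d)%N; split=> [j ij|].
  by case: leqP => // _; rewrite Hd ?mulr0 // leq_subRL //; apply: leq_trans ij; rewrite leq_addr.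
rewrite big_split_ord /= big1 ?add0r => [|j _]; last by rewrite leqNgt ltn_ord.
by rewrite {1}Ed mulr_sumr; apply: eq_bigr => j _; rewrite leq_addr addKn.
Qed.
Lemma hcomp_homog i x m : G i x -> hcomp x m = if m == i then x else 0.
Proof.
move=> Gx; rewrite -[x in LHS]mulr1 (hcompMl _ _ Gx).
have h1 j : hcomp 1 j = if j == 0%N then 1 else 0.
  apply: hcomp_eq (fun j => if j == 0%N then 1 else 0) _ j; split=> [l|].
    by case: eqP => [->|_]; [exact: gr1|exact: gr0].
  by exists 1%N; split=> [[|l]|]; rewrite ?big_ord1.
rewrite h1; case: leqP => [im|im]; last by rewrite ltn_eqF.
by rewrite subn_eq0 eqn_leq im andbT; case: leqP; rewrite ?mulr1 ?mulr0.
Qed.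
(** The bound [d] depends on [u] only, so one [d] serves all [x] and [m]. *)
Lemma hcompM u : exists d, forall x m,
  hcomp (u * x) m = \sum_(l < d) if (l <= m)%N then hcomp u l * hcomp x (m - l) else 0.
Proof.
have [d [Hd Ed]] := hcomp_sum u; exists d => x m.
rewrite {1}Ed mulr_suml hcomp_bigsum; apply: eq_bigr => l _.
by apply: hcompMl; exact: hcomp_gr.
Qed.

Lemma hcomp_ideal (I : set S) : is_ideal I ->
  is_ideal [set x | forall i, I (hcomp x i)].
Proof.
move=> Ii; split=> [i|x y Hx Hy i|a x Hx i] /=.
- by rewrite hcomp0; exact: idl0.
- by rewrite hcompD; apply: (idlD Ii).
- have [d ->] := hcompM a; apply: (idl_sum _ Ii) => l _.
  by case: ifP => _; [exact: (idlMl _ Ii)|exact: idl0].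
Qed.

Lemma homogeneous_hcomp I x i : is_ideal I -> homogeneous G I -> I x -> I (hcomp x i).
Proof.
move=> Ii hI Ix; suff: I `<=` [set x | forall i, I (hcomp x i)] by move=> /(_ _ Ix).
rewrite {1}hI; apply: ideal_gen_min; first exact: hcomp_ideal.
move=> y [Iy [j Gy]] m /=; rewrite (hcomp_homog m Gy); case: eqP => // _; exact: idl0.
Qed.

Lemma colon_hcomp (L M : set S) x i : (forall x i, L x -> L (hcomp x i)) -> is_ideal L ->
  (forall x i, M x -> M (hcomp x i)) -> colon L M x -> colon L M (hcomp x i).
Proof.
move=> hL Li hM Hx y My; have [d [_ Ey]] := hcomp_sum y.
rewrite Ey mulr_sumr; apply: (idl_sum _ Li) => j _.
have Gy := hcomp_gr y j.
have E := hcompMl x (j + i) Gy; rewrite leq_addr addKn in E; rewrite mulrC -E.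
by apply: hL; rewrite mulrC; apply: Hx; apply: hM.
Qed.
End Components.

Lemma standard_graded_grading (S : comNzRingType) (G : nat -> set S) :
  standard_graded G -> grading G.
Proof. by case. Qed.

Section StandardGraded.
Variables (S : comNzRingType) (n : set S) (G : nat -> set S).
Hypotheses (loc : local_ring n) (SG : standard_graded G).
Local Notation HG := (standard_graded_grading SG).
Let ni := loc_ideal loc.
Local Notation hc := (hcomp HG).

Lemma gr_pos i x : (0 < i)%N -> G i x -> n x.
Proof.
move=> i0 Gx; apply: contrapT => /(loc_unit loc)[y xy].
have := hcompMl HG y 0 Gx; rewrite xy (hcomp_homog HG 0 (gr1 HG)) eqxx leqNgt i0 /= => one0.
by apply: (loc_1 loc); rewrite one0; exact: idl0.
Qed.
Lemma gr0_n x : G 0 x -> n x -> x = 0.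
Proof.
case: SG => _ inv _ _ Gx nx; apply: contrapT => x0; have [y _ xy] := inv _ Gx x0.
by apply: (loc_1 loc); rewrite -xy; apply: (idlMr _ ni).
Qed.
Lemma hc0_n x : n (x - hc x 0).
Proof.
have [[|d] [Hd Ed]] := hcomp_sum HG x.
  by rewrite Hd // Ed big_ord0 subrr; exact: idl0.
rewrite {1}Ed big_ord_recl addrC addKr; apply: (idl_sum _ ni) => i _.
by apply: gr_pos (hcomp_gr HG _ _).
Qed.
Lemma gr0_subring : subring_set (G 0).
Proof.
split; [exact: (gr1 HG)|by move=> x y; exact: (grB HG)|].
by move=> x y Gx Gy; rewrite -[0%N]addn0; exact: (grM HG).
Qed.
Lemma gr0_covers : covers n (G 0).
Proof. by move=> x; exists (hc x 0); [exact: hcomp_gr|exact: hc0_n]. Qed.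
Lemma n_hc0 x : n x -> hc x 0 = 0.
Proof.
move=> nx; apply: gr0_n; first exact: hcomp_gr.
by apply: (idlBKr ni (hc0_n x)).
Qed.

(** The elements whose degree [i] component lies in [n^i] for all [i] form a subring containing
    degrees 0 and 1, hence everything: generation in degree one enters here. With [exp_hc], [n^i] is
    the part of degree at least [i]. *)
Lemma exp_gr i x : G i x -> ideal_exp n i x.
Proof.
pose T := [set x | forall i, ideal_exp n i (hc x i)].
case: SG => _ _ gen _ Gx.
have -> : x = hc x i by rewrite (hcomp_homog HG i Gx) eqxx.
have TT : T = setT.
  apply: gen.
  - have E j := ideal_exp_ideal n j.
    split=> [|u w|u w]; rewrite ?inE.
    + by move=> j; rewrite (hcomp_homog HG j (gr1 HG)); case: eqP => [->|_]; [|exact: (idl0 (E j))].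
    + by move=> Tu Tw j; rewrite hcompB; apply: (idlB (E j)).
    + move=> Tu Tw j; have [d ->] := hcompM HG u; apply: (idl_sum _ (E j)) => l _.
      case: leqP => [lj|_]; last exact: (idl0 (E j)).
      by rewrite -(subnKC lj); apply: ideal_expD; [exact: Tu|rewrite addKn; exact: Tw].
  - move=> u Gu j; rewrite (hcomp_homog HG j Gu); case: eqP => [->|_] //.
    exact: (idl0 (ideal_exp_ideal n j)).
  - move=> u Gu j; rewrite (hcomp_homog HG j Gu); case: eqP => [->|_].
      by rewrite ideal_exp1 //; apply: gr_pos Gu.
    exact: (idl0 (ideal_exp_ideal n j)).
have Tx : T x by rewrite TT.
exact: Tx.
Qed.

Lemma exp_hc i x j : ideal_exp n i x -> (j < i)%N -> hc x j = 0.
Proof.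
move=> Hx; move: j; suff: ideal_exp n i `<=` [set x | forall j, (j < i)%N -> hc x j = 0].
  by move=> /(_ _ Hx).
elim: i {x Hx} => [|i IH] //; apply: ideal_mul_min => [|u w nu /IH Hw j ji] /=.
  split=> [k ki|u w Hu Hw k ki|a u Hu k ki] /=; first exact: hcomp0.
    by rewrite hcompD Hu // Hw // addr0.
  have [d ->] := hcompM HG a; apply: big1 => l _; case: ifP => // lk.
  by rewrite Hu ?mulr0 //; lia.
have [d ->] := hcompM HG u; apply: big1 => -[l ld] _ /=; case: ifP => // lj.
case: l lj {ld} => [|l] lj; first by rewrite n_hc0 // mul0r.
by rewrite Hw ?mulr0 //; lia.
Qed.

Lemma exp_hc_sum t x : (forall i, (i < t)%N -> hc x i = 0) -> ideal_exp n t x.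
Proof.
move=> H; have [d [_ Ed]] := hcomp_sum HG x; rewrite Ed.
have E := ideal_exp_ideal n t; apply: (idl_sum _ E) => i _.
case: (leqP t i) => [ti|it]; last by rewrite H //; exact: (idl0 E).
by apply: ideal_exp_leq ti _ _; apply: exp_gr; exact: hcomp_gr.
Qed.

Lemma n_gr1 x : n x -> ideal_exp n 2 (x - hc x 1).
Proof.
move=> nx; apply: exp_hc_sum => -[|[|//]] _; rewrite hcompB (hcomp_homog HG _ (hcomp_gr HG x 1)) /=.
  by rewrite n_hc0 // subr0.
by rewrite subrr.
Qed.
Lemma n2_gr2 x : ideal_exp n 2 x -> ideal_exp n 3 (x - hc x 2).
Proof.
move=> nx; apply: exp_hc_sum => -[|[|[|//]]] _;
  rewrite hcompB (hcomp_homog HG _ (hcomp_gr HG x 2)) /= ?subrr //; by rewrite (exp_hc nx) // subr0.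
Qed.

End StandardGraded.

Section GradedIdeal.
Variables (S : comNzRingType) (n : set S) (G : nat -> set S).
Hypotheses (loc : local_ring n) (SG : standard_graded G).
Local Notation HG := (standard_graded_grading SG).
Variables (A : loc_alg n) (K : set S).
Hypotheses (Ki : is_ideal K) (Kn : K `<=` n) (hK : forall x i, K x -> K (hcomp HG x i)).
Hypothesis (AG : forall a, G 0 (la_s A a)).
Local Notation hc := (hcomp HG).
Local Notation ldim := (ldim A).
Local Notation lin := (lin n K).
Local Notation sg := (la_s A).
Let ni := la_ideal A.
Let nexpi t : is_ideal (ideal_exp n t) := ideal_exp_ideal n t.

Lemma gr1_sub : G 1 `<=` n.
Proof. by move=> x; apply: (gr_pos loc SG). Qed.

Lemma exists_basis_gr1 : exists y : 'I_(ldim n - ldim lin) -> S,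
  [/\ forall i, G 1 (y i), spans A n lin y & indep A lin y].
Proof.
apply: exists_basis; [exact: ideal_subsp|apply: ideal_subsp; exact: lin_ideal
  |exact: (lin_sub A Kn)|exact: gr1_sub|].
move=> L [_ LD _] lL GL x nx; rewrite -(subrK (hc x 1) x); apply: LD.
  by apply: lL; apply: (sq_lin Ki); apply: (n_gr1 loc SG).
by apply: GL; exact: hcomp_gr.
Qed.

(** Besides (1, 2, 2) there is (1, 2, 1, 1), where [n^3] is not in [K]. Degree 2 modulo [K] is then
    a line, so [linker_or_cube] applies to homogeneous [y], and its second alternative is
    impossible. *)
Lemma condI_graded2 : (ldim n - ldim lin = 2)%N -> (ldim lin - ldim K = 2)%N ->
  (4 <= v_inv n)%N -> condI n K.
Proof.
move=> k2 d2 v4; have v3 : (3 <= v_inv n)%N by apply: ltnW.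
pose D3 := ideal_add K (ideal_exp n 3).
have D3i : is_ideal D3 by exact: ideal_add_ideal.
have lini : is_ideal lin by exact: lin_ideal.
have [HK H3 Hl] := And3 (ideal_subsp A Ki) (ideal_subsp A D3i) (ideal_subsp A lini).
have KD : K `<=` D3 by exact: ideal_addl.
have Dl : D3 `<=` lin by apply: ideal_add_mono => //; apply: ideal_exp_leq.
have lt3 : (ldim D3 < ldim lin)%N.
  apply: ldim_lt => // lD; have n2K : ideal_exp n 2 `<=` K.
    apply: (nakayama (la_nil A)) => //.
    by apply: subset_trans lD; exact: sq_lin.
  have : lin `<=` K by apply: ideal_add_min.
  by move/(ldim_mono Hl HK); lia.
have [n3K|n3K] := pselect (ideal_exp n 3 `<=` K); first exact: (@condI_122 _ _ A).
have ltK : (ldim K < ldim D3)%N.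
  by apply: ldim_lt => // DK; apply: n3K; apply: subset_trans DK; exact: ideal_addr.
have d1 : (ldim lin - ldim D3 = 1)%N by lia.
have [|L [_ LD _] DL GL|g [Gg sp _]] := @exists_basis _ _ A lin D3 (G 2) Hl H3 Dl.
- by move=> x Gx; apply: (sq_lin Ki); apply: (exp_gr loc SG).
- move=> _ [u [w [Ku nw ->]]]; apply: (LD); first by apply: DL; apply: KD.
  rewrite -(subrK (hc w 2) w); apply: (LD); last by apply: GL; exact: hcomp_gr.
  by apply: DL; apply: (ideal_addr Ki); apply: (n2_gr2 loc SG).
rewrite d1 in g Gg sp.
have G2K x : G 2 x -> exists b, K (x - sg b * g ord0).
  move=> Gx; have [|b Hb] := sp x.
  - by apply: (sq_lin Ki); apply: (exp_gr loc SG).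
  exists (b ord0); rewrite big_ord1 in Hb.
  (* The congruence holds so far modulo [K + n^3]; its degree 2 component holds modulo [K], as [K]
     is homogeneous. *)
  have Ge : G 2 (x - sg (b ord0) * g ord0).
    by apply: (grB HG) => //; rewrite -[2%N]add0n; apply: (grM HG).
  move: Hb => [u [w [Ku nw E]]].
  have := hcomp_homog HG 2 Ge; rewrite eqxx => <-.
  rewrite E hcompD (exp_hc loc SG nw) // addr0; exact: hK.
have [y [Gy spy iy]] := exists_basis_gr1.
have H i j : exists b, K (y i * y j - sg b * g ord0).
  by apply: G2K; apply: (grM HG (i := 1) (j := 1)).
have [b Hb] := choice (fun p : 'I_(ldim n - ldim lin) * 'I_(ldim n - ldim lin) => H p.1 p.2).
have [|||lk|n3] := @linker_or_cube _ _ A K Ki _ y (\matrix_(i, j) b (i, j)) (g ord0) _ _ spy iy.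
- by rewrite k2.
- by move=> i; apply: gr1_sub.
- by move=> i j; rewrite mxE; exact: (Hb (i, j)).
- by apply: (@linker_condI _ _ A) => //; rewrite k2.
- by case: n3K; apply: subset_trans n3 _; apply: ideal_mul_subr.
Qed.

Definition low_part t : set S := ideal_gen [set x | K x /\ exists2 j, (j <= t)%N & G j x].

Lemma low_part_sub t : low_part t `<=` K.
Proof. by apply: ideal_gen_min => // x []. Qed.
Lemma low_part_hc t x : K x -> ideal_add (low_part t) (ideal_exp n t.+1) x.
Proof.
move=> Kx; have Li : is_ideal (low_part t) by exact: ideal_gen_ideal.
have LEi := ideal_add_ideal Li (nexpi t.+1).
have [d [_ Ed]] := hcomp_sum HG x; rewrite Ed; apply: (idl_sum _ LEi) => i _.
case: (leqP i t) => it.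
  apply: (ideal_addl (nexpi t.+1)); apply: sub_ideal_gen; split; first exact: hK.
  by exists i => //; exact: hcomp_gr.
apply: (ideal_addr Li); apply: ideal_exp_leq it _ _; apply: (exp_gr loc SG).
exact: hcomp_gr.
Qed.

(** Generators of degree three or more are in [n K], hence redundant by Nakayama. *)
Lemma cube_maxgd : ideal_exp n 3 `<=` ideal_mul n K -> (maxgd G K < 3)%N.
Proof.
move=> n3; rewrite ltnNge; apply/negP => /least_lt; apply.
have Li : is_ideal (low_part 2) by exact: ideal_gen_ideal.
apply/seteqP; split; first exact: low_part_sub.
apply: (nakayama (la_nil A)) => // x /(low_part_hc 2).
exact: ideal_add_mono.
Qed.

(** Some degree bound works because a power of [n] vanishes, so [maxgd] is a true minimum and not
    the default value of [least]. *)
Lemma maxgd_low_part t : (maxgd G K <= t)%N -> low_part t = K.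
Proof.
move=> le; have [k nk] := la_nil A.
have H : low_part k = K.
  apply/seteqP; split; first exact: low_part_sub.
  move=> x /(low_part_hc k)[u [w [Hu Hw ->]]].
  by rewrite (nk w) ?addr0 //; apply: ideal_exp_leq (leqnSn k) _ Hw.
have E : low_part (maxgd G K) = K := @leastP [set t | low_part t = K] k H.
apply/seteqP; split; first exact: low_part_sub.
rewrite -{1}E; apply: ideal_gen_mono => x [Kx [j jt Gx]]; split=> //.
by exists j => //; apply: leq_trans le.
Qed.
End GradedIdeal.

(** * Polynomial rings and condition (II) *)

Section Noetherian.

Lemma noetherian_surj (R T : comNzRingType) (f : {rmorphism R -> T}) :
  (forall y, exists x, f x = y) -> noetherian R -> noetherian T.
Proof.
move=> fs nR C Ci Cs.
have [|i x|m Hm] := nR (fun i => [set x | C i (f x)]).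
- move=> i; split=> [|x y Hx Hy|a x Hx] /=.
  + by rewrite rmorph0; exact: idl0.
  + by rewrite rmorphD; exact: idlD.
  + by rewrite rmorphM; exact: idlMl.
- exact: Cs.
exists m => i /Hm /seteqP[H1 H2]; apply/seteqP; split=> y; have [x <-] := fs y.
  exact: H1.
exact: H2.
Qed.

Lemma chain_mono (R : comNzRingType) (C : nat -> set R) i j :
  (forall i, C i `<=` C i.+1) -> (i <= j)%N -> C i `<=` C j.
Proof.
move=> Cs /subnK <-; elim: (j - i)%N => // k IH.
by apply: subset_trans IH _; exact: Cs.
Qed.

Lemma noetherian_field (F : fieldType) : noetherian F.
Proof.
move=> C Ci Cs; have [[i [x Cx /eqP x0]]|H] := pselect (exists i, exists2 x, C i x & x <> 0).
  have T j : (i <= j)%N -> C j = setT.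
    move=> ij; apply/seteqP; split=> // y _.
    rewrite -(divfK x0 y); apply: (idlMl _ (Ci j)).
    exact: (chain_mono Cs ij).
  by exists i => j ij; rewrite !T.
have Z j : C j = [set 0].
  apply/seteqP; split=> [x Cx|_ ->]; last exact: idl0.
  by apply: contrapT => x0; apply: H; exists j, x.
by exists 0%N => j _; rewrite !Z.
Qed.

Section Hilbert.
Variable R : comNzRingType.
Hypothesis nR : noetherian R.

Definition lead_ideal (I : set {poly R}) d : set R :=
  [set r | exists p, [/\ I p, (size p <= d.+1)%N & p`_d = r]].

Lemma lead_ideal_ideal I d : is_ideal I -> is_ideal (lead_ideal I d).
Proof.
move=> Ii; split.
- by exists 0; rewrite size_poly0 coef0; split=> //; exact: idl0.
- move=> _ _ [p [Ip sp <-]] [q [Iq sq <-]]; exists (p + q); rewrite coefD; split=> //.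
    exact: idlD.
  by apply: leq_trans (size_polyD _ _) _; rewrite geq_max sp sq.
- move=> a _ [p [Ip sp <-]]; exists (a *: p); rewrite coefZ; split=> //.
    by rewrite -mul_polyC; exact: idlMl.
  by apply: leq_trans (size_scale_leq _ _) _.
Qed.
Lemma lead_idealS I d : is_ideal I -> lead_ideal I d `<=` lead_ideal I d.+1.
Proof.
move=> Ii _ [p [Ip sp <-]]; exists ('X * p); rewrite coefXM; split=> //; first exact: idlMl.
by rewrite mulrC; apply: leq_trans (size_polyMleq _ _) _; rewrite size_polyX addn2.
Qed.
Lemma lead_ideal_mono I L d : I `<=` L -> lead_ideal I d `<=` lead_ideal L d.
Proof. by move=> IL r [p [/IL Lp sp pr]]; exists p. Qed.

(** Nested ideals with the same leading coefficients in each degree are equal, by cancelling leading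
    terms; so these coefficient ideals must stabilise uniformly in the degree. *)
Lemma hilbert_basis : noetherian {poly R}.
Proof.
move=> C Ci Cs; have Cm i j := @chain_mono _ C i j Cs.
pose L i d := lead_ideal (C i) d.
have Li i d : is_ideal (L i d) by exact: lead_ideal_ideal.
have Lm i j d e : (i <= j)%N -> (d <= e)%N -> L i d `<=` L j e.
  move=> ij de; apply: subset_trans (lead_ideal_mono (Cm _ _ ij)) _.
  by apply: (chain_mono (C := L j)) de => l; exact: lead_idealS.
have [|i|m0 Hm0] := nR (C := fun i => L i i); first by [].
  by apply: Lm.
have st d : exists m, forall i, (m <= i)%N -> L i d = L m d.
  by apply: (nR (C := fun i => L i d)) => // i; apply: Lm.
have [md Hmd] := choice st.
(* The diagonal settles all degrees from [m0] on at once; the finitely many [d < m0] are settled one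
   by one. *)
pose M := maxn m0 (\max_(d < m0) md d).
have key i d : (M <= i)%N -> L i d `<=` L M d.
  move=> Mi; have [m0d|dm0] := leqP m0 d.
    apply: (@subset_trans _ (L m0 m0)); last by apply: Lm => //; exact: leq_maxl.
    rewrite -(Hm0 (maxn i d)); last by rewrite leq_max m0d orbT.
    by apply: Lm; [exact: leq_maxl|exact: leq_maxr].
  have le : (md d <= M)%N.
    apply: leq_trans (leq_maxr _ _); exact: (leq_bigmax (F := fun d : 'I_m0 => md d) (Ordinal dm0)).
  by rewrite (Hmd d i) ?(leq_trans le) // (Hmd d M).
exists M => i Mi; apply/seteqP; split; last exact: Cm.
move=> p; have [s] := ubnP (size p); elim: s p => // s IH p sp Cp.
have [->|p0] := eqVneq p 0; first exact: idl0.
have sp0 : (0 < size p)%N by rewrite size_poly_gt0.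
have [|q [Cq sq qE]] := key i (size p).-1 Mi p`_(size p).-1.
  by exists p; rewrite prednK.
rewrite -(subrK q p); apply: (idlD (Ci M)) => //; apply: IH.
  rewrite ltnS in sp; apply: leq_trans sp; rewrite -[X in (_ < X)%N](prednK sp0) ltnS.
  apply/leq_sizeP => j; rewrite leq_eqVlt => /predU1P[<-|lt]; first by rewrite coefB qE subrr.
  rewrite coefB !nth_default ?subrr //; first by apply: leq_trans sq _.
  by rewrite -(prednK sp0).
by apply: (idlB (Ci i)) => //; apply: (Cm _ _ Mi).
Qed.
End Hilbert.

Lemma noetherian_mpoly (F : fieldType) m : noetherian {mpoly F[m]}.
Proof.
elim: m => [|m IH].
  apply: (@noetherian_surj _ _ (@mpolyC 0 F)); last exact: noetherian_field.
  by move=> p; exists p@_0; exact: mpolyKC.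
pose X : {mpoly F[m.+1]} := 'X_ord_max.
have cX : commr_rmorph (@mwiden m F) X by move=> p; exact: mulrC.
pose phi : {rmorphism {poly {mpoly F[m]}} -> {mpoly F[m.+1]}} := horner_morph cX.
apply: (@noetherian_surj _ _ (phi)); last exact: hilbert_basis.
move=> p; rewrite [p]mpolyE.
have im_sum (I : Type) (r : seq I) (f : I -> {mpoly F[m.+1]}) :
    (forall i, exists q, phi q = f i) ->
    exists q, phi q = \sum_(i <- r) f i.
  move=> H; elim: r => [|i r [q Hq]]; first by exists 0; rewrite rmorph0 big_nil.
  by have [q' Hq'] := H i; exists (q' + q); rewrite rmorphD Hq Hq' big_cons.
apply: im_sum => mon; rewrite -mul_mpolyC mpolyXE_id.
have [q Hq] : exists q, phi q = \prod_(i < m.+1) 'X_i ^+ mon i.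
  have im_prod (r : seq 'I_m.+1) : exists q, phi q = \prod_(i <- r) 'X_i ^+ mon i.
    elim: r => [|i r [q Hq]]; first by exists 1; rewrite rmorph1 big_nil.
    have [q' Hq'] : exists q', phi q' = 'X_i.
      have [j ->|->] := unliftP ord_max i; last by exists 'X; exact: horner_morphX.
      exists ('X_j)%:P; rewrite /phi /= horner_morphC /= mwidenX; congr 'X_[_].
      rewrite mnmwiden1; congr (U_(_))%MM; apply: val_inj => /=.
      by rewrite /bump leqNgt ltn_ord.
    by exists (q' ^+ mon i * q); rewrite rmorphM rmorphXn Hq Hq' big_cons.
  exact: im_prod.
exists (((p@_mon)%:MP)%:P * q).
by rewrite rmorphM Hq /phi /= horner_morphC /= mwidenC.
Qed.
End Noetherian.

(** * Quotient rings and transfer along surjections *)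

Section Quotients.

Lemma factor_rmorphism (R S T : comNzRingType) (pi : {rmorphism R -> S}) (rho : {rmorphism R -> T}) :
  (forall y, exists x, pi x = y) -> (forall x, pi x = 0 -> rho x = 0) ->
  exists f : {rmorphism S -> T}, forall x, f (pi x) = rho x.
Proof.
move=> ps ker; have [g Hg] := choice ps.
have E x y : pi x = pi y -> rho x = rho y.
  by move=> Exy; apply/eqP; rewrite -subr_eq0 -rmorphB; apply/eqP/ker; rewrite rmorphB Exy subrr.
pose f y := rho (g y).
have fE x : f (pi x) = rho x by apply: E; rewrite Hg.
have fB : zmod_morphism f.
  by move=> x y; rewrite -(Hg x) -(Hg y) -rmorphB !fE rmorphB.
have fM : monoid_morphism f.
  split=> [|x y]; first by rewrite -(rmorph1 pi) fE rmorph1.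
  by rewrite -(Hg x) -(Hg y) -rmorphM !fE rmorphM.
pose a := GRing.isZmodMorphism.Build _ _ f fB.
pose b := GRing.isMonoidMorphism.Build _ _ f fM.
pose fR : {rmorphism S -> T} := HB.pack f a b.
by exists fR.
Qed.

Lemma ring_iso_quot (S T1 T2 : comNzRingType) (f1 : {rmorphism S -> T1}) (f2 : {rmorphism S -> T2}) :
  (forall y, exists x, f1 x = y) -> (forall y, exists x, f2 x = y) ->
  (forall x, f1 x = 0 <-> f2 x = 0) -> ring_iso T1 T2.
Proof.
move=> s1 s2 E; have [g Hg] := factor_rmorphism s1 (fun x => proj1 (E x)).
have [h Hh] := factor_rmorphism s2 (fun x => proj2 (E x)).
by exists g, h => y; [have [x <-] := s1 y|have [x <-] := s2 y]; rewrite ?Hg ?Hh ?Hg.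
Qed.

Section Transfer.
Variables (S T : comNzRingType) (n K : set S) (f : {rmorphism S -> T}).
Hypotheses (fs : forall y, exists x, f x = y) (fK : forall x, f x = 0 <-> K x).
Hypotheses (Ki : is_ideal K) (Kn : K `<=` n) (loc : local_ring n).
Let ni := loc_ideal loc.

Definition image_max : set T := [set y | exists2 x, n x & f x = y].

Lemma image_maxP x : image_max (f x) <-> n x.
Proof.
split=> [[x' nx' E]|nx]; last by exists x.
apply: (idlBKr ni) nx'; apply: Kn; apply/fK.
by rewrite rmorphB E subrr.
Qed.
Lemma preim_ideal (I : set T) : is_ideal I -> is_ideal [set x | I (f x)].
Proof.
move=> Ii; split=> [|x y Hx Hy|a x Hx] /=.
- by rewrite rmorph0; exact: idl0.
- by rewrite rmorphD; exact: idlD.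
- by rewrite rmorphM; exact: idlMl.
Qed.
Lemma image_max_ideal : is_ideal image_max.
Proof.
split; first by exists 0; [exact: idl0|rewrite rmorph0].
  by move=> _ _ [x nx <-] [y ny <-]; exists (x + y); [exact: idlD|rewrite rmorphD].
by move=> a _ [x nx <-]; have [b <-] := fs a; exists (b * x); [exact: idlMl|rewrite rmorphM].
Qed.
Lemma image_local : local_ring image_max.
Proof.
have I1 : ~ image_max 1 by rewrite -(rmorph1 f) => /image_maxP; exact: loc_1.
have sub (L : set T) : is_ideal L -> ~ L 1 -> L `<=` image_max.
  move=> Li L1 y; have [x <-] := fs y => Lx; apply/image_maxP.
  apply: (loc_sub loc (preim_ideal Li)) Lx.
  by rewrite /= rmorph1.
have mx : maximal_ideal image_max.
  split=> //; first exact: image_max_ideal.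
  move=> L Li IL; have [L1|L1] := pselect (L 1); [right|left]; apply/seteqP; split=> //.
    by move=> x _; rewrite -[x]mulr1; apply: idlMl.
  exact: sub.
split=> // m [mi m1 mmax].
have [E|E] := mmax _ image_max_ideal (sub m mi m1); first by rewrite E.
by case: I1; rewrite E.
Qed.
Lemma image_artinian : artinian S -> artinian T.
Proof.
move=> art C Ci Cs; have [|i x|m Hm] := art (fun i => [set x | C i (f x)]).
- by move=> i; apply: preim_ideal.
- exact: Cs.
exists m => i /Hm /seteqP[H1 H2]; apply/seteqP; split=> y; have [x <-] := fs y.
  exact: H1.
exact: H2.
Qed.

Lemma image_socle_dim : socle_dim image_max (ideal0 T) = socle_dim n K.
Proof.
have colE x : colon (ideal0 T) image_max (f x) <-> colon K n x.
  split=> H y.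
    by move=> ny; apply/fK; rewrite rmorphM; apply: H; apply/image_maxP.
  have [z <-] := fs y => /image_maxP nz; rewrite /ideal0 /= -rmorphM; apply/fK.
  exact: H.
have basisE d (e : 'I_d -> S) : residue_basis image_max (colon (ideal0 T) image_max) (ideal0 T) (fun i => f (e i))
    <-> residue_basis n (colon K n) K e.
  have sumE (a : 'I_d -> S) : f (\sum_i a i * e i) = \sum_i f (a i) * f (e i).
    by rewrite rmorph_sum; apply: eq_bigr => i _; rewrite rmorphM.
  split=> -[H1 H2 H3]; split.
  - by move=> i; apply/colE.
  - move=> x /colE/H2[a Ha]; have [b Hb] := choice (fun i => fs (a i)).
    exists b; apply/fK; rewrite rmorphB sumE; rewrite -[RHS]Ha; congr (_ - _).
    by apply: eq_bigr => i _; rewrite Hb.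
  - move=> a Ha i; apply/image_maxP; apply: (H3 (fun i => f (a i))).
    by rewrite -sumE; apply/fK.
  - by move=> i; apply/colE.
  - move=> y; have [x <-] := fs y => /colE/H2[a Ha]; exists (fun i => f (a i)).
    by rewrite -sumE -rmorphB; apply/fK.
  - move=> a; have [b Hb] := choice (fun i => fs (a i)) => Ha i.
    rewrite -Hb; apply/image_maxP; apply: H3; apply/fK; rewrite sumE -[RHS]Ha.
    by apply: eq_bigr => j _; rewrite Hb.
rewrite /socle_dim /residue_dim; congr (xget _ _); apply/seteqP; split=> d [e He].
  have [e' He'] := choice (fun i => fs (e i)); exists e'; apply/basisE.
  by rewrite (_ : (fun i => f (e' i)) = e) //; apply/funext.
by exists (fun i => f (e i)); apply/basisE.
Qed.

Lemma image_gorenstein : artinian S -> socle_dim n K = 1%N -> exists m, artinian_gorenstein_local T m.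
Proof.
move=> art s1; exists image_max; split; [exact: image_local|exact: image_artinian|].
by rewrite image_socle_dim.
Qed.
End Transfer.
End Quotients.

Section Presentation.
Variables (P S : comNzRingType) (n : set S) (f : {rmorphism P -> S}).
Hypotheses (fs : forall y, exists x, f x = y) (loc : local_ring n) (art : artinian S).

Definition preim_set (I : set S) : set P := [set p | I (f p)].

Lemma preim_is_ideal I : is_ideal I -> is_ideal (preim_set I).
Proof. exact: preim_ideal. Qed.
Lemma preim_proper (I : set S) : ~ I 1 -> ~ preim_set I 1.
Proof. by rewrite /preim_set /= rmorph1. Qed.
Definition preim_pideal (I : set S) (Ii : is_ideal I) (I1 : ~ I 1) : pideal P :=
  PIdeal (preim_is_ideal Ii) (preim_proper I1).

Lemma quot_preim (I : set S) (Ii : is_ideal I) (I1 : ~ I 1) :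
  exists g : {rmorphism S -> quot (preim_pideal Ii I1)},
    (forall q, exists x, g x = q) /\ (forall x, g x = 0 <-> I x).
Proof.
have [pr [prs pr0]] := quot_proj (preim_pideal Ii I1).
have [p p0|g Hg] := factor_rmorphism (rho := pr) fs.
  by apply/pr0; rewrite /= /preim_set /= p0; exact: idl0.
exists g; split=> [q|x]; first by have [p <-] := prs q; exists (f p).
by have [p <-] := fs x; rewrite Hg pr0.
Qed.

Lemma quot_preim_gorenstein (I : set S) (Ii : is_ideal I) (I1 : ~ I 1) :
  socle_dim n I = 1%N -> exists m, artinian_gorenstein_local (quot (preim_pideal Ii I1)) m.
Proof.
move=> s1; have [g [gs g0]] := quot_preim Ii I1.
exact: (image_gorenstein gs g0 (loc_sub loc Ii I1) loc art s1).
Qed.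

Lemma quot_preim_iso (J : pideal S) : ring_iso (quot J) (quot (preim_pideal (carrier_ideal J) (carrier_proper (p:=J)))).
Proof.
have [g [gs g0]] := quot_preim (carrier_ideal J) (carrier_proper (p:=J)).
have [pr [prs pr0]] := quot_proj J.
by apply: (ring_iso_quot prs gs) => x; rewrite g0 pr0.
Qed.

(** As [B] maps onto [K], sending [B] into the kernel of [f] amounts to annihilating [K]. *)
Lemma colon_preim (J : pideal S) (K : set S) (B : set P) :
  colon (ideal0 S) K = J :> set S -> (forall p, B p -> K (f p)) ->
  (forall y, K y -> exists2 p, B p & f p = y) ->
  preim_set J = colon (preim_set (ideal0 S)) B.
Proof.
move=> KJ BK KB; apply/seteqP; split=> p; rewrite /preim_set /= -KJ => Hp.
  by move=> b /BK Kb; rewrite /preim_set /ideal0 /= rmorphM; apply: Hp.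
by move=> y /KB[b Bb <-]; rewrite /ideal0 /= -rmorphM; exact: Hp.
Qed.
End Presentation.

Section CondIIIntro.
Variables (S : comNzRingType) (n : set S) (A : loc_alg n) (J : pideal S) (K : set S).
Hypotheses (loc : local_ring n) (art : artinian S) (gor : socle_dim n (ideal0 S) = 1%N).
Hypotheses (Ki : is_ideal K) (Kn : K `<=` n) (KJ : colon (ideal0 S) K = J :> set S).
Variables (m : nat) (x : 'I_m -> S).
Hypotheses (nx : forall i, n (x i)) (gx : n `<=` ideal_gen (range x)).
Local Notation P := {mpoly la_F A[m]}.
Let onto : forall y, exists p, ev A x p = y := @ev_onto _ _ A _ x nx gx.

(** [A] is the kernel of the evaluation. It lies in [B^2], hence in [B], so [B] is the full preimage
    of [K], and [P / B] is [S / K], Gorenstein by its socle. *)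
Lemma condII_intro (b : seq P) : regular_seq b -> (2 <= size b)%N ->
  (forall p, ideal_gen [set` b] p -> K (ev A x p)) ->
  (forall y, K y -> exists2 p, ideal_gen [set` b] p & ev A x p = y) ->
  (forall p, ev A x p = 0 -> ideal_exp (ideal_gen [set` b]) 2 p) ->
  socle_dim n K = 1%N -> condII (quot J).
Proof.
move=> rb sb BK KB ker sK; have Bi := ideal_gen_ideal [set` b].
have K1 : ~ K 1 by move=> /Kn; exact: loc_1.
have i0 := @ideal0_ideal S; have i1 : ~ ideal0 S 1 by move/eqP; rewrite oner_eq0.
have E : preim_set (ev A x) K = ideal_gen [set` b].
  apply/seteqP; split=> p; last exact: BK.
  move=> Kp; have [q Bq Eq] := KB _ Kp.
  apply: (idlBK Bi _ Bq); have Hb : ideal_exp (ideal_gen [set` b]) 2 (p - q).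
    by apply: ker; rewrite rmorphB Eq subrr.
  by move: Hb; rewrite (ideal_exp2E Bi); apply: ideal_mul_subr.
exists P, (preim_pideal (ev A x) i0 i1), (preim_pideal (ev A x) Ki K1),
  (preim_pideal (ev A x) (carrier_ideal J) (carrier_proper (p:=J))).
split; first exact: noetherian_mpoly.
- by move=> p /= Hp; rewrite E; apply: ker.
- exact: (quot_preim_gorenstein onto loc art).
- exact: (quot_preim_gorenstein onto loc art).
split; [by exists b; split|rewrite /= E; exact: (colon_preim KJ BK KB)|].
exact: (quot_preim_iso onto).
Qed.
End CondIIIntro.

(** * Regular sequences of variables and forms *)

Section RegularSequences.
Variables (F : fieldType) (k s : nat).
Local Notation P := {mpoly F[k + s]}.
Implicit Types (p q u w : P).

Lemma gen_cat (R : comNzRingType) (s1 s2 : seq R) :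
  ideal_gen [set` s1 ++ s2] = ideal_add (ideal_gen [set` s1]) (ideal_gen [set` s2]).
Proof.
have [G1 G2] := (ideal_gen_ideal [set` s1], ideal_gen_ideal [set` s2]).
apply/seteqP; split.
  apply: ideal_gen_min; first exact: ideal_add_ideal.
  move=> y; rewrite /= mem_cat => /orP[H|H].
    by apply: (ideal_addl G2); apply: sub_ideal_gen.
  by apply: (ideal_addr G1); apply: sub_ideal_gen.
apply: ideal_add_min; first exact: ideal_gen_ideal.
  by apply: ideal_gen_mono => y; rewrite /= mem_cat => ->.
by apply: ideal_gen_mono => y; rewrite /= mem_cat => ->; rewrite orbT.
Qed.

Lemma gen_seq1 (R : comNzRingType) (a y : R) : ideal_gen [set` [:: a]] y <-> exists r, y = r * a.
Proof.
split=> [|[r ->]]; last first.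
  by apply: (idlMl _ (ideal_gen_ideal _)); apply: sub_ideal_gen; rewrite /= mem_seq1.
suff: ideal_gen [set` [:: a]] `<=` [set y | exists r, y = r * a] by apply.
apply: ideal_gen_min => [|z /=]; last by rewrite mem_seq1 => /eqP ->; exists 1; rewrite mul1r.
split=> /= [|_ _ [r ->] [t ->]|c _ [r ->]]; first by exists 0; rewrite mul0r.
  by exists (r + t); rewrite mulrDl.
by exists (c * r); rewrite mulrA.
Qed.

Lemma gen_nil (R : comNzRingType) : ideal_gen [set` [::]] = ideal0 R.
Proof.
apply/seteqP; split; first by apply: ideal_gen_min => //; exact: ideal0_ideal.
by move=> _ ->; apply: idl0; exact: ideal_gen_ideal.
Qed.

Definition zvars : seq P := [seq 'X_(rshift k j) | j <- enum 'I_s].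

Definition zlt (i : nat) : pred 'I_(k + s) :=
  fun l => if fintype.split l is inr j then (j < i)%N else false.

Lemma zlt_r i j : zlt i (rshift k j) = (j < i)%N.
Proof. by rewrite /zlt (unsplitK (inr j)). Qed.
Lemma zltP i l : zlt i l -> exists2 j : 'I_s, (j < i)%N & l = rshift k j.
Proof. by rewrite /zlt; case: splitP => // j E ji; exists j => //; apply: val_inj. Qed.

Lemma size_zvars : size zvars = s.
Proof. by rewrite size_map size_enum_ord. Qed.
Lemma nth_zvars (j : 'I_s) : zvars`_j = 'X_(rshift k j).
Proof. by rewrite (nth_map j) ?size_enum_ord // nth_ord_enum. Qed.

Lemma gen_take_zvars i : (i <= s)%N -> ideal_gen [set` take i zvars] = varZ (zlt i).
Proof.
move=> si; apply/seteqP; split; apply: ideal_gen_mono => y /=.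
  move=> /(nthP 0)[j]; rewrite size_take size_zvars => ji.
  have {}ji : (j < i)%N by move: ji; case: (ltnP i s) => // ? ?; lia.
  rewrite nth_take // (nth_zvars (Ordinal (leq_trans ji si))) => <-.
  by exists (rshift k (Ordinal (leq_trans ji si))); rewrite //= zlt_r.
move=> [l /zltP[j ji ->] <-]; apply/(nthP 0); exists j.
  by rewrite size_take size_zvars; case: (ltnP i s).
by rewrite nth_take // nth_zvars.
Qed.

Lemma varZ_ltE : varZ (zlt s) = varZ (is_z (k:=k) (s:=s)) :> set P.
Proof.
suff E : zlt s = is_z (k:=k) (s:=s) by rewrite E.
by apply/funext => l; rewrite /zlt /is_z; case: fintype.split => // j; rewrite ltn_ord.
Qed.
Lemma gen_zvars : ideal_gen [set` zvars] = varZ (is_z (k:=k) (s:=s)).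
Proof. by rewrite -varZ_ltE -gen_take_zvars ?take_oversize ?size_zvars. Qed.

Local Notation kz := (kill (is_z (k:=k) (s:=s))).

Lemma regular_zvars (qs : seq P) :
  (forall i, (i < size qs)%N -> forall p,
     ideal_add (varZ (is_z (k:=k) (s:=s))) (ideal_gen [set` take i qs]) (p * qs`_i) ->
     ideal_add (varZ (is_z (k:=k) (s:=s))) (ideal_gen [set` take i qs]) p) ->
  ~ ideal_gen [set` zvars ++ qs] 1 -> regular_seq (zvars ++ qs).
Proof.
move=> H n1; split=> // i; rewrite size_cat size_zvars => isz p.
have [is_|si] := ltnP i s.
  rewrite take_cat nth_cat size_zvars is_ gen_take_zvars ?(ltnW is_) //.
  rewrite (nth_zvars (Ordinal is_)) => /varZP; rewrite rmorphM /= killXU zlt_r /= ltnn.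
  move/eqP; rewrite mulf_eq0 => /orP[/eqP/varZP//|].
  move=> /eqP/(congr1 (mcoeff U_(rshift k (Ordinal is_)))).
  by rewrite mcoeffXU eqxx mcoeff0 => /eqP; rewrite oner_eq0.
rewrite take_cat nth_cat size_zvars ltnNge si /= gen_cat gen_zvars.
by apply: H; rewrite ltn_subLR.
Qed.

Lemma mpolyX_neq0 mon : 'X_[mon] != 0 :> P.
Proof.
apply/eqP => /(congr1 (mcoeff mon)); rewrite mcoeffX eqxx mcoeff0 => /eqP.
by rewrite oner_eq0.
Qed.

(* [Q1] and [Q2] have no common factor, since one would divide a power of ['X_a]
   and a power of ['X_b]. *)
Lemma regular_pair (Q1 Q2 : P) (a b : 'I_(k + s)) t : a != b -> ~~ is_z a -> ~~ is_z b ->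
  kz Q1 = Q1 -> kz Q2 = Q2 -> Q1 != 0 ->
  ideal_gen [set` zvars ++ [:: Q1; Q2]] ('X_a ^+ t) ->
  ideal_gen [set` zvars ++ [:: Q1; Q2]] ('X_b ^+ t) ->
  ~ ideal_gen [set` zvars ++ [:: Q1; Q2]] 1 -> regular_seq (zvars ++ [:: Q1; Q2]).
Proof.
move=> ab za zb k1 k2 Q10 Ha Hb H1; apply: regular_zvars => // -[|[|//]] _ p /=.
  rewrite gen_nil => -[v [_ [/varZP vz -> E]]]; exists p, 0; rewrite addr0; split=> //.
  apply/varZP; have := congr1 kz E; rewrite addr0 rmorphM /= vz k1 => /eqP.
  by rewrite mulf_eq0 (negPf Q10) orbF => /eqP.
move=> [v [_ [/varZP vz /gen_seq1[r ->] E]]].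
have {E} E : kz p * Q2 = kz r * Q1.
  by have := congr1 kz E; rewrite rmorphD !rmorphM /= vz k1 k2 add0r.
have comb c : ~~ is_z c -> ideal_gen [set` zvars ++ [:: Q1; Q2]] ('X_c ^+ t) ->
    exists u w, 'X_c ^+ t = u * Q1 + w * Q2.
  move=> zc; rewrite gen_cat gen_zvars -cat1s gen_cat.
  move=> [v' [_ [/varZP vz' [_ [_ [/gen_seq1[u ->] /gen_seq1[w ->] ->]] Ec]]]].
  exists (kz u), (kz w); have := congr1 kz Ec.
  by rewrite !(rmorphD, rmorphM, rmorphXn) /= vz' add0r k1 k2 killXU (negPf zc).
(* Multiply ['X_c ^+ t = u * Q1 + w * Q2] by [kz p] and use [kz p * Q2 = kz r * Q1]. *)
have dvd c : ~~ is_z c -> ideal_gen [set` zvars ++ [:: Q1; Q2]] ('X_c ^+ t) ->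
    exists u, kz p * 'X_c ^+ t = Q1 * u.
  move=> zc /(comb c zc)[u [w ->]]; exists (kz p * u + w * kz r).
  have -> : kz p * (u * Q1 + w * Q2) = kz p * u * Q1 + w * (kz p * Q2) by ring.
  by rewrite E; ring.
have [[u Hu] [w Hw]] := (dvd a za Ha, dvd b zb Hb).
have uw : u * 'X_b ^+ t = w * 'X_a ^+ t.
  apply: (mulfI Q10); rewrite !mulrA -Hu -Hw; ring.
(* Setting ['X_a] to zero shows that it divides [u'], one factor at a time. Cancelling ['X_a ^+ t]
   afterwards makes [Q1] divide [kz p]. *)
have dvdX i (u' w' : P) : u' * 'X_b ^+ t = w' * 'X_a ^+ i -> exists v', u' = v' * 'X_a ^+ i.
  elim: i u' w' => [|i IH] u' w'; first by exists u'; rewrite expr0 mulr1.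
  rewrite exprSr mulrA => E'.
  have /varZP : kill (pred1 a) u' = 0.
    have := congr1 (kill (pred1 a)) E'.
    rewrite rmorphM rmorphXn [in RHS]rmorphM /= !killXU /= eqxx mulr0 eq_sym (negPf ab).
    by move/eqP; rewrite mulf_eq0 expf_eq0 (negPf (mpolyX_neq0 _)) andbF orbF => /eqP.
  rewrite /varZ (_ : [set 'X_j | j in _] = [set` [:: 'X_a : P]]); last first.
    apply/seteqP; split=> y /=; first by move=> [j /eqP -> <-]; rewrite mem_seq1.
    by rewrite mem_seq1 => /eqP ->; exists a => //=.
  move=> /gen_seq1[u'' Eu]; rewrite Eu in E' *.
  have [v' Ev] : exists v', u'' = v' * 'X_a ^+ i.
    apply: (IH u'' w'); apply: (mulIf (mpolyX_neq0 U_(a))).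
    by rewrite -E'; ring.
  by exists v'; rewrite Ev mulrA.
have [v' Ev] := dvdX _ _ _ uw.
exists (p - kz p), (Q1 * v'); split; first exact: varZ_kill.
  by apply/gen_seq1; exists v'; rewrite mulrC.
have -> : Q1 * v' = kz p; last by rewrite subrK.
apply: (mulIf (expf_neq0 t (mpolyX_neq0 U_(a)))).
by rewrite Hu Ev mulrA.
Qed.
End RegularSequences.

Section MonomialMembership.
Variables (F : fieldType) (m : nat).
Local Notation P := {mpoly F[m]}.

Lemma ordge_ideal t (I : set P) : is_ideal I ->
  (forall mon, (t <= mdeg mon)%N -> I 'X_[mon]) -> forall p, ordge t p -> I p.
Proof.
move=> Ii H p /ordge_msupp Hp; rewrite [p]mpolyE big_seq; apply: (idl_sum _ Ii) => mon /Hp/H Im.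
by rewrite -mul_mpolyC; apply: (idlMl _ Ii).
Qed.
Lemma mpolyX_dvd (mon : 'X_{1..m}) i : mon i != 0%N -> 'X_[mon] = 'X_[(mon - U_(i))%MM] * 'X_i :> P.
Proof. by move=> mi; rewrite -mpolyXD submK // lep1mP. Qed.
Lemma mdeg_gt0 (mon : 'X_{1..m}) : (0 < mdeg mon)%N -> exists i, mon i != 0%N.
Proof.
rewrite lt0n mdeg_eq0 => mon0; apply/existsP; apply: contraR mon0; rewrite negb_exists => /forallP H.
by apply/eqP/mnmP => i; rewrite mnm0E; apply/eqP; have := H i; rewrite negbK.
Qed.
Lemma mdeg_sub1 (mon : 'X_{1..m}) i : mon i != 0%N -> (mdeg (mon - U_(i))%MM).+1 = mdeg mon.
Proof.
move=> mi; have E : (mon - U_(i) + U_(i))%MM = mon by apply: submK; rewrite lep1mP.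
by rewrite -[in RHS]E mdegD mdeg1 addn1.
Qed.
End MonomialMembership.

(** * The case k = 1, where the quotient by K is a truncated polynomial ring in one variable *)

Section EmbDimOne.
Variables (S : comNzRingType) (n : set S) (A : loc_alg n) (J : pideal S) (K : set S).
Hypotheses (loc : local_ring n) (art : artinian S) (gor : socle_dim n (ideal0 S) = 1%N).
Hypotheses (Ki : is_ideal K) (Kn : K `<=` n) (KJ : colon (ideal0 S) K = J :> set S).
Local Notation F := (la_F A).
Local Notation sg := (la_s A).
Local Notation ldim := (ldim A).
Local Notation lin := (lin n K).
Let ni := la_ideal A.
Let c := (ldim setT - ldim K)%N.
Hypotheses (emb2 : (2 <= ldim n - ldim (ideal_exp n 2))%N) (vc : (2 * c <= v_inv n)%N).
Variables (s : nat) (y : 'I_1 -> S) (z : 'I_s -> S).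
Hypothesis cs : coord_system A K y z.
Local Notation x := (coords y z).
Local Notation idz := (idZ x (is_z (k:=1) (s:=s))).
Let idzi : is_ideal idz := idZ_ideal _ _.
Local Notation X := (y ord0).
Let nx := coords_n Kn cs.
Let gx := coords_gen cs.
Let K1 : ~ K 1. Proof. by move=> /Kn; exact: loc_1. Qed.

Lemma n_idz_X v : n v -> exists u, idz (v - X * u).
Proof.
have sp : spans A n (ideal_add idz (ideal_mul n n)) y.
  by rewrite -(ideal_exp2E ni) (idz_lin Ki cs); exact: cs_spans cs.
move=> /(spans_gen ni idzi (cs_y cs) sp)[a [_ [Ha /gen_rangeP[b ->] ->]]].
by exists (b ord0); rewrite big_ord1 mulrC addrK.
Qed.

(** Modulo [z] the ideal [n] is generated by [X], so an expansion in powers of [X] can be pursued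
    one coefficient at a time. *)
Lemma pow_decomp t v : exists a : 'I_t -> F, exists u,
  idz (v - \sum_i sg (a i) * X ^+ i - X ^+ t * u).
Proof.
elim: t => [|t [a [u Hu]]].
  by exists (fun=> 0), v; rewrite big_ord0 subr0 mul1r subrr; exact: (idl0 idzi).
have [al Hal] := la_cov A u; have [w Hw] := n_idz_X Hal.
exists (fun i => if unlift ord_max i is Some j then a j else al), w.
rewrite big_ord_recr /= unlift_none.
have -> : \sum_(i < t) sg (if unlift ord_max (widen_ord (leqnSn t) i) is Some j then a j else al) *
    X ^+ i = \sum_i sg (a i) * X ^+ i.
  apply: eq_bigr => i _; congr (sg _ * _).
  have -> : widen_ord (leqnSn t) i = lift ord_max i.
    by apply: val_inj; rewrite /= /bump leqNgt ltn_ord.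
  by rewrite liftK.
have -> : v - (\sum_i sg (a i) * X ^+ i + sg al * X ^+ t) - X ^+ t.+1 * w =
    (v - \sum_i sg (a i) * X ^+ i - X ^+ t * u) + X ^+ t * (u - sg al - X * w).
  by rewrite exprSr; ring.
by apply: (idlD idzi) => //; apply: (idlMl _ idzi).
Qed.

(** A sum whose first nonzero coefficient is that of [X ^+ i] is [X ^+ i] times a unit. The shift
    [j] carries the induction. *)
Lemma pow_low t j (a : 'I_t -> F) : K (X ^+ j * \sum_i sg (a i) * X ^+ i) ->
  (exists i, a i != 0) -> exists i : 'I_t, a i != 0 /\ K (X ^+ (i + j)).
Proof.
elim: t j a => [|t IH] j a H [i0 Hi0]; first by case: i0 {Hi0}.
have E : \sum_i sg (a i) * X ^+ i = sg (a ord0) + X * \sum_i sg (a (lift ord0 i)) * X ^+ i.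
  rewrite big_ord_recl expr0 mulr1 mulr_sumr; congr (_ + _); apply: eq_bigr => i _.
  by rewrite lift0 exprS; ring.
have [a0|a0] := eqVneq (a ord0) 0.
  have [||i [ai Ki']] := IH j.+1 (fun i => a (lift ord0 i)).
  - by move: H; rewrite E a0 rmorph0 add0r mulrA -exprSr.
  - have [i Ei|Ei] := unliftP ord0 i0; first by exists i; rewrite -Ei.
    by move: Hi0; rewrite Ei a0 eqxx.
  by exists (lift ord0 i); split=> //; rewrite lift0 addSnnS.
exists ord0; split=> //; rewrite add0n.
have [|w Hw] := @la_unit _ _ A (\sum_i sg (a i) * X ^+ i).
  move=> /(fun h => h); rewrite E => nw; move/eqP: a0; apply; apply: (la_s_eq0 (A := A)).
  rewrite -(addrK (X * \sum_i sg (a (lift ord0 i)) * X ^+ i) (sg (a ord0))).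
  by apply: (idlB ni) => //; apply: (idlMr _ ni); exact: cs_y cs _.
by have := idlMr w Ki H; rewrite -mulrA Hw mulr1.
Qed.

Lemma K_pow_ge t : K (X ^+ t) -> (c <= t)%N.
Proof.
move=> Kt; rewrite /c leq_subLR.
apply: (spans_ldim (g := fun i : 'I_t => X ^+ i)); try exact: ideal_subsp.
move=> v _; have [a [u Hu]] := pow_decomp t v; exists a.
by apply: (idlBK Ki (idz_sub Ki cs Hu)); apply: (idlMr _ Ki).
Qed.

Lemma ldimKT : (ldim K <= ldim setT)%N.
Proof. by apply: ldim_mono => //; exact: ideal_subsp. Qed.

(** Otherwise [pow_low] makes the powers up to [X ^+ c] independent modulo [K], one too many for the
    dimension [c] of [S / K]. *)
Lemma K_pow_c : K (X ^+ c).
Proof.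
apply: contrapT => Kc.
have : (ldim K + c.+1 <= ldim setT)%N.
  apply: (indep_ldim (g := fun i : 'I_c.+1 => X ^+ i)) => //; try exact: ideal_subsp.
  move=> a Ha i; apply/eqP; apply: contrapT => /negP ai; apply: Kc.
  have [||j [_ Kj]] := @pow_low c.+1 0 a; first by rewrite expr0 mul1r.
    by exists i.
  rewrite addn0 in Kj.
  have jc : (j <= c)%N by rewrite -ltnS.
  by rewrite -(subnK jc) exprD; apply: (idlMl _ Ki).
have := ldimKT; rewrite /c; lia.
Qed.

Lemma c_gt0 : (0 < c)%N.
Proof.
by rewrite lt0n; apply/eqP => c0; apply: K1; have := K_pow_c; rewrite c0.
Qed.

Lemma K_pow t : (c <= t)%N -> K (X ^+ t).
Proof. by move=> /subnK <-; rewrite exprD; apply: (idlMl _ Ki); exact: K_pow_c. Qed.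

(** The ideal generated by [z] and [X ^+ c] lies in [K] and has colength at most [c], the colength
    of [K]. *)
Lemma K_sub v : K v -> exists r, idz (v - r * X ^+ c).
Proof.
pose M := [set v | exists r, idz (v - r * X ^+ c)].
have Mi : is_ideal M.
  split=> [|u w [r Hr] [t Ht]|a u [r Hr]].
  - by exists 0; rewrite mul0r subr0; exact: (idl0 idzi).
  - by exists (r + t); rewrite mulrDl opprD addrACA; exact: (idlD idzi).
  - by exists (a * r); rewrite -mulrA -mulrBr; exact: (idlMl _ idzi).
have MK : M `<=` K.
  move=> u [r Hr]; apply: (idlBK Ki (idz_sub Ki cs Hr)).
  by apply: (idlMl _ Ki); exact: K_pow_c.
suff: K `<=` M by apply.
apply: (@ldim_eq _ _ A M K) => //; try exact: ideal_subsp.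
have : (ldim setT <= ldim M + c)%N.
  apply: (spans_ldim (g := fun i : 'I_c => X ^+ i)); try exact: ideal_subsp.
  move=> u _; have [a [w Hw]] := pow_decomp c u; exists a.
  by exists w; rewrite [w * _]mulrC.
have := ldimKT; rewrite /c; lia.
Qed.

(** Multiplying a socle element by [X] and applying [pow_low] removes all terms of its expansion
    below [X ^+ c.-1]. *)
Lemma embdim1_socle : socle_dim n K = 1%N.
Proof.
have Ci : is_ideal (colon K n) by exact: colon_ideal.
have KC : K `<=` colon K n by apply: sub_colon.
rewrite /socle_dim (residue_dimE A Ci Ki KC); last first.
  by move=> u w nu Hw; rewrite mulrC; apply: Hw.
have c1 : c = c.-1.+1 by rewrite prednK // c_gt0.
have Kc1 : ~ K (X ^+ c.-1) by move=> /K_pow_ge; rewrite {1}c1 ltnn.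
have nX : n X := cs_y cs _.
apply/esym; apply: (ldim_basis (g := fun _ : 'I_1 => X ^+ c.-1)) => //; try exact: ideal_subsp.
- move=> _ u /n_idz_X[w Hw].
  rewrite -(subrK (X * w) u) mulrDr; apply: (idlD Ki).
    by apply: (idlMl _ Ki); apply: (idz_sub Ki cs).
  rewrite mulrA -exprSr -c1; apply: (idlMr _ Ki); exact: K_pow_c.
- move=> u Cu; have [a [w Hw]] := pow_decomp c.-1.+1 u.
  rewrite big_ord_recr /= in Hw.
  exists (fun=> a ord_max); rewrite big_ord1.
  pose b i := a (widen_ord (leqnSn c.-1) i).
  have Ku : K (u - \sum_i sg (b i) * X ^+ i - sg (a ord_max) * X ^+ c.-1).
    have := idz_sub Ki cs Hw; rewrite opprD addrA => /(idlBK Ki); apply.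
    by apply: (idlMr _ Ki); apply: K_pow; rewrite -c1.
  have b0 i : b i = 0.
    apply/eqP; apply: contrapT => /negP bi.
    have [||j [_ Kj]] := @pow_low c.-1 1 b.
    - have rng (x0 w0 u0 a0 z0 : S) :
        x0 * w0 = u0 * x0 - a0 * (z0 * x0) - (u0 - w0 - a0 * z0) * x0 by ring.
      rewrite expr1 (rng _ _ u (sg (a ord_max)) (X ^+ c.-1)).
      apply: (idlB Ki); last exact: (idlMr _ Ki).
      apply: (idlB Ki); first exact: Cu.
      by rewrite -exprSr -c1; apply: (idlMl _ Ki); exact: K_pow_c.
    - by exists i.
    by have := K_pow_ge Kj; have := ltn_ord j; have := c_gt0; lia.
  by move: Ku; rewrite big1 ?subr0 // => i _; rewrite b0 rmorph0 mul0r.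
- move=> a; rewrite big_ord1 => Ha i; rewrite (ord1 i); apply/eqP; apply: contrapT => /negP a0.
  apply: Kc1; have -> : X ^+ c.-1 = sg (a 0)^-1 * (sg (a 0) * X ^+ c.-1).
    by rewrite mulrA -rmorphM mulVf // rmorph1 mul1r.
  exact: (idlMl _ Ki).
Qed.

Local Notation P := {mpoly F[1 + s]}.
Let XP : P := 'X_(lshift s ord0).
Let b : seq P := zvars F 1 s ++ [:: XP ^+ c].
Let Bi := ideal_gen_ideal [set` b].

Lemma b_mon mon : (c <= mdeg mon)%N -> ideal_gen [set` b] 'X_[mon].
Proof.
move=> cm; have [/existsP[j mj]|H] := boolP [exists j : 'I_s, mon (rshift 1 j) != 0%N].
  rewrite (mpolyX_dvd _ mj); apply: (idlMl _ Bi); apply: sub_ideal_gen.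
  by rewrite /= mem_cat; apply/orP; left; apply/mapP; exists j; rewrite ?mem_enum.
have E : mdeg mon = mon (lshift s ord0).
  rewrite mdegE big_split_ord big_ord1 /= big1 ?addn0 // => j _.
  by apply/eqP; apply: contraR H => mj; apply/existsP; exists j.
rewrite mpolyXE_id big_split_ord big_ord1 /= -E -(subnK cm) exprD.
apply: (idlMr _ Bi); apply: (idlMl _ Bi); apply: sub_ideal_gen.
by rewrite /= mem_cat mem_seq1 eqxx orbT.
Qed.

(** A factor among [zvars] leaves a monomial of degree at least [2c - 1 >= c], in the ideal by
    [b_mon]; without one, [XP ^+ c] divides twice. *)
Lemma b_mon2 mon : (2 * c <= mdeg mon)%N -> ideal_exp (ideal_gen [set` b]) 2 'X_[mon].
Proof.
move=> cm; have [/existsP[j mj]|H] := boolP [exists j : 'I_s, mon (rshift 1 j) != 0%N].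
  rewrite (mpolyX_dvd _ mj); apply: ideal_exp2 => //.
    by apply: b_mon; have := mdeg_sub1 mj; have := c_gt0; lia.
  apply: sub_ideal_gen.
  by rewrite /= mem_cat; apply/orP; left; apply/mapP; exists j; rewrite ?mem_enum.
have E : mdeg mon = mon (lshift s ord0).
  rewrite mdegE big_split_ord big_ord1 /= big1 ?addn0 // => j _.
  by apply/eqP; apply: contraR H => mj; apply/existsP; exists j.
have B2i := ideal_exp_ideal (ideal_gen [set` b]) 2.
rewrite mpolyXE_id big_split_ord big_ord1 /= -E -(subnK cm) exprD mul2n -addnn exprD.
apply: (idlMr _ B2i); apply: (idlMl _ B2i); apply: ideal_exp2 => //.
  by apply: sub_ideal_gen; rewrite /= mem_cat mem_seq1 eqxx orbT.
by apply: sub_ideal_gen; rewrite /= mem_cat mem_seq1 eqxx orbT.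
Qed.

Lemma condII_embdim1 : condII (quot J).
Proof.
have ev_b p : ideal_gen [set` b] p -> K (ev A x p).
  suff: ideal_gen [set` b] `<=` preim_set (ev A x) K by apply.
  apply: ideal_gen_min; first exact: preim_is_ideal.
  move=> q; rewrite /= mem_cat mem_seq1 => /orP[/mapP[j _ ->]|/eqP ->]; rewrite /preim_set /=.
    by rewrite evXU coords_r; exact: cs_z cs j.
  by rewrite rmorphXn /= evXU coords_l; exact: K_pow_c.
apply: (@condII_intro S n A J K loc art gor Ki Kn KJ _ x nx gx b) => //.
- apply: regular_zvars.
    move=> [|//] _ p /=; rewrite gen_nil => -[v [_ [/varZP vz -> E]]].
    exists p, 0; rewrite addr0; split=> //; apply/varZP.
    have := congr1 (kill (is_z (k:=1) (s:=s))) E.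
    rewrite addr0 rmorphM rmorphXn /= vz killXU is_z_l => /eqP.
    by rewrite mulf_eq0 expf_eq0 (negPf (mpolyX_neq0 _ _)) andbF orbF => /eqP.
  by move=> /ev_b; rewrite rmorph1.
(* The length [s + 1] of [b] is the embedding dimension, at least two. *)
- by rewrite size_cat size_zvars addn1; have := cs_dim cs; lia.
- move=> v /K_sub[r Hr]; have [p Vp Ep] := idZ_ev A nx gx Hr.
  have [q Eq] := ev_onto A nx gx r.
  exists (p + q * XP ^+ c); last first.
    by rewrite rmorphD rmorphM rmorphXn /= evXU coords_l Ep Eq subrK.
  apply: (idlD Bi); last first.
    by apply: (idlMl _ Bi); apply: sub_ideal_gen; rewrite /= mem_cat mem_seq1 eqxx orbT.
  by rewrite /b gen_cat; apply: (ideal_addl (ideal_gen_ideal _)); rewrite gen_zvars.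
- move=> p Ep; apply: (ordge_ideal (ideal_exp_ideal _ 2) b_mon2).
  apply: (ordge_leq vc); apply: (ev_ordgeP nx gx (cs_dim cs)) => //.
  by rewrite Ep; apply: idl0; exact: ideal_exp_ideal.
- exact: embdim1_socle.
Qed.
End EmbDimOne.

Section PolynomialMaps.
Variable F : fieldType.

Lemma mpoly_rmorph_ext m (T : comNzRingType) (f g : {rmorphism {mpoly F[m]} -> T}) :
  (forall c, f c%:MP = g c%:MP) -> (forall i, f 'X_i = g 'X_i) -> f =1 g.
Proof.
move=> fgC fgX p; rewrite [p]mpolyE !rmorph_sum; apply: eq_bigr => mon _.
rewrite -mul_mpolyC !rmorphM fgC; congr (_ * _); rewrite mpolyXE_id !rmorph_prod.
by apply: eq_bigr => i _; rewrite !rmorphXn /= fgX.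
Qed.

Lemma dhomog_bigprod m (I : finType) (f : I -> {mpoly F[m]}) (d : I -> nat) :
  (forall i, f i \is (d i).-homog) -> \prod_i f i \is (\sum_i d i)%N.-homog.
Proof.
move=> H; elim/big_ind2: _ => [|p i q j hp hq|//]; first exact: dhomog1.
exact: dhomogM.
Qed.

Lemma mmap_homog a b (h : 'I_a -> {mpoly F[b]}) t p : (forall i, h i \is 1.-homog) ->
  p \is t.-homog -> mmap (@mpolyC b F) h p \is t.-homog.
Proof.
move=> hh /dhomogP hp; rewrite /mmap big_seq; apply: rpred_sum => mon /hp mt.
rewrite mul_mpolyC; apply: rpredZ; rewrite -mt /= mdegE; apply: dhomog_bigprod => i.
by have := dhomogMn (mon i) (hh i); rewrite mul1n.
Qed.

Variables k s : nat.
Definition incl_vars : {rmorphism {mpoly F[k]} -> {mpoly F[k + s]}} :=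
  comp_mpoly [tuple 'X_(lshift s i) | i < k].
Definition drop_vars : {rmorphism {mpoly F[k + s]} -> {mpoly F[k]}} :=
  mmap (@mpolyC k F) (fun i => if fintype.split i is inl a then 'X_a else 0).

Lemma incl_varsC c : incl_vars c%:MP = c%:MP.
Proof. exact: comp_mpolyC. Qed.
Lemma incl_varsX i : incl_vars 'X_i = 'X_(lshift s i).
Proof. by rewrite /incl_vars /= comp_mpolyXU -tnth_nth tnth_mktuple. Qed.
Lemma incl_drop p : incl_vars (drop_vars p) = kill (is_z (k:=k) (s:=s)) p.
Proof.
apply: (mpoly_rmorph_ext (f := incl_vars \o drop_vars)) => [c|i] /=.
  by rewrite /kill /drop_vars /= !mmapC; exact: comp_mpolyC.
rewrite killXU /drop_vars /= mmapX mmap1U /is_z.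
by case: splitP => [a Ea|a Ea]; rewrite ?rmorph0 //; rewrite incl_varsX; congr 'X_[U_(_)]; apply: val_inj.
Qed.
Lemma incl_homog t p : p \is t.-homog -> incl_vars p \is t.-homog.
Proof.
move=> hp; apply: mmap_homog hp => i; rewrite tnth_mktuple.
by rewrite dhomogX /= mdeg1.
Qed.
Lemma drop_homog t p : p \is t.-homog -> drop_vars p \is t.-homog.
Proof.
move=> hp; apply: mmap_homog hp => i.
by case: fintype.split => a; rewrite ?dhomogX /= ?mdeg1 // dhomog0.
Qed.
Lemma kill_incl p : kill (is_z (k:=k) (s:=s)) (incl_vars p) = incl_vars p.
Proof.
apply: (mpoly_rmorph_ext (f := kill (is_z (k:=k) (s:=s)) \o incl_vars)) => [c|i] /=.
  by rewrite !incl_varsC /kill /= mmapC.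
by rewrite !incl_varsX killXU is_z_l.
Qed.
Lemma incl_inj p : incl_vars p = 0 -> p = 0.
Proof.
move=> /(congr1 drop_vars); rewrite rmorph0 => E.
rewrite -[LHS](_ : drop_vars (incl_vars p) = p) //.
apply: (mpoly_rmorph_ext (f := drop_vars \o incl_vars) (g := idfun)) => [c|i] /=.
  by rewrite incl_varsC /drop_vars /= mmapC.
by rewrite incl_varsX /drop_vars /= mmapX mmap1U (unsplitK (inl i)).
Qed.
End PolynomialMaps.
Arguments incl_vars {F} k s.
Arguments drop_vars {F} k s.

(** * The quadrics in K *)

Section Quadrics.
Variables (S : comNzRingType) (n : set S) (A : loc_alg n) (K : set S).
Hypotheses (Ki : is_ideal K) (Kn : K `<=` n).
Local Notation F := (la_F A).
Local Notation sg := (la_s A).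
Let ni := la_ideal A.
Local Notation ldim := (ldim A).
Local Notation lin := (lin n K).
Variables (k' s : nat).
Local Notation k := k'.+1.
Variables (y : 'I_k -> S) (z : 'I_s -> S).
Hypothesis cs : coord_system A K y z.
Local Notation x := (coords y z).
Local Notation idz := (idZ x (is_z (k:=k) (s:=s))).
Let idzi : is_ideal idz := idZ_ideal _ _.
Let nx := coords_n Kn cs.
Let gx := coords_gen cs.

Lemma ev_incl p : ev A x (incl_vars k s p) = ev A y p.
Proof.
apply: (mpoly_rmorph_ext (f := ev A x \o incl_vars k s)) => [c|i] /=.
  by rewrite incl_varsC !evC.
by rewrite incl_varsX !evXU coords_l.
Qed.
Lemma ev_drop p : idz (ev A x p - ev A y (drop_vars k s p)).
Proof.
rewrite -ev_incl incl_drop -rmorphB; apply: ev_varZ; exact: varZ_kill.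
Qed.

Lemma sq_ev w : ideal_exp n 2 w ->
  exists2 p : {mpoly F[k]}, p \is 2.-homog & ideal_add idz (ideal_exp n 3) (w - ev A y p).
Proof.
move=> /(ev_homog_surj A nx gx)[p hp Hp]; exists (drop_vars k s p); first exact: drop_homog.
exists (ev A x p - ev A y (drop_vars k s p)), (w - ev A x p); split=> //.
  exact: ev_drop.
by rewrite [RHS]addrC addrA subrK.
Qed.

Hypotheses (n3K : ideal_exp n 3 `<=` K) (d1 : (ldim lin - ldim K = 1)%N).

Lemma n2_notin_K : ~ ideal_exp n 2 `<=` K.
Proof.
move=> n2K; have : lin `<=` K by apply: ideal_add_min.
move/(ldim_mono (ideal_subsp A (lin_ideal n Ki)) (ideal_subsp A Ki)); lia.
Qed.

(** As [lin / K] is a line, the quadratic forms with value in [K] are a hyperplane in the space of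
    all of them, of dimension ['C(2 + k', 2)] for [k = k' + 1] variables: two quadrics for [k = 2],
    five for [k = 3]. *)
Lemma quadrics : exists q : 'I_('C(2 + k', 2)).-1 -> {mpoly F[k]},
  [/\ forall i, q i \is 2.-homog, forall c : 'I_('C(2 + k', 2)).-1 -> F,
        \sum_i c i *: q i = 0 -> forall i, c i = 0,
      forall i, K (ev A y (q i))
    & forall v, K v -> exists a, ideal_add idz (ideal_exp n 3) (v - \sum_i sg (a i) * ev A y (q i))].
Proof.
pose V := dhomog k F 2.
have n3i := ideal_exp_ideal n 3.
have IK : ideal_add idz (ideal_exp n 3) `<=` K.
  by apply: ideal_add_min => //; exact: (idz_sub Ki cs).
have evL (a : F) (u v : V) : ev A y (a *: u + v : V) = sg a * ev A y u + ev A y v.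
  by rewrite linearP rmorphD /= evZ.
have mp0 : (0 : V) = 0 :> {mpoly F[k]} by [].
have E0 : ev A y (0 : V) = 0 by rewrite mp0 rmorph0.
have [||U HU] := @vspace_of_pred F V [set p : V | K (ev A y p)].
- exact: (eq_ind_r K (idl0 Ki) E0).
- move=> a u v /= Ku Kv; rewrite evL; apply: (idlD Ki) => //; exact: (idlMl _ Ki).
have [w nw Kw] : exists2 w, ideal_exp n 2 w & ~ K w.
  by apply: contrapT => H; apply: n2_notin_K => w nw; apply: contrapT => ?; apply: H; exists w.
have [p0 hp0 Hp0] := sq_ev nw.
pose P0 : V := DHomog hp0.
have KP0 : ~ K (ev A y P0) by move=> H; apply: Kw; apply: (idlBK Ki (IK _ Hp0)).
have ev_lin (p : V) : lin (ev A y p).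
  apply: (sq_lin Ki); apply: (@ev_ordge S n A _ y (cs_y cs)); apply: ordge_homog.
  exact: dhomog_is_dhomog.
have lin1 : lin `<=` addl A K (ev A y P0).
  have Hl := ideal_subsp A (lin_ideal n Ki); have HK := ideal_subsp A Ki.
  apply: (ldim_eq (addl_subsp _ HK) Hl); first exact: (addl_min Hl (sub_lin n (K:=K)) (ev_lin P0)).
  by rewrite ldim_addl //; lia.
have P00 : P0 != 0 by apply: contra_notN KP0 => /eqP ->; exact: (eq_ind_r K (idl0 Ki) E0).
have disj : (U :&: <[P0]> = 0)%VS.
  apply/eqP; rewrite -subv0; apply/subvP => u; rewrite memv_cap memv0.
  move=> /andP[/HU /= Ku /vlineP[a E]]; rewrite E in Ku *.
  have [->|a0] := eqVneq a 0; first by rewrite scale0r.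
  case: KP0; have := evL a P0 0; rewrite addr0 E0 addr0 => E2.
  have -> : ev A y P0 = sg a^-1 * ev A y (a *: P0 : V).
    by rewrite E2 mulrA -rmorphM mulVf // rmorph1 mul1r.
  exact: (idlMl _ Ki).
have full : (U + <[P0]> = fullv)%VS.
  apply/eqP; rewrite eqEsubv subvf; apply/subvP => u _.
  have [a Ha] := lin1 _ (ev_lin u).
  rewrite -(subrK (a *: P0) u) memv_add ?memvZ ?memv_line //.
  have E : ev A y (u - a *: P0 : V) = ev A y u - sg a * ev A y P0.
    by rewrite addrC -scaleNr evL rmorphN mulNr addrC.
  by apply/HU; rewrite -E in Ha.
have dU : \dim U = ('C(2 + k', 2)).-1.
  have := dimv_disjoint_sum disj; rewrite full dimvf dim_vline P00 addn1 => E.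
  by have E' : 'C(2 + k', 2) = (\dim U).+1 := E; rewrite E'.
rewrite -dU; pose q (i : 'I_(\dim U)) : V := (vbasis U)`_i.
exists q; split.
- by move=> i; exact: dhomog_is_dhomog.
- move=> a E i; have /freeP := basis_free (vbasisP U); apply.
  apply: val_inj; apply: etrans E.
  by apply: etrans (raddf_sum (@mpoly_of_dhomog k F 2) _ _ _) _.
- move=> i; apply/HU; apply: vbasis_mem; apply: mem_nth; by rewrite size_tuple.
move=> v Kv; have := sub_lin n Kv; rewrite -(idz_lin Ki cs) => -[u [w' [Hu nw' Ev]]].
have [p hp Hp] := sq_ev nw'.
pose p' : V := DHomog hp.
have p'U : p' \in U.
  apply/HU => /=; apply: (idlBKr Ki (IK _ Hp)).
  have -> : w' = v - u by rewrite Ev addrC addKr.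
  by apply: (idlB Ki) => //; exact: (idz_sub Ki cs).
exists (fun i => coord (vbasis U) i p').
have -> : \sum_i sg (coord (vbasis U) i p') * ev A y (q i) = ev A y p.
  have -> : p = p' by [].
  rewrite [in RHS](coord_vbasis p'U) (raddf_sum (@mpoly_of_dhomog k F 2)) rmorph_sum.
  by apply: eq_bigr => i _; rewrite -evZ.
rewrite Ev; case: Hp => a [b [Ha Hb Eb]]; exists (u + a), b; split=> //.
  exact: (idlD idzi).
by rewrite -addrA Eb addrA.
Qed.
End Quadrics.

Section NoLinker.
Variables (S : comNzRingType) (n : set S) (A : loc_alg n) (K : set S).
Hypotheses (Ki : is_ideal K) (Kn : K `<=` n).
Local Notation sg := (la_s A).
Local Notation ldim := (ldim A).
Local Notation lin := (lin n K).
Let ni := la_ideal A.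
Let lini : is_ideal lin := lin_ideal n Ki.

(** Complete a linker [a] by [w]. Then [a^2] and [a w] are in [K] but [w^2] is not, so [K] lies in
    [(z, a) + n^3] and [n K] in [(z, a) + n^4]. In degree 3, below [v_inv n], this excludes [w^3],
    which is in [n^3]. *)
Lemma cube_no_linker : (ldim n - ldim lin = 2)%N -> (ldim lin - ldim K = 1)%N ->
  ideal_exp n 3 `<=` ideal_mul n K -> (4 <= v_inv n)%N -> ~ linker n K.
Proof.
move=> k2 d1 n3 v4 [a [na la aK]].
have [Hn Hl HK] := And3 (ideal_subsp A ni) (ideal_subsp A lini) (ideal_subsp A Ki).
have ln := lin_sub A Kn.
have d2 : (2 <= ldim n - ldim lin)%N by rewrite k2.
have [w nw ind] := indep_pair lini (sq_lin Ki) ln d2 na la.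
have Ha := addl_subsp a Hl; have Haw := addl_subsp w Ha.
have waddl : ~ addl A lin a w.
  move=> [c Hc]; have [] := ind (- sg c) 1; last by move=> _ /(la_1 A).
  by rewrite mul1r mulNr addrC.
have nsp : n `<=` addl A (addl A lin a) w.
  apply: (ldim_eq Haw Hn).
    by apply: (addl_min Hn) nw; apply: (addl_min Hn ln na).
  by rewrite !ldim_addl //; lia.
pose y (i : 'I_2) := if i == ord0 then a else w.
have E1 : lift ord0 (ord0 : 'I_1) = ord_max :> 'I_2 by apply: val_inj.
have [||||s [z [cs _]]] := @exists_coords S n A K Ki Kn K 2 y (fun _ h => h).
- by move=> L _ _; apply.
- by move=> i; rewrite /y; case: ifP.
- move=> u /nsp[c [d Hd]]; exists (fun i => if i == ord0 then d else c).
  rewrite big_ord_recl big_ord1 /y !eqxx E1 /= opprD addrA addrAC; exact: Hd.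
- move=> c; rewrite big_ord_recl big_ord1 /y eqxx E1 /= => /ind[/la_s_eq0 c0 /la_s_eq0 c1] i.
  by case: (unliftP ord0 i) => [j ->|->]; rewrite ?(ord1 j) ?E1.
have ya : y ord0 = a by rewrite /y eqxx.
have yw : y ord_max = w by [].
have n3K : ideal_exp n 3 `<=` K by apply: subset_trans n3 _; apply: ideal_mul_subr.
have idzK := idz_sub Ki cs.
set idz := idZ _ _ in idzK.
have IK : ideal_add idz (ideal_exp n 3) `<=` K by apply: ideal_add_min.
pose Iy := idZ (coords y z) (Zy (s:=s) ord0).
have Iyi : is_ideal Iy by exact: idZ_ideal.
have idzIy : idz `<=` Iy by exact: idz_idzy.
have yIy : Iy a by rewrite -ya; exact: y_idzy.
have quadK al be ga : K (sg ga * (w * w)) -> K (quad y al be ga ord0 ord_max).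
  rewrite /quad ya yw => Kw; apply: (idlD Ki) => //; apply: (idlD Ki); apply: (idlMl _ Ki); exact: aK.
have w2 : ~ K (w * w).
  move=> Kw; have n2K : ideal_exp n 2 `<=` K.
    move=> u /(sq_lin Ki)/(sq_span Ki cs)[al [be [ga Hq]]].
    by apply: (idlBK Ki (IK _ Hq)); apply: quadK; apply: (idlMl _ Ki).
  have : lin `<=` K by apply: ideal_add_min.
  by move/(ldim_mono Hl HK); lia.
have KIy : K `<=` ideal_add Iy (ideal_exp n 3).
  move=> u Ku; have [al [be [ga Hq]]] := sq_span Ki cs (sub_lin n Ku).
  have Kq : K (quad y al be ga ord0 ord_max) by apply: (idlBKr Ki (IK _ Hq)).
  have ga0 : ga = 0.
    apply/eqP; apply: contrapT => /negP ga0; apply: w2.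
    have -> : w * w = sg ga^-1 * (sg ga * (w * w)) by rewrite mulrA -rmorphM mulVf // rmorph1 mul1r.
    apply: (idlMl _ Ki); move: Kq; rewrite /quad ya yw => H.
    rewrite -(addKr (sg al * (a * a) + sg be * (a * w)) (sg ga * (w * w))) addrC.
    apply: (idlB Ki) => //.
    by apply: (idlD Ki); apply: (idlMl _ Ki); exact: aK.
  move: Hq; rewrite ga0 /quad rmorph0 mul0r addr0 ya yw => -[p [r [Hp Hr E]]].
  exists (p + (sg al * (a * a) + sg be * (a * w))), r; split=> //.
    apply: (idlD Iyi); first exact: idzIy.
    by apply: (idlD Iyi); apply: (idlMl _ Iyi); apply: (idlMr _ Iyi).
  by rewrite addrAC -E subrK.
have nKIy : ideal_mul n K `<=` ideal_add Iy (ideal_exp n 4).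
  apply: ideal_mul_min; first by apply: ideal_add_ideal => //; exact: ideal_exp_ideal.
  move=> u v nu /KIy[p [r [Hp Hr ->]]]; rewrite mulrDr; exists (u * p), (u * r); split=> //.
    exact: (idlMl _ Iyi).
  exact: ideal_expS.
have nw1 : ideal_exp n 1 w by rewrite ideal_exp1.
have H3 : ideal_add Iy (ideal_exp n 4) (w * w * w).
  apply: nKIy; apply: n3; rewrite mulrC; apply: ideal_expS => //; exact: ideal_exp2.
have ab : (ord0 : 'I_2) != ord_max by [].
have := @sq_cancel S n A K Ki Kn s y z cs ord0 ord_max 1 w ab.
rewrite yw => /(_ v4 nw1 H3); rewrite -yw.
exact: (y_notin_idzy Ki cs ab).
Qed.

(** The socle of [S / K] is [lin / K]: a socle element outside [lin] would be a linker, and [n^3] in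
    [K] makes all of [lin] socle. *)
Lemma socle_no_linker : (1 <= ldim n - ldim lin)%N -> (ldim lin - ldim K = 1)%N ->
  ideal_exp n 3 `<=` K -> ~ linker n K -> socle_dim n K = 1%N.
Proof.
move=> k1 d1 n3K nl; have Ci : is_ideal (colon K n) by exact: colon_ideal.
have KC : K `<=` colon K n by apply: sub_colon.
rewrite /socle_dim (residue_dimE A Ci Ki KC); last first.
  by move=> u w nu Hw; rewrite mulrC; apply: Hw.
suff -> : colon K n = lin by [].
apply/seteqP; split.
  move=> a Ca; apply: contrapT => la; apply: nl; exists a; split=> //.
  apply: contrapT => na; have [a' aa'] := la_unit A na.
  have nK : n `<=` K.
    move=> u nu; have := idlMl a' Ki (Ca _ nu).
    by rewrite mulrA [a' * a]mulrC aa' mul1r.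
  have : n `<=` lin by apply: subset_trans nK (sub_lin n (K:=K)).
  by move/(ldim_mono (ideal_subsp A ni) (ideal_subsp A lini)); lia.
apply: ideal_add_min => // u nu v nv; apply: n3K; rewrite mulrC.
exact: ideal_expS.
Qed.
End NoLinker.

Section Homogeneous.
Variables (F : fieldType) (m : nat).
Local Notation P := {mpoly F[m]}.
Implicit Types (p q l : P).

Lemma pihomog_mulr t d l q : q \is d.-homog ->
  pihomog mdeg (t + d) (l * q) = pihomog mdeg t l * q.
Proof.
move=> hq; rewrite {1}[l]mpolyE mulr_suml linear_sum pihomogE mulr_suml [RHS]big_mkcond.
apply: eq_bigr => mon _; rewrite -scalerAl linearZ /=.
have h : 'X_[mon] * q \is (mdeg mon + d).-homog by apply: dhomogM => //; rewrite dhomogX.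
have [E|ne] := eqVneq (mdeg mon) t; first by rewrite -E pihomog_dE // scalerAl.
by rewrite (pihomog_ne0 _ h) ?scaler0 // eqn_add2r.
Qed.

Lemma pihomog_ordge t p : ordge t.+1 p -> pihomog mdeg t p = 0.
Proof.
move=> Hp; apply/mpolyP => mon; rewrite mcoeff_pihomog mcoeff0.
by case: eqP => // E; rewrite Hp // E.
Qed.

Lemma mnm_split t (mon : 'X_{1..m}) : (t <= mdeg mon)%N ->
  exists m1 m2 : 'X_{1..m}, mon = (m1 + m2)%MM /\ mdeg m1 = t.
Proof.
elim: t => [|t IH] le; first by exists 0%MM, mon; rewrite add0m mdeg0.
have [m1 [m2 [E d1]]] := IH (ltnW le).
have [i mi] : exists i, m2 i != 0%N.
  by apply: mdeg_gt0; rewrite lt0n; apply: contraTneq le => d2; rewrite E mdegD d1 d2 addn0 ltnn.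
exists (m1 + U_(i))%MM, (m2 - U_(i))%MM; split; last by rewrite mdegD mdeg1 d1 addn1.
by rewrite -addmA [(U_(i) + _)%MM]addmC submK ?lep1mP.
Qed.
End Homogeneous.

(** * The Hilbert function (1, 2, 1) with cubes in n K *)

Section Gorenstein121.
Variables (S : comNzRingType) (n : set S) (A : loc_alg n) (J : pideal S) (K : set S).
Hypotheses (loc : local_ring n) (art : artinian S) (gor : socle_dim n (ideal0 S) = 1%N).
Hypotheses (Ki : is_ideal K) (Kn : K `<=` n) (KJ : colon (ideal0 S) K = J :> set S).
Local Notation F := (la_F A).
Local Notation sg := (la_s A).
Local Notation ldim := (ldim A).
Local Notation lin := (lin n K).
Let ni := la_ideal A.
Hypotheses (k2 : (ldim n - ldim lin = 2)%N) (d1 : (ldim lin - ldim K = 1)%N)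
  (n3 : ideal_exp n 3 `<=` ideal_mul n K) (v5 : (5 <= v_inv n)%N).

(** [B] is generated by the variables of [z] and two quadrics. Relations of [S] have order at least
    five, so [n^3] in [n K] can be read on polynomials: cubic monomials are in [B]. Two more degrees
    put [(X)^5], and with it all relations, in [B^2]. *)
Lemma condII_gorenstein121 : condII (quot J).
Proof.
have K1 : ~ K 1 by move=> /Kn; exact: loc_1.
have n3K : ideal_exp n 3 `<=` K by apply: subset_trans n3 _; apply: ideal_mul_subr.
have := exists_coords0 A Ki Kn; rewrite k2 => -[s [y [z cs]]].
have nx := coords_n Kn cs; have gx := coords_gen cs.
have [] := quadrics Ki Kn cs n3K d1.
rewrite (_ : ('C(2 + 1, 2)).-1 = 2%N) // => q [hq iq Kq spq].
set x := coords y z in nx gx spq; set idz := idZ _ _ in spq.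
have idzi : is_ideal idz by exact: idZ_ideal.
have idzK : idz `<=` K := idz_sub Ki cs.
pose P := {mpoly F[2 + s]}.
pose g (i : 'I_(s + 2)) : S := match fintype.split i with inl j => z j | inr i => ev A y (q i) end.
pose Gp (i : 'I_(s + 2)) : P :=
  match fintype.split i with inl j => 'X_(rshift 2 j) | inr i => incl_vars 2 s (q i) end.
pose dg (i : 'I_(s + 2)) : nat := if fintype.split i is inl _ then 1 else 2.
have Gp_ev i : ev A x (Gp i) = g i.
  by rewrite /Gp /g; case: fintype.split => j; [by rewrite evXU /x coords_r|exact: ev_incl].
have Gp_hom i : Gp i \is (dg i).-homog.
  rewrite /Gp /dg; case: fintype.split => j; first by rewrite dhomogX /= mdeg1.
  exact: incl_homog.
have dg1 i : (1 <= dg i)%N by rewrite /dg; case: fintype.split.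
have dg2 i : (dg i <= 2)%N by rewrite /dg; case: fintype.split.
have Kg i : K (g i) by rewrite /g; case: fintype.split => j; [exact: cs_z cs j|exact: Kq].
have Gi := ideal_gen_ideal (range g).
have KG : K = ideal_gen (range g).
  apply/seteqP; split; last by apply: ideal_gen_min => // _ [i _ <-]; exact: Kg.
  apply: (nakayama (la_nil A)) => // v /spq[a [p [r [Hp Hr E]]]].
  exists (p + \sum_i sg (a i) * ev A y (q i)), r; split; [|exact: n3|by rewrite addrAC -E subrK].
  apply: (idlD Gi).
    move: Hp; rewrite /idz /x idz_gen; apply: ideal_gen_mono => _ [j _ <-].
    by exists (lshift 2 j); rewrite // /g (unsplitK (inl j)).
  apply: (idl_sum _ Gi) => i _; apply: (idlMl _ Gi); apply: sub_ideal_gen.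
  by exists (rshift s i); rewrite // /g (unsplitK (inr i)).
pose Q1 := incl_vars 2 s (q ord0); pose Q2 := incl_vars 2 s (q ord_max).
pose b : seq P := zvars F 2 s ++ [:: Q1; Q2].
have Bi := ideal_gen_ideal [set` b].
have B_Gp i : ideal_gen [set` b] (Gp i).
  apply: sub_ideal_gen; rewrite /= /b mem_cat /Gp; case: fintype.split => j.
    by apply/orP; left; apply/mapP; exists j; rewrite ?mem_enum.
  apply/orP; right; rewrite !inE.
  have [->|->] : j = ord0 \/ j = ord_max.
    by case: j => [[|[|]]] // h; [left|right]; apply: val_inj.
  - by rewrite eqxx.
  - by rewrite eqxx orbT.
have B_K p : ideal_gen [set` b] p -> K (ev A x p).
  suff: ideal_gen [set` b] `<=` preim_set (ev A x) K by apply.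
  apply: ideal_gen_min; first exact: preim_is_ideal.
  move=> r; rewrite /= mem_cat !inE => /orP[/mapP[j _ ->]|/orP[] /eqP ->]; rewrite /preim_set /=.
  - by rewrite -[mmap _ _ _]/(ev A x 'X_(rshift 2 j)) evXU /x coords_r; exact: cs_z cs j.
  - by rewrite -[mmap _ _ _]/(ev A x Q1) /x ev_incl; exact: Kq.
  - by rewrite -[mmap _ _ _]/(ev A x Q2) /x ev_incl; exact: Kq.
have ker5 p : ev A x p = 0 -> ordge 5 p.
  move=> E; apply: (ev_ordgeP nx gx (cs_dim cs)) => //.
  by rewrite E; apply: idl0; exact: ideal_exp_ideal.
(* The component of degree 3 of a relation modulo the ideal of [S]. *)
have cube mon : mdeg mon = 3%N -> exists2 l : 'I_(s + 2) -> P,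
    (forall i, l i \is (3 - dg i).-homog) & 'X_[mon] = \sum_i l i * Gp i.
  move=> m3; have : ideal_mul n K (ev A x 'X_[mon]).
    by apply: n3; rewrite -m3; exact: ev_mon.
  rewrite KG => /(mul_gen_rangeP ni)[a na Ea].
  have H i : exists l, ordge 1 l /\ ev A x l = a i.
    have [|l Hl El] := @ev_surj S n A _ x nx gx 1 (a i); first by rewrite ideal_exp1.
    by exists l.
  have [l Hl] := choice H.
  have E : ev A x ('X_[mon] - \sum_i l i * Gp i) = 0.
    rewrite rmorphB rmorph_sum Ea; apply/eqP; rewrite subr_eq0; apply/eqP.
    by apply: eq_bigr => i _; rewrite rmorphM Gp_ev; have [_ <-] := Hl i.
  exists (fun i => pihomog mdeg (3 - dg i) (l i)); first by move=> i; exact: pihomogP.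
  have : pihomog mdeg 3 ('X_[mon] - \sum_i l i * Gp i) = 0.
    by apply: pihomog_ordge; apply: ordge_leq (ker5 _ E).
  rewrite linearB /= pihomog_dE; last by rewrite dhomogX /= m3.
  move/eqP; rewrite subr_eq0 => /eqP ->; rewrite linear_sum; apply: eq_bigr => i _ /=.
  rewrite -(pihomog_mulr _ _ (Gp_hom i)) subnK //; exact: leq_trans (dg2 i) _.
have B3 p : ordge 3 p -> ideal_gen [set` b] p.
  apply: (ordge_ideal Bi) => mon /mnm_split[m1 [m2 [-> /cube[l _ El]]]].
  rewrite mpolyXD El; apply: (idlMr _ Bi); apply: (idl_sum _ Bi) => i _.
  by apply: (idlMl _ Bi).
have B5 p : ordge 5 p -> ideal_exp (ideal_gen [set` b]) 2 p.
  have B2i := ideal_exp_ideal (ideal_gen [set` b]) 2.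
  apply: (ordge_ideal B2i) => mon le.
  (* [Gp i] has degree at most two, so its cofactor in degree five or more has degree at least three
     and lies in [B]. *)
  have [m1 [m2 [E m13]]] := mnm_split (t := 3) (leq_trans (isT : 3 <= 5)%N le).
  have [l hl El] := cube _ m13.
  rewrite E mpolyXD El mulr_suml; apply: (idl_sum _ B2i) => i _.
  rewrite mulrAC; apply: ideal_exp2 => //; apply: B3.
  apply: (@ordge_leq _ _ _ ((3 - dg i) + mdeg m2)%N).
    by have := dg2 i; move: le; rewrite E mdegD m13; lia.
  by apply: ordgeM; [exact: ordge_homog|exact: ordgeX].
apply: (@condII_intro S n A J K loc art gor Ki Kn KJ _ x nx gx b) => //.
(* These cubes are the powers of two variables that [regular_pair] asks for. *)
- have pw i : ideal_gen [set` b] ('X_i ^+ 3).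
    by apply: B3; rewrite mpolyXn; apply: ordgeX; rewrite mdegMn mdeg1.
  apply: (@regular_pair F 2 s Q1 Q2 (lshift s ord0) (lshift s ord_max) 3) => //.
  + by rewrite is_z_l.
  + by rewrite is_z_l.
  + exact: kill_incl.
  + exact: kill_incl.
  + apply/eqP => /incl_inj q0.
    have := iq (fun i => (i == ord0)%:R); rewrite big_ord_recl big_ord1 /= q0 scaler0 scale0r addr0.
    by move=> /(_ erefl ord0) /eqP; rewrite eqxx oner_eq0.
  + by move=> /B_K; rewrite rmorph1.
- by rewrite size_cat addnC.
- move=> v; rewrite KG => /gen_rangeP[a ->].
  have [l Hl] := choice (fun i => ev_onto A nx gx (a i)).
  exists (\sum_i l i * Gp i); first by apply: (idl_sum _ Bi) => i _; exact: (idlMl _ Bi).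
  by rewrite rmorph_sum; apply: eq_bigr => i _; rewrite rmorphM Hl Gp_ev.
- by move=> p /ker5/B5.
- apply: (@socle_no_linker S n A K) => //; first by rewrite k2.
  by apply: (@cube_no_linker S n A K) => //; apply: leq_trans v5.
Qed.
End Gorenstein121.

(** * Condition (III) *)

Section GradedEvaluation.
Variables (S : comNzRingType) (n : set S) (A : loc_alg n) (G : nat -> set S).
Hypotheses (HG : grading G) (AG : forall a, G 0 (la_s A a)).
Variables (m : nat) (x : 'I_m -> S).
Hypothesis Gx : forall i, G 1 (x i).

Lemma ev_mon_gr mon : G (mdeg mon) (ev A x 'X_[mon]).
Proof.
rewrite /ev /= mmapX /mmap1 mdegE.
elim/big_ind2: _ => [|a b c d|i _]; [exact: gr1|exact: grM|].
elim: (mon i) => [|t IH]; first exact: gr1.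
by rewrite exprS -add1n; apply: grM.
Qed.

Lemma hcomp_ev p d : hcomp HG (ev A x p) d = ev A x (pihomog mdeg d p).
Proof.
rewrite pihomogE rmorph_sum evE hcomp_bigsum [RHS]big_mkcond; apply: eq_bigr => mon _.
have H : G (mdeg mon) (la_s A p@_mon * ev A x 'X_[mon]).
  by rewrite -[mdeg mon]add0n; apply: (grM HG) => //; exact: ev_mon_gr.
by rewrite (hcomp_homog HG d H) eq_sym evZ.
Qed.

End GradedEvaluation.

Lemma homog1E (F : fieldType) m (p : {mpoly F[m]}) : p \is 1.-homog ->
  p = \sum_i p@_U_(i) *: 'X_i.
Proof.
move=> hp; apply/mpolyP => mon; rewrite raddf_sum /=.
under eq_bigr do rewrite mcoeffZ mcoeffX.
have [d|d] := eqVneq (mdeg mon) 1%N; last first.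
  rewrite (dhomog_nemf_coeff hp d) big1 // => i _.
  by case: eqP => [E|_]; rewrite ?mulr0 //; rewrite -E mdeg1 eqxx in d.
have [i /eqP Ei] := mdeg1P _ (introT eqP d).
rewrite Ei (bigD1 i) //= eqxx mulr1 big1 ?addr0 // => j ji.
by rewrite eq_mnm1 (negPf ji) mulr0.
Qed.

Section CaseIII.
Variables (S : comNzRingType) (n : set S) (G : nat -> set S).
Hypotheses (loc : local_ring n) (art : artinian S) (gor : socle_dim n (ideal0 S) = 1%N).
Hypothesis SG : standard_graded G.
Local Notation HG := (standard_graded_grading SG).
Variables (A : loc_alg n) (J : pideal S) (K : set S).
Hypotheses (Ki : is_ideal K) (Kn : K `<=` n) (KJ : colon (ideal0 S) K = J :> set S).
Hypotheses (hK : forall x i, K x -> K (hcomp HG x i)) (AG : forall a, G 0 (la_s A a)).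
Local Notation F := (la_F A).
Local Notation hc := (hcomp HG).
Local Notation ldim := (ldim A).
Local Notation lin := (lin n K).
Local Notation sg := (la_s A).
Let ni := la_ideal A.

(** If [K + n^3] were all of [K + n^2], Nakayama would put [n^2] in [K]. Being smaller, it equals
    [K], as there is only one dimension in between. *)
Lemma cube_sub : (ldim lin - ldim K = 1)%N -> ideal_exp n 3 `<=` K.
Proof.
move=> d1; pose D3 := ideal_add K (ideal_exp n 3).
have D3i : is_ideal D3 by apply: ideal_add_ideal => //; exact: ideal_exp_ideal.
have lini := lin_ideal n Ki.
have [HK H3 Hl] := And3 (ideal_subsp A Ki) (ideal_subsp A D3i) (ideal_subsp A lini).
have KD : K `<=` D3 by apply: ideal_addl; exact: ideal_exp_ideal.
have Dl : D3 `<=` lin by apply: ideal_add_mono => //; apply: ideal_exp_leq.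
have lt3 : (ldim D3 < ldim lin)%N.
  apply: ldim_lt => // lD; have n2K : ideal_exp n 2 `<=` K.
    apply: (nakayama (la_nil A)) => //; first exact: ideal_exp_ideal.
    by apply: subset_trans lD; exact: sq_lin.
  have : lin `<=` K by apply: ideal_add_min.
  by move/(ldim_mono Hl HK); lia.
have DK : D3 `<=` K.
  apply: (ldim_eq HK H3 KD); lia.
by apply: subset_trans DK; apply: ideal_addr.
Qed.

(** Cubes being in [K], [lin] lies in [colon K n]; both exceed [K] by one dimension. *)
Lemma socle1_colon : (ldim lin - ldim K = 1)%N -> socle_dim n K = 1%N -> colon K n `<=` lin.
Proof.
move=> d1 s1; have n3K := cube_sub d1.
have Ci : is_ideal (colon K n) by exact: colon_ideal.
have KC : K `<=` colon K n by apply: sub_colon.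
have lini := lin_ideal n Ki.
have [HC HK Hl] := And3 (ideal_subsp A Ci) (ideal_subsp A Ki) (ideal_subsp A lini).
have lC : lin `<=` colon K n.
  by apply: ideal_add_min => // u nu v nv; apply: n3K; rewrite mulrC; exact: ideal_expS.
move: s1; rewrite /socle_dim (residue_dimE A Ci Ki KC); last first.
  by move=> u w nu Hw; rewrite mulrC; apply: Hw.
by move=> dC; apply: (ldim_eq Hl HC lC); lia.
Qed.

Lemma exp_mgrade (k : fieldType) s t (mon : 'X_{1..3 + s}) : (t <= mdeg mon)%N ->
  ideal_exp (ideal_gen (mgrade k s 1)) t 'X_[mon].
Proof.
elim: t mon => [|t IH] mon le //.
have [i mi] : exists i, mon i != 0%N by apply: mdeg_gt0; apply: leq_trans le.
rewrite (mpolyX_dvd _ mi) mulrC; apply: ideal_mulM.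
  by apply: sub_ideal_gen; rewrite /mgrade /= dhomogX /= mdeg1.
by apply: IH; have := mdeg_sub1 mi; lia.
Qed.

Hypotheses (k3 : (ldim n - ldim lin = 3)%N) (d1 : (ldim lin - ldim K = 1)%N)
  (m2 : (maxgd G K <= 2)%N) (s1 : socle_dim n K = 1%N) (v5 : (5 <= v_inv n)%N).

(** The kernel of the evaluation at coordinates of degree one is homogeneous, and of order at least
    [v_inv n >= 5]. By [maxgd G K <= 2], the linear forms [z] and the five quadrics generate [K],
    without any assumption that [n^3] is in [n K]. *)
Lemma condIII_maxgd2 : condIII (quot J).
Proof.
have n3K := cube_sub d1.
have := @exists_basis_gr1 S n G loc SG A K Ki Kn; rewrite k3 => -[y [Gy spy iy]].
have ny i : n (y i) by exact: (gr1_sub loc SG (Gy i)).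
have [|||||s [z [cs Wz]]] := @exists_coords S n A K Ki Kn (K `&` G 1) 3 y => //.
  move=> L [_ LD _] nL WL v Kv; rewrite -(subrK (hc v 1) v); apply: LD.
    by apply: nL; apply: (n_gr1 loc SG); exact: Kn.
  by apply: WL; split; [exact: hK|exact: hcomp_gr].
have nx := coords_n Kn cs; have gx := coords_gen cs.
have [] := quadrics Ki Kn cs n3K d1.
rewrite (_ : ('C(2 + 2, 2)).-1 = 5%N) // => q [hq iq Kq spq].
have Gx i : G 1 (coords y z i).
  by rewrite /coords; case: fintype.split => j; [exact: Gy|case: (Wz j)].
have evI p : ev A (coords y z) (in_X s p) = ev A y p by exact: ev_incl.
set x := coords y z in nx gx spq Gx evI; set idz := idZ _ _ in spq.
have onto := ev_onto A nx gx.
have i0 := @ideal0_ideal S; have i1 : ~ ideal0 S 1 by move/eqP; rewrite oner_eq0.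
have K1 : ~ K 1 by move=> /Kn; exact: loc_1.
have ker5 p : ev A x p = 0 -> ordge 5 p.
  move=> E; apply: (ev_ordgeP nx gx (cs_dim cs)) => //.
  by rewrite E; apply: idl0; exact: ideal_exp_ideal.
pose B := ideal_add (ideal_gen (range (fun i => in_X s (q i)))) (Y_ideal F s).
have B'i := ideal_gen_ideal (range (fun i => in_X s (q i))).
have Yi : is_ideal (Y_ideal F s) := ideal_gen_ideal _.
have Bi : is_ideal B by exact: ideal_add_ideal.
have BK p : B p -> K (ev A x p).
  suff: B `<=` preim_set (ev A x) K by apply.
  have Pi := preim_is_ideal (ev A x) Ki.
  apply: ideal_add_min => //; apply: ideal_gen_min => // _ [j _ <-]; rewrite /preim_set /mkset.
  - by rewrite evI; exact: Kq.
  - by rewrite evXU /x coords_r; exact: cs_z cs j.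
pose I := ideal_gen (range z `|` range (fun i => ev A y (q i))).
have Ii : is_ideal I := ideal_gen_ideal _.
have GI : homogeneous G I.
  apply/seteqP; split; last by apply: ideal_gen_min => // v [].
  apply: ideal_gen_mono => v Hv; split; first exact: sub_ideal_gen.
  case: Hv => -[j _ <-]; first by exists 1%N; case: (Wz j).
  by exists 2%N; rewrite -(pihomog_dE (hq j)) -(hcomp_ev HG AG Gy); exact: hcomp_gr.
have KI : K `<=` I.
  rewrite -(maxgd_low_part loc A Ki hK m2).
  apply: ideal_gen_min => // v [/spq[a [p [r [Hp Hr E]]]] [j j2 Gv]].
  have {E} E : v = (p + \sum_i sg (a i) * ev A y (q i)) + r by rewrite addrAC -E subrK.
  (* [r] in [n^3] has no component of degree [j <= 2], so [v] is a component of an element of the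
     homogeneous ideal [I]. *)
  have := hcomp_homog HG j Gv; rewrite eqxx {1}E hcompD (exp_hc loc SG Hr) ?ltnS // addr0 => <-.
  apply: (homogeneous_hcomp HG j Ii GI); apply: (idlD Ii).
    move: Hp; rewrite /idz /x idz_gen; apply: ideal_gen_mono => _ [l _ <-]; left.
    by exists l.
  apply: (idl_sum _ Ii) => i _; apply: (idlMl _ Ii); apply: sub_ideal_gen; right.
  by exists i.
have KB v : K v -> exists2 p, B p & ev A x p = v.
  move=> /KI; suff: I `<=` [set v | exists2 p, B p & ev A x p = v] by apply.
  apply: ideal_gen_min.
    split=> [|_ _ [p Bp <-] [r Br <-]|a _ [p Bp <-]].
    - by exists 0; [exact: idl0|rewrite rmorph0].
    - by exists (p + r); [exact: (idlD Bi)|rewrite rmorphD].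
    have [r <-] := onto a.
    by exists (r * p); [exact: (idlMl _ Bi)|rewrite rmorphM].
  move=> _ [] [j _ <-].
    exists 'X_(rshift 3 j); last by rewrite evXU /x coords_r.
    by apply: (ideal_addr B'i); apply: sub_ideal_gen; exists j.
  exists (in_X s (q j)); last exact: evI.
  by apply: (ideal_addl Yi); apply: sub_ideal_gen; exists j.
exists F, s, q, (preim_pideal (ev A x) i0 i1),
  (preim_pideal (ev A x) (carrier_ideal J) (carrier_proper (p:=J))).
move=> P1; rewrite -/B; split=> //.
- split.
    have Pi := preim_is_ideal (ev A x) i0.
    apply/seteqP; split; last by apply: ideal_gen_min => // p [].
    move=> p /= Hp; have Hi := ideal_gen_ideal
      [set r | preim_set (ev A x) (ideal0 S) r /\ exists i, mgrade F s i r].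
    rewrite [p](pihomog_partitionE (mf := mdeg) (k := mmeasure mdeg p)) //; apply: (idl_sum _ Hi) => d _.
    apply: sub_ideal_gen; split; last by exists d; exact: pihomogP.
    by rewrite /preim_set /ideal0 /= -(hcomp_ev HG AG Gx) Hp hcomp0.
  move=> p /ker5; apply: ordge_ideal; first exact: ideal_exp_ideal.
  by move=> mon; exact: exp_mgrade.
- exact: (quot_preim_gorenstein onto loc art).
- move=> p [hp Cp].
  (* A linear form sending all variables into [B] has its value in [colon K n], hence in [lin];
     independence of [y] kills its coefficients on the first three variables. *)
  have : lin (ev A x p).
    apply: (socle1_colon d1 s1) => u /gx/gen_rangeP[a ->].
    rewrite mulr_sumr; apply: (idl_sum _ Ki) => i _; rewrite mulrCA; apply: (idlMl _ Ki).
    have <- : ev A x 'X_i = x i := evXU A x i.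
    rewrite -rmorphM; apply: BK; apply: Cp; apply: sub_ideal_gen.
    by rewrite /mgrade /= dhomogX /= mdeg1.
  have Ep := homog1E hp.
  rewrite {1}Ep rmorph_sum big_split_ord /= => Hl.
  have c0 : forall i, p@_U_(lshift s i) = 0.
    apply: iy; apply: (idlBKr (lin_ideal n Ki) _ Hl).
        under eq_bigr do rewrite -[mmap _ _ _]/(ev A x _) evZ evXU /x coords_l.
    rewrite addrAC subrr add0r; apply: sub_lin.
    apply: (idl_sum _ Ki) => j _; rewrite -[mmap _ _ _]/(ev A x _) evZ evXU /x coords_r.
    by apply: (idlMl _ Ki); exact: cs_z cs j.
  rewrite Ep big_split_ord /= big1 => [|i _]; last by rewrite c0 scale0r.
  rewrite add0r; apply: (ideal_addr B'i); apply: (idl_sum _ Yi) => j _.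
  rewrite -mul_mpolyC; apply: (idlMl _ Yi); apply: sub_ideal_gen.
  by exists j.
- split; last exact: (quot_preim_iso onto).
  exact: (colon_preim KJ BK KB).
Qed.
End CaseIII.

(** * The nine cases *)

Lemma ecast_surj (F F' : fieldType) (E : F = F') (b : F') : exists a : F, ecast K K E a = b.
Proof. by case: _ / E b => b; exists b. Qed.

Section CoefficientField.
Variables (S : comNzRingType) (n : set S).
Hypotheses (loc : local_ring n) (art : artinian S) (emb : (0 < embdim n)%N).

Lemma coef_loc_alg (T : set S) : subring_set T -> covers n T ->
  (forall x, T x -> n x -> x = 0) -> exists A : loc_alg n, forall a, T (la_s A a).
Proof.
move=> Tr Tc Tn; have [F [sg [sgT cov]]] := coef_subring_field loc Tr Tc Tn.
have [A [E HA]] := exists_loc_alg loc art emb cov.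
by exists A => b; have [a <-] := ecast_surj E b; rewrite HA.
Qed.

Lemma equichar_loc_alg : equicharacteristic n -> inhabited (loc_alg n).
Proof.
move=> eqc; have [T [Tr Tc Tn]] := exists_coef_subring loc (loc_nilp loc art) eqc.
by have [A _] := coef_loc_alg Tr Tc Tn.
Qed.

Lemma graded_loc_alg G : standard_graded G -> exists A : loc_alg n, forall a, G 0%N (la_s A a).
Proof.
move=> SG; apply: coef_loc_alg; [exact: gr0_subring SG|exact: gr0_covers loc SG|].
exact: gr0_n loc SG.
Qed.
End CoefficientField.

Section Cases.
Variables (S : comNzRingType) (n : set S) (J : pideal S) (A : loc_alg n).
Hypotheses (loc : local_ring n) (art : artinian S) (gor : socle_dim n (ideal0 S) = 1%N).
Hypothesis J0 : J <> ideal0 S :> set S.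
Local Notation ldim := (ldim A).
Local Notation K := (colon (ideal0 S) J).
Local Notation c := (colength J).
Local Notation k := (num_gen n K).
Local Notation v := (v_inv n).
Let ni := la_ideal A.

Lemma ann_ideal : is_ideal K.
Proof. by apply: colon_ideal; exact: ideal0_ideal. Qed.
Lemma ann_sub : K `<=` n.
Proof.
apply: (loc_sub loc ann_ideal) => K1; apply: J0; apply/seteqP; split.
  by move=> x /K1; rewrite mul1r.
by move=> _ ->; apply: idl0; exact: carrier_ideal.
Qed.
Lemma ann_ann : colon (ideal0 S) K = J :> set S.
Proof. by apply: (annK A gor); exact: carrier_ideal. Qed.

Lemma codimE : c = (ldim setT - ldim K)%N.
Proof. by apply: (colengthE A gor); exact: carrier_ideal. Qed.
Lemma num_gen_ann : k = (ldim n - ldim (lin n K))%N.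
Proof. exact: (num_gen_lin A ann_ideal ann_sub). Qed.
Lemma codim_split : c = (k + (ldim (lin n K) - ldim K)).+1.
Proof.
rewrite codimE num_gen_ann ldim_max; have lini := lin_ideal n ann_ideal.
have [HK Hn Hl] := And3 (ideal_subsp A ann_ideal) (ideal_subsp A ni) (ideal_subsp A lini).
have := ldim_mono HK Hl (sub_lin n (K:=K)); have := ldim_mono Hl Hn (lin_sub A ann_sub).
lia.
Qed.

Lemma num_gen_lt : (k < c)%N.
Proof. by rewrite codim_split ltnS leq_addr. Qed.

Lemma socle_dim_gt0 : (0 < socle_dim n K)%N.
Proof.
have Ci : is_ideal (colon K n) by apply: colon_ideal; exact: ann_ideal.
have KC : K `<=` colon K n by apply: sub_colon; exact: ann_ideal.
rewrite /socle_dim (residue_dimE A Ci ann_ideal KC); last first.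
  by move=> u w nu Hw; rewrite mulrC; apply: Hw.
rewrite subn_gt0; apply: ldim_lt => //; [exact: (ideal_subsp A ann_ideal)|exact: ideal_subsp|].
move=> CK; have [|x [_ Kx nx]] := ideal_socle A (@idealT_ideal S) ann_ideal.
  by move=> /(_ 1 I)/ann_sub; exact: loc_1.
by apply: Kx; apply: CK => u nu; rewrite mulrC; apply: nx.
Qed.

(** Here [K = n] by Nakayama, and the criterion applies with [a = 1] and [D = n^2]. *)
Lemma condI_maximal : (2 <= embdim n)%N -> k = 0%N -> condI n K.
Proof.
rewrite num_gen_ann => emb2 k0; have lini := lin_ideal n ann_ideal.
have nl : n `<=` lin n K.
  apply: (ldim_eq (ideal_subsp A lini) (ideal_subsp A ni) (lin_sub A ann_sub)).
  by rewrite -subn_eq0 k0.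
have Kn : K = n.
  apply/seteqP; split; first exact: ann_sub.
  apply: (nakayama (la_nil A) ni ann_ideal).
  by rewrite -(ideal_exp2E ni).
rewrite Kn; apply: (@condI_criterion S n A n (ideal_exp n 2) 1) => //.
- exact: ideal_exp_ideal.
- exact: (n2_sub A).
- by rewrite -embdimE.
- by move=> u nu; rewrite mul1r.
- by move=> u _; rewrite mul1r -(ideal_exp2E ni).
Qed.

Lemma condII_principal : (2 <= embdim n)%N -> k = 1%N -> (2 * c <= v)%N -> condII (quot J).
Proof.
rewrite num_gen_ann codimE => emb2 k1 vc; have := exists_coords0 A ann_ideal ann_sub.
rewrite k1 => -[s [y [z cs]]].
apply: (condII_embdim1 loc art gor ann_ideal ann_sub ann_ann _ vc cs).
by rewrite -embdimE.
Qed.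

Lemma condI_linker : (2 <= k)%N -> (3 <= v)%N -> linker n K -> condI n K.
Proof. by rewrite num_gen_ann; exact: linker_condI ann_ideal ann_sub. Qed.

(** By [codim_split] no dimension is left between [K] and [K + n^2]; so [n^2] is in [K], and any
    element of [n] outside [lin] is a linker. *)
Lemma condI_square : (2 <= k)%N -> k = (c - 1)%N -> (3 <= v)%N -> condI n K.
Proof.
move=> k2 kc v3; apply: condI_linker => //; have lini := lin_ideal n ann_ideal.
apply: (sq_linker (A := A) ann_ideal); first by rewrite -num_gen_ann; apply: ltnW.
apply: subset_trans (sq_lin ann_ideal) _.
apply: (ldim_eq (ideal_subsp A ann_ideal) (ideal_subsp A lini) (sub_lin n (K:=K))).
by have := codim_split; lia.
Qed.

Lemma condI_cube : (2 <= k)%N -> c = k.+2 -> ~ ideal_exp n 3 `<=` ideal_mul n K ->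
  (3 <= v)%N -> condI n K.
Proof.
move=> k2 kc n3 v3; apply: condI_linker => //.
have [| |//|/n3 []] := @linker_or_cube1 S n A K ann_ideal ann_sub.
  by rewrite -num_gen_ann.
by have := codim_split; lia.
Qed.

Lemma condII_pencil : k = 2%N -> c = 4%N -> ideal_exp n 3 `<=` ideal_mul n K ->
  (5 <= v)%N -> condII (quot J).
Proof.
move=> k2 c4 n3 v5; apply: (@condII_gorenstein121 S n A J K) => //.
- exact: ann_ideal.
- exact: ann_sub.
- exact: ann_ann.
- by rewrite -num_gen_ann.
- by have := codim_split; lia.
Qed.

Lemma condI_socle : (2 <= k)%N -> c = k.+2 -> (2 <= socle_dim n K)%N -> (3 <= v)%N -> condI n K.
Proof.
move=> k2 kc s2 v3; apply: condI_linker => //.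
apply: (@socle_linker S n A K ann_ideal) => //; last by have := codim_split; lia.
by rewrite -num_gen_ann; apply: ltnW.
Qed.

Section Graded.
Variable (G : nat -> set S).
Hypotheses (SG : standard_graded G) (hJ : homogeneous G J) (AG : forall a, G 0%N (la_s A a)).

Lemma ann_hcomp x i : K x -> K (hcomp (standard_graded_grading SG) x i).
Proof.
apply: colon_hcomp; [|exact: ideal0_ideal|].
  by move=> u j ->; exact: hcomp0.
by move=> u j; apply: homogeneous_hcomp => //; exact: carrier_ideal.
Qed.

Lemma condI_codim5_pencil : k = 2%N -> c = 5%N -> (4 <= v)%N -> condI n K.
Proof.
move=> k2 c5 v4; apply: (condI_graded2 loc ann_ideal ann_sub ann_hcomp AG) => //.
  by rewrite -num_gen_ann.
by have := codim_split; lia.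
Qed.

Lemma condI_maxgd3 : k = 3%N -> c = 5%N -> (3 <= maxgd G K)%N -> (3 <= v)%N -> condI n K.
Proof.
move=> k3 c5 m3 v3; apply: condI_cube; rewrite ?k3 //.
by move=> /(cube_maxgd loc A ann_ideal ann_hcomp); lia.
Qed.

Lemma condIII_maxgd2_socle1 : k = 3%N -> c = 5%N -> (maxgd G K <= 2)%N ->
  socle_dim n K = 1%N -> (5 <= v)%N -> condIII (quot J).
Proof.
move=> k3 c5 m2 s1 v5.
apply: (condIII_maxgd2 loc art gor ann_ideal ann_sub ann_ann ann_hcomp AG) => //.
  by rewrite -num_gen_ann.
by have := codim_split; lia.
Qed.
End Graded.
End Cases.

Section Conditions.
Variables (S : comNzRingType) (n : set S) (J : pideal S).
Hypotheses (gor : artinian_gorenstein_local S n) (eqc : equicharacteristic n).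
Hypotheses (emb2 : (2 <= embdim n)%N) (J0 : J <> ideal0 S :> set S).
Local Notation K := (colon (ideal0 S) J).
Local Notation c := (colength J).
Local Notation k := (num_gen n K).
Local Notation v := (v_inv n).

Lemma conditions_by_case :
     (k = 0%N -> condI n K) /\
     (k = 1%N -> 2 * c <= v -> condII (quot J))%N /\
     (2 <= k -> k = c - 1 -> 3 <= v -> condI n K)%N /\
     (k = 2 -> c = 4 -> ideal_exp n 3 `<=` ideal_mul n K ->
        5 <= v -> condII (quot J))%N /\
     (k = 2 -> c = 4 -> ~ (ideal_exp n 3 `<=` ideal_mul n K) ->
        4 <= v -> condI n K)%N /\
     (forall G, standard_graded G -> homogeneous G J ->
        k = 2 -> c = 5 -> 4 <= v -> condI n K)%N /\
     (forall G, standard_graded G -> homogeneous G J ->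
        k = 3 -> c = 5 -> 3 <= maxgd G K -> 3 <= v -> condI n K)%N /\
     (forall G, standard_graded G -> homogeneous G J ->
        k = 3 -> c = 5 -> 2 <= socle_dim n K -> 3 <= v -> condI n K)%N /\
     (forall G, standard_graded G -> homogeneous G J ->
        k = 3 -> c = 5 -> maxgd G K <= 2 -> socle_dim n K = 1 ->
        5 <= v -> condIII (quot J))%N.
Proof.
have [loc art s1] := gor; have emb1 := ltnW emb2.
have [A] := equichar_loc_alg loc art emb1 eqc.
split; first exact: (condI_maximal A loc J0 emb2).
split; first exact: (condII_principal A loc art s1 J0 emb2).
split; first exact: (condI_square A loc s1 J0).
split; first exact: (condII_pencil A loc art s1 J0).
split.
  by move=> k2 c4 n3 v4; apply: (condI_cube A loc s1 J0) => //; rewrite ?k2 //; exact: ltnW.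
split.
  (* Homogeneity arguments need coefficients of degree 0, so [[S]_0] replaces the coefficient field
     of [A]. *)
  move=> G SG hJ; have [B GB] := graded_loc_alg loc art emb1 SG.
  exact: (condI_codim5_pencil loc s1 J0 SG hJ GB).
split.
  move=> G SG hJ; have [B GB] := graded_loc_alg loc art emb1 SG.
  exact: (condI_maxgd3 B loc s1 J0 SG hJ).
split.
  by move=> G SG hJ k3 c5 s2 v3; apply: (condI_socle A loc s1 J0); rewrite ?k3.
move=> G SG hJ; have [B GB] := graded_loc_alg loc art emb1 SG.
exact: (condIII_maxgd2_socle1 loc art s1 J0 SG hJ GB).
Qed.

(** The bound 10 is [2 * c] for [k = 1] and [c = 5]; the other cases ask for at most 5. *)
Lemma some_condition : (1 <= c <= 4)%N \/
       (c = 5%N /\ exists G, standard_graded G /\ homogeneous G J) ->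
     (10 <= v)%N ->
     [\/ condI n K, condII (quot J) | condIII (quot J)].
Proof.
have [loc art s1] := gor; have emb1 := ltnW emb2.
have [A] := equichar_loc_alg loc art emb1 eqc.
have kc := num_gen_lt A loc s1 J0; have s0 := socle_dim_gt0 A loc J0.
have [Ha [Hb [Hc [Hd [He [Hf [Hg [Hh Hi]]]]]]]] := conditions_by_case.
move=> H v10.
have [k0|k0] := eqVneq k 0%N; first by apply: Or31; exact: Ha.
have [k1|k1] := eqVneq k 1%N.
  by apply: Or32; apply: Hb => //; case: H => [|[]]; lia.
have [kc1|kc1] := eqVneq k (c - 1)%N.
  by apply: Or31; apply: Hc => //; lia.
(* Since [k < c <= 5] and [k] is none of 0, 1, [c - 1], the pair [(k, c)] is [(2, 4)], [(2, 5)] or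
   [(3, 5)]. *)
case: H => [c4|[c5 [G [SG hJ]]]].
  have [k2 {}c4] : k = 2%N /\ c = 4%N by lia.
  have [n3|n3] := pselect (ideal_exp n 3 `<=` ideal_mul n K).
    by apply: Or32; apply: Hd => //; lia.
  by apply: Or31; apply: He => //; lia.
have [k2|k2] := eqVneq k 2%N; first by apply: Or31; apply: (Hf G) => //; lia.
have k3 : k = 3%N by lia.
have [m3|m2] := leqP 3 (maxgd G K); first by apply: Or31; apply: (Hg G) => //; lia.
have [s2|s2] := leqP 2 (socle_dim n K); first by apply: Or31; apply: (Hh G) => //; lia.
by apply: Or33; apply: (Hi G) => //; lia.
Qed.
End Conditions.

Local Open Scope nat_scope.

Theorem theorem3p1 :
  (exists v0 : nat, forall (S : comNzRingType) (n : set S) (J : pideal S),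
     artinian_gorenstein_local S n -> equicharacteristic n -> 2 <= embdim n ->
     J <> ideal0 S :> set S ->
     let K := colon (ideal0 S) J in
     let c := colength J in
     (1 <= c <= 4) \/
       (c = 5 /\ exists G, standard_graded G /\ homogeneous G J) ->
     v0 <= v_inv n ->
     [\/ condI n K, condII (quot J) | condIII (quot J)])
  /\
  (forall (S : comNzRingType) (n : set S) (J : pideal S),
     artinian_gorenstein_local S n -> equicharacteristic n -> 2 <= embdim n ->
     J <> ideal0 S :> set S ->
     let K := colon (ideal0 S) J in
     let c := colength J in
     let k := num_gen n K in
     let v := v_inv n in
     (1 <= c <= 4) \/
       (c = 5 /\ exists G, standard_graded G /\ homogeneous G J) ->
     (k = 0 -> condI n K) /\
     (k = 1 -> 2 * c <= v -> condII (quot J)) /\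
     (2 <= k -> k = c - 1 -> 3 <= v -> condI n K) /\
     (k = 2 -> c = 4 -> ideal_exp n 3 `<=` ideal_mul n K ->
        5 <= v -> condII (quot J)) /\
     (k = 2 -> c = 4 -> ~ (ideal_exp n 3 `<=` ideal_mul n K) ->
        4 <= v -> condI n K) /\
     (forall G, standard_graded G -> homogeneous G J ->
        k = 2 -> c = 5 -> 4 <= v -> condI n K) /\
     (forall G, standard_graded G -> homogeneous G J ->
        k = 3 -> c = 5 -> 3 <= maxgd G K -> 3 <= v -> condI n K) /\
     (forall G, standard_graded G -> homogeneous G J ->
        k = 3 -> c = 5 -> 2 <= socle_dim n K -> 3 <= v -> condI n K) /\
     (forall G, standard_graded G -> homogeneous G J ->
        k = 3 -> c = 5 -> maxgd G K <= 2 -> socle_dim n K = 1 ->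
        5 <= v -> condIII (quot J))).
Proof.
split.
  by exists 10 => S n J gor eqc emb2 J0; exact: some_condition.
by move=> S n J gor eqc emb2 J0 K c k v _; exact: conditions_by_case.
Qed.
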